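(* Let $\lambda=\sum_{i=1}^n m_i\omega_i$ be a dominant integral weight of $\mathfrak{sl}_{n+1}(\mathbb{C})$. Then the set of elements $f^{\mathbf{s}}v_\lambda$, $\mathbf{s}\in S(\lambda)$, forms a basis of $gr\,V(\lambda)$.
   Context: Let $\mathfrak{g}=\mathfrak{sl}_{n+1}(\mathbb{C})=\mathfrak{n}^+\oplus\mathfrak{h}\oplus\mathfrak{n}^-$ be a Cartan decomposition, with simple roots $\alpha_1,\dots,\alpha_n$ and fundamental weights $\omega_1,\dots,\omega_n$. The positive roots are $\alpha_{p,q}=\alpha_p+\dots+\alpha_q$, $1\le p\le q\le n$ (so $\alpha_{i,i}=\alpha_i$). For each positive root $\alpha$ fix a nonzero root vector $f_\alpha\in\mathfrak{n}^-_{-\alpha}$. PBW filtration: $U(\mathfrak{n}^-)_s=\mathrm{span}\{x_1\cdots x_l : x_i\in\mathfrak{n}^-,\ l\le s\}$, $gr\,U(\mathfrak{n}^-)\simeq S(\mathfrak{n}^-)$. Let $V(\lambda)$ be the irreducible $\mathfrak{g}$-module of highest weight $\lambda$ with highest weight vector $v_\lambda$, and $V(\lambda)_s=U(\mathfrak{n}^-)_s v_\lambda$. Then $gr\,V(\lambda)=\bigoplus_{s\ge0}V(\lambda)_s/V(\lambda)_{s-1}$ (with $V(\lambda)_{-1}=0$) is a cyclic $S(\mathfrak{n}^-)$-module generated by (the class of) $v_\lambda$. A multi-exponent is a tuple $\mathbf{s}=(s_\alpha)_{\alpha>0}$ of non-negative integers indexed by the positive roots; $f^{\mathbf{s}}=\prod_{\alpha>0}f_\alpha^{s_\alpha}\in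 S(\mathfrak{n}^-)$. A Dyck path is a sequence $\mathbf{p}=(\beta(0),\dots,\beta(k))$, $k\ge0$, of positive roots such that either $k=0$ and $\mathbf{p}=(\alpha_i)$ for some simple root $\alpha_i$, or $k\ge1$, $\beta(0)=\alpha_i$, $\beta(k)=\alpha_j$ for some $1\le i<j\le n$, and whenever $\beta(s)=\alpha_{p,q}$ with $s<k$, then $\beta(s+1)=\alpha_{p,q+1}$ or $\beta(s+1)=\alpha_{p+1,q}$. For $\lambda=\sum m_i\omega_i$ dominant integral, $S(\lambda)$ is the set of all multi-exponents $\mathbf{s}$ such that for every Dyck path $\mathbf{p}=(\beta(0),\dots,\beta(k))$ with $\beta(0)=\alpha_i$, $\beta(k)=\alpha_j$ one has $s_{\beta(0)}+\dots+s_{\beta(k)}\le m_i+m_{i+1}+\dots+m_j$. *)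

(* Defs.v *)
From HB Require Import structures.
From mathcomp Require Import all_boot all_order all_algebra.
From mathcomp Require Import ring_quotient generic_quotient.
From mathcomp Require Import boolp classical_sets functions reals.

Set Implicit Arguments.
Unset Strict Implicit.
Unset Printing Implicit Defensive.

Import GRing.Theory.
Local Open Scope classical_set_scope.
Local Open Scope quotient_scope.
Local Open Scope ring_scope.

Section LinearAlgebra.
Variables (K : fieldType) (V : lmodType K).

Definition submodule (A : set V) : Prop :=
  A 0 /\ forall (a : K) u w, A u -> A w -> A (a *: u + w).

Definition lin_span (A : set V) : set V :=
  [set u | exists2 r : seq (K * V),
    (forall t, t \in r -> A t.2) & u = \sum_(t <- r) t.1 *: t.2].

(* The family (b i), indexed by the i such that D i, is a basis; in
   particular it has no repetitions. *)
Definition is_basis (I : eqType) (D : set I) (b : I -> V) : Prop :=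
  (forall (r : seq I) (c : I -> K), uniq r -> (forall i, i \in r -> D i) ->
     \sum_(i <- r) c i *: b i = 0 -> forall i, i \in r -> c i = 0) /\
  (forall w, exists (r : seq I) (c : I -> K),
     (forall i, i \in r -> D i) /\ w = \sum_(i <- r) c i *: b i).

Lemma lin_span_submodule A : submodule (lin_span A).
Proof.
split; first by exists [::]; rewrite ?big_nil.
move=> a _ _ [r1 h1 ->] [r2 h2 ->].
exists ([seq (a * t.1, t.2) | t <- r1] ++ r2).
  by move=> t; rewrite mem_cat => /orP[/mapP[t' /h1 ? ->]|/h2].
rewrite big_cat big_map scaler_sumr; congr (_ + _).
by apply: eq_bigr => t _; rewrite scalerA.
Qed.

Lemma lin_span_sub (A B : set V) : A `<=` B -> lin_span A `<=` lin_span B.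
Proof. by move=> AB _ [r h ->]; exists r => // t /h /AB. Qed.

Lemma lin_span_incl (A : set V) : A `<=` lin_span A.
Proof.
move=> u Au; exists [:: (1, u)]; last by rewrite big_seq1 scale1r.
by move=> t; rewrite inE => /eqP ->.
Qed.

End LinearAlgebra.

Section AssociatedGraded.
Variables (K : fieldType) (V : lmodType K).

Record filtration := Filtration {
  fil :> nat -> set V;
  fil_submodule : forall s, submodule (fil s);
  fil_incr : forall s, fil s `<=` fil s.+1 }.

Variable F : filtration.

Definition fil_prev (s : nat) : set V :=
  if s is s'.+1 then F s' else [set 0].

Lemma fil_prev_submodule s : submodule (fil_prev s).
Proof.
case: s => [|s] /=; last exact: fil_submodule.
by split=> // a u w -> ->; rewrite scaler0 addr0.
Qed.

(* gr V = (\bigoplus_s F_s) / (\bigoplus_s F_(s-1)), where \bigoplus_s F_s is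
   realised as the finitely supported sequences x with x s in F_s. *)
Definition dsum_pred : {pred nat -> V} := fun x =>
  `[< (forall s, F s (x s)) /\ exists N, forall s, (N <= s)%N -> x s = 0 >].

Lemma dsum_submod_closed : submod_closed dsum_pred.
Proof.
split.
  by apply/asboolP; split=> [s|]; [case: (fil_submodule F s)|exists 0%N].
move=> a x y /asboolP[xF [N1 x0]] /asboolP[yF [N2 y0]]; apply/asboolP.
split=> [s|]; first by case: (fil_submodule F s) => _; apply.
exists (maxn N1 N2) => s; rewrite geq_max => /andP[h1 h2].
by rewrite -[LHS]/(a *: x s + y s) x0 // y0 // scaler0 addr0.
Qed.
HB.instance Definition _ :=
  GRing.isSubmodClosed.Build K (nat -> V) dsum_pred dsum_submod_closed.

Record dsum := Dsum { dsum_val :> nat -> V; _ : dsum_val \in dsum_pred }.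
HB.instance Definition _ := [isSub for dsum_val].
HB.instance Definition _ := [Choice of dsum by <:].
HB.instance Definition _ := [SubChoice_isSubLmodule of dsum by <:].

Definition dsum_prev : {pred dsum} := fun x =>
  `[< forall s, fil_prev s (x s) >].

Lemma dsum_prev_submod_closed : submod_closed dsum_prev.
Proof.
split; first by apply/asboolP => s; case: (fil_prev_submodule s).
move=> a x y /asboolP hx /asboolP hy; apply/asboolP => s.
by case: (fil_prev_submodule s) => _; apply.
Qed.
HB.instance Definition _ :=
  GRing.isSubmodClosed.Build K dsum dsum_prev dsum_prev_submod_closed.

Definition gr : Type := Quotient.quot dsum_prev.
HB.instance Definition _ := GRing.Zmodule.on gr.
HB.instance Definition _ := EqQuotient.on gr.

Lemma gr_eqP (x y : dsum) :
  reflect (forall s, fil_prev s (x s - y s)) (\pi_gr x == \pi_gr y).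
Proof. by rewrite -Quotient.idealrBE; apply: (iffP (asboolP _)). Qed.

Definition gr_scale (a : K) (q : gr) : gr := \pi_gr (a *: repr q).

Lemma pi_gr_scale a (x : dsum) : gr_scale a (\pi_gr x) = \pi_gr (a *: x).
Proof.
apply/eqP/gr_eqP => s; case: (fil_prev_submodule s) => h0 hl.
have /eqP/gr_eqP/(_ s) h : \pi_gr (repr (\pi_gr x)) = \pi_gr x by rewrite reprK.
rewrite -[X in fil_prev s X]/(a *: repr (\pi_gr x) s - a *: x s).
by rewrite -scalerBr -[X in fil_prev s X]addr0; apply: hl; [exact: h|exact: h0].
Qed.

Lemma pi_gr_add (x y : dsum) : \pi_gr (x + y) = \pi_gr x + \pi_gr y.
Proof. exact: Quotient.pi_add. Qed.

Fact gr_scalerA a b q : gr_scale a (gr_scale b q) = gr_scale (a * b) q.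
Proof. by elim/quotW: q => x; rewrite (pi_gr_scale b) !pi_gr_scale scalerA. Qed.
Fact gr_scale1r : left_id 1 gr_scale.
Proof. by elim/quotW=> x; rewrite pi_gr_scale scale1r. Qed.
Fact gr_scalerDr : right_distributive gr_scale +%R.
Proof.
move=> a; elim/quotW=> x; elim/quotW=> y.
by rewrite -pi_gr_add !pi_gr_scale scalerDr pi_gr_add.
Qed.
Fact gr_scalerDl q : {morph gr_scale^~ q : a b / a + b}.
Proof.
by elim/quotW: q => x a b /=; rewrite !pi_gr_scale scalerDl pi_gr_add.
Qed.
HB.instance Definition _ := GRing.Zmodule_isLmodule.Build K gr
  gr_scalerA gr_scale1r gr_scalerDr gr_scalerDl.

Definition gr_class (s : nat) (u : V) : gr :=
  \pi_gr (insubd (0 : dsum) (fun k => if k == s then u else 0)).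

Definition gr_shift (T : V -> V) (q : gr) : gr :=
  \pi_gr (insubd (0 : dsum) (fun k => if k is k'.+1 then T (repr q k') else 0)).

Lemma dsum_class s u : F s u -> (fun k => if k == s then u else 0) \in dsum_pred.
Proof.
move=> Fu; apply/asboolP; split=> [k|].
  by case: eqP => [->//|_]; case: (fil_submodule F k).
by exists s.+1 => k sk; case: eqP => // ks; rewrite ks ltnn in sk.
Qed.

Lemma dsum_shift (T : {linear V -> V}) (x : dsum) :
  (forall s u, F s u -> F s.+1 (T u)) ->
  (fun k => if k is k'.+1 then T (x k') else 0) \in dsum_pred.
Proof.
case: x => x /= /asboolP[xF [N x0]] hT; apply/asboolP; split=> [[|k]|].
- by case: (fil_submodule F 0).
- exact: hT.
- by exists N.+1 => -[//|k] /x0 ->; rewrite linear0.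
Qed.

Lemma gr_shift_class (T : {linear V -> V}) s u :
  (forall k w, F k w -> F k.+1 (T w)) -> F s u ->
  gr_shift T (gr_class s u) = gr_class s.+1 (T u).
Proof.
move=> hT Fu; apply/eqP/gr_eqP => k.
rewrite !val_insubd dsum_shift // dsum_class; last exact: hT.
have /eqP/gr_eqP h : \pi_gr (repr (gr_class s u)) = gr_class s u by rewrite reprK.
case: k => [|k]; first by rewrite subr0.
have := h k; rewrite val_insubd dsum_class // eqSS.
have -> : (if k == s then T u else 0) = T (if k == s then u else 0).
  by case: ifP => // _; rewrite linear0.
rewrite -linearB; case: k => [|k] /=; last exact: hT.
by move=> ->; rewrite linear0; case: (fil_submodule F 0).
Qed.

End AssociatedGraded.

Section SpecialLinear.
Variables (K : fieldType) (n : nat).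
Local Notation M := 'M[K]_n.+1.

Definition sl : set M := [set x | \tr x = 0].

Definition lie_bracket (x y : M) : M := x *m y - y *m x.

(* Linear forms on the subspace h are given as linear forms on M, of which only
   the restriction to h is ever used. *)
Definition root_space (h : {vspace M}) (a : M -> K) : set M :=
  [set x | sl x /\ forall y, y \in h -> lie_bracket y x = a y *: x].

(* The pair (p, q) stands for the positive root
   alpha_p + alpha_(p+1) + ... + alpha_q. *)
Definition posroot := {b : 'I_n * 'I_n | b.1 <= b.2}%N.
HB.instance Definition _ := Finite.on posroot.

Definition root_fst (b : posroot) : 'I_n := (val b).1.
Definition root_snd (b : posroot) : 'I_n := (val b).2.

Definition root_form (alpha : 'I_n -> {scalar M}) (b : posroot) : M -> K :=
  fun y => \sum_(i < n | (root_fst b <= i <= root_snd b)%N) alpha i y.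

Definition nplus (h : {vspace M}) (alpha : 'I_n -> {scalar M}) : set M :=
  [set x | exists2 x_ : posroot -> M,
     (forall b, root_space h (root_form alpha b) (x_ b)) & x = \sum_b x_ b].

Definition nminus (h : {vspace M}) (alpha : 'I_n -> {scalar M}) : set M :=
  [set x | exists2 x_ : posroot -> M,
     (forall b, root_space h (fun y => - root_form alpha b y) (x_ b)) &
     x = \sum_b x_ b].

(* sl = n^- (+) h (+) n^+, where h is its own zero weight space; since
   dim sl = n + n (n + 1), this forces dim h = n and all the forms
   +- (alpha_p + ... + alpha_q) to be roots. *)
Record cartan_decomposition (h : {vspace M}) (alpha : 'I_n -> {scalar M}) :
    Prop := {
  cartan_zero_weight : forall x, x \in h <-> root_space h (fun=> 0) x;
  cartan_simple_free : forall c : 'I_n -> K,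
    (forall y, y \in h -> \sum_i c i * alpha i y = 0) -> forall i, c i = 0;
  cartan_sum : forall x, sl x -> exists xm y xp,
    [/\ nminus h alpha xm, y \in h, nplus h alpha xp & x = xm + y + xp];
  cartan_direct : forall xm y xp,
    nminus h alpha xm -> y \in h -> nplus h alpha xp -> xm + y + xp = 0 ->
    [/\ xm = 0, y = 0 & xp = 0] }.

Definition is_coroot (h : {vspace M}) (a : M -> K) (c : M) : Prop :=
  a c = 2%:R /\ exists x y,
    [/\ root_space h a x, root_space h (fun z => - a z) y &
        c = lie_bracket x y].

Definition fundamental_weights (h : {vspace M})
    (alpha omega : 'I_n -> {scalar M}) : Prop :=
  forall i j c, is_coroot h (alpha j) c -> omega i c = (i == j)%:R.

Definition weight (omega : 'I_n -> {scalar M}) (m : 'I_n -> nat) : M -> K :=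
  fun y => \sum_i (m i)%:R * omega i y.

Section Representation.
Variables (V : lmodType K) (rho : M -> {linear V -> V}).

(* rho is only meaningful on sl. *)
Definition sl_representation : Prop :=
  (forall (a : K) x y u, sl x -> sl y ->
     rho (a *: x + y) u = a *: rho x u + rho y u) /\
  (forall x y u, sl x -> sl y ->
     rho (lie_bracket x y) u = rho x (rho y u) - rho y (rho x u)).

Definition irreducible : Prop :=
  (exists u : V, u <> 0) /\
  forall W : set V, submodule W ->
    (forall x u, sl x -> W u -> W (rho x u)) -> W = [set 0] \/ W = setT.

Definition highest_weight_vector (h : {vspace M})
    (alpha : 'I_n -> {scalar M}) (lambda : M -> K) (v : V) : Prop :=
  [/\ v <> 0,
      forall x, nplus h alpha x -> rho x v = 0 &
      forall y, y \in h -> rho y v = lambda y *: v].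

Definition pbw_gen (N : set M) (v : V) (s : nat) : set V :=
  [set u | exists xs : seq M, [/\ (size xs <= s)%N,
     forall x, x \in xs -> N x & u = foldr (fun x => rho x) v xs]].

Lemma pbw_gen_incr N v s :
  lin_span (pbw_gen N v s) `<=` lin_span (pbw_gen N v s.+1).
Proof.
by apply: lin_span_sub => u [xs [h1 h2 ->]]; exists xs; split=> //; apply: leqW.
Qed.

(* The s-th term is U(n^-)_s v when N is n^-. *)
Definition pbw_filtration (N : set M) (v : V) : filtration V :=
  Filtration (fun s => lin_span_submodule (pbw_gen N v s))
    (@pbw_gen_incr N v).

Lemma pbw_shift N v x s u :
  N x -> pbw_filtration N v s u -> pbw_filtration N v s.+1 (rho x u).
Proof.
move=> Nx [r hr ->]; exists [seq (t.1, rho x t.2) | t <- r].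
  move=> _ /mapP[t /hr[xs [h1 h2 ->]] ->]; exists (x :: xs); split=> //.
  by move=> y; rewrite inE => /orP[/eqP ->//|/h2].
by rewrite big_map linear_sum; apply: eq_bigr => t _; rewrite linearZ.
Qed.

(* The action of x in n^- = S^1(n^-) on gr V. *)
Definition pbw_act (N : set M) (v : V) (x : M) :
    gr (pbw_filtration N v) -> gr (pbw_filtration N v) :=
  @gr_shift K V (pbw_filtration N v) (rho x).

Lemma pbw_act_class N v x s u : N x -> pbw_filtration N v s u ->
  pbw_act x (gr_class (pbw_filtration N v) s u) =
  gr_class (pbw_filtration N v) s.+1 (rho x u).
Proof. by move=> Nx; apply: gr_shift_class => k w; apply: pbw_shift. Qed.

(* f^s v_lambda in gr V; the operators pbw_act (f b) commute with each other,
   so the order of the product is irrelevant. *)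
Definition pbw_monomial (N : set M) (v : V) (f : posroot -> M)
    (s : {ffun posroot -> nat}) : gr (pbw_filtration N v) :=
  foldr (fun b => iter (s b) (pbw_act (f b)))
    (gr_class (pbw_filtration N v) 0 v) (enum {: posroot}).

Lemma pbw_monomialE (N : set M) v (f : posroot -> M) s :
  (forall b, N (f b)) ->
  pbw_monomial N v f s =
  gr_class (pbw_filtration N v) (\sum_b s b)%N
    (foldr (fun b => iter (s b) (rho (f b))) v (enum {: posroot})).
Proof.
move=> Nf; rewrite /pbw_monomial -big_enum.
suff [//] : foldr (fun b => iter (s b) (pbw_act (f b)))
    (gr_class (pbw_filtration N v) 0 v) (enum {: posroot}) =
  gr_class (pbw_filtration N v) (\sum_(b <- enum {: posroot}) s b)%N
    (foldr (fun b => iter (s b) (rho (f b))) v (enum {: posroot})) /\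
  pbw_filtration N v (\sum_(b <- enum {: posroot}) s b)%N
    (foldr (fun b => iter (s b) (rho (f b))) v (enum {: posroot})).
elim: (enum _) => [|b r [IH1 IH2]] /=.
  by rewrite big_nil; split=> //; apply: lin_span_incl; exists [::].
rewrite big_cons IH1; elim: (s b) => [|k [IHk1 IHk2]] //=.
by rewrite IHk1 pbw_act_class // addSn; split=> //; apply: pbw_shift.
Qed.

End Representation.

Definition dyck_step (b c : posroot) : bool :=
  ((root_fst c == root_fst b :> nat) && (root_snd c == (root_snd b).+1 :> nat))
  || ((root_fst c == (root_fst b).+1 :> nat) && (root_snd c == root_snd b :> nat)).

Definition is_simple (b : posroot) : bool := root_fst b == root_snd b.

Definition dyck_path (b0 : posroot) (p : seq posroot) : bool :=
  [&& is_simple b0, is_simple (last b0 p), path dyck_step b0 p &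
      (p == [::]) || (root_fst b0 < root_fst (last b0 p))%N].

Definition S_lambda (m : 'I_n -> nat) : set {ffun posroot -> nat} :=
  [set s | forall b0 p, dyck_path b0 p ->
     (\sum_(b <- b0 :: p) s b <=
      \sum_(i < n | root_fst b0 <= i <= root_fst (last b0 p)) m i)%N].

End SpecialLinear.

(* Main.v *)
Require Import Defs.
From HB Require Import structures.
From mathcomp Require Import all_boot all_order all_algebra perm.
From mathcomp Require Import zify.
From mathcomp Require Import boolp classical_sets functions reals complex.

(* The vectors [f^s v], [s] in [S_lambda m], span the graded module by
   straightening.  Let [s] be supported on a Dyck path from [alpha_i] to
   [alpha_j] with [|s| > m_i + .. + m_j].  A nilpotent matrix of rank one whose
   strictly lower part is [(sigma_p tau_q)_(i <= p <= q <= j)] has [|s|]-th power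
   killing [v]; its coefficients in [sigma], [tau] are sums of the monomials
   with prescribed row and column sums, modulo lower filtration degree.  Among
   these the one supported on a Dyck path, which is a chain for the
   componentwise order, is the unique maximum of the weight [\sum p * q], and
   is therefore a combination of monomials of smaller weight.

   Linear independence is proved in a tensor product of exterior powers of
   C^(n+1), with highest weight vector [w].  The relations between words in the
   [f_b] are the same on [v] and on [w]: irreducibility of [V] gives one
   direction, a positive definite contravariant form the other.  Every [s] in
   [S_lambda m] is a sum of antichains of roots, one for each exterior factor
   (remove the minimal elements of the support), and in an exterior power an
   antichain is detected by one coordinate that vanishes on all other monomials
   which are not larger; such coordinates multiply.

   An arbitrary Cartan decomposition of sl_(n+1) is brought to standard form by
   a basis of weight vectors of the natural module, up to the outer
   automorphism [x |-> - x^T]. *)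

Set Implicit Arguments.
Unset Strict Implicit.
Unset Printing Implicit Defensive.

Import Order.TTheory GRing.Theory Num.Theory.
Local Open Scope ring_scope.

(** * Chains and Dyck paths *)

(** One weight, [word_weight], serves both halves. For prescribed row and column margins a chain of
    roots is its only maximum and an antichain its only minimum: reflecting the right ends exchanges
    chains with antichains and replaces the weight by a constant, fixed by the margins, minus
    itself. Hence straightening, which lowers the weight, and detection by coordinates, which
    ignores what is not larger, are triangular for the same order, size first and then weight.

    [V] is known only through irreducibility and its highest weight; nilpotency of root vectors is
    not given. The vanishing of powers on [v] is therefore imported from the tensor model, and
    linear relations are exported to it. The bridge is the submodule of the product of the two
    modules generated by [(v, w)], which meets each factor in zero.

    Elements of U(n^-) are replaced by words in the [lower_gen b]; reordering a word costs only
    shorter words, so no basis of U(n^-) is used.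

    A coordinate of a tensor product receives contributions from many ways of splitting one monomial
    between the factors. This is why the model asks for positive, not merely nonzero, detecting
    coordinates: they cannot cancel. *)

Section Chains.
Local Open Scope nat_scope.
Implicit Types u v : seq (nat * nat).

Let corner x y u := count (fun c => (x <= c.1) && (y <= c.2)) u.

(** The product [c.1.+1 * c.2.+1] counts the pairs [(x, y)] dominated by [c]; count point-pair
    incidences in both orders. *)
Lemma weight_corner N u : (forall c, c \in u -> c.1 < N /\ c.2 < N) ->
  \sum_(c <- u) c.1.+1 * c.2.+1 = \sum_(x < N) \sum_(y < N) corner x y u.
Proof.
have cnt k : k < N -> \sum_(x < N) (x <= k) = k.+1.
  move=> kN; rewrite -(big_mkord xpredT (fun x => (x <= k) : nat)).
  rewrite (big_cat_nat (n := k.+1)) //=.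
  rewrite [X in _ + X]big_nat_cond [X in _ + X]big1 ?addn0; last first.
    by move=> i /andP[/andP[ki _] _]; rewrite leqNgt ki.
  rewrite big_nat_cond (eq_bigr (fun=> 1)); last by move=> i; rewrite andbT /= ltnS => ->.
  by rewrite -big_nat_cond sum_nat_const_nat muln1 subn0.
elim: u => [|c u IH] h; first by rewrite big_nil !big1 // => x _; rewrite big1.
have [c1 c2] := h c (mem_head _ _).
rewrite big_cons IH => [|d du]; last by apply: h; rewrite inE du orbT.
rewrite -(cnt _ c1) -(cnt _ c2) big_distrlr /= -big_split /=.
by apply: eq_bigr => x _; rewrite -big_split /=; apply: eq_bigr => y _; rewrite mulnb.
Qed.

(** Multiplicities are the mixed second differences of the quadrant counts. *)
Lemma corner_perm u v : (forall x y, corner x y u = corner x y v) -> perm_eq u v.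
Proof.
move=> h; apply/allP => -[p q] _; apply/eqP.
have cm w : corner p q w + corner p.+1 q.+1 w =
            count_mem (p, q) w + corner p.+1 q w + corner p q.+1 w.
  elim: w => //= -[a b] w IH; rewrite xpair_eqE /=.
  move: IH; rewrite /corner; lia.
have := cm u; rewrite !h cm /=; lia.
Qed.

Definition chain_comparable (c d : nat * nat) :=
  (c.1 <= d.1) && (c.2 <= d.2) || (d.1 <= c.1) && (d.2 <= c.2).

(** In a chain one half-plane condition implies the other: a point [c] with [x <= c.1] and [c.2 < y]
    lies below every [d] with [y <= d.2], which forces [x <= d.1]. *)
Lemma corner_chain u x y : {in u &, forall c d, chain_comparable c d} ->
  corner x y u = minn (count (fun c => x <= c.1) u) (count (fun c => y <= c.2) u).
Proof.
move=> ch; have [/hasP[c cu /andP[c1 c2]]|/hasPn nc] :=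
  boolP (has (fun c => (x <= c.1) && (c.2 < y)) u).
- have e : corner x y u = count (fun c => y <= c.2) u.
    apply: eq_in_count => d du; have := ch _ _ cu du; rewrite /chain_comparable; lia.
  rewrite e; apply/esym/minn_idPr; rewrite -e; apply: sub_count => d; lia.
have e : corner x y u = count (fun c => x <= c.1) u.
  by apply: eq_in_count => d /nc; lia.
rewrite e; apply/esym/minn_idPl; rewrite -e; apply: sub_count => d; lia.
Qed.

(* With prescribed marginals, the supermodular weight [p * q] has a chain as its
   only maximum: compare the numbers of points in all quadrants. *)
Lemma chain_max u v : {in v &, forall c d, chain_comparable c d} ->
  (forall x, count (fun c => x <= c.1) u = count (fun c => x <= c.1) v) ->
  (forall y, count (fun c => y <= c.2) u = count (fun c => y <= c.2) v) ->
  \sum_(c <- v) c.1.+1 * c.2.+1 <= \sum_(c <- u) c.1.+1 * c.2.+1 ->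
  perm_eq u v.
Proof.
move=> ch h1 h2.
pose N := \max_(c <- u ++ v) maxn c.1.+1 c.2.+1.
have hN c : c \in u ++ v -> c.1 < N /\ c.2 < N.
  move=> cu; apply/andP; rewrite -geq_max.
  exact: (leq_bigmax_seq (F := fun c => maxn c.1.+1 c.2.+1) (P := xpredT) c cu isT).
rewrite !(weight_corner (N := N)) => [|c cu|c cu]; first last.
- by apply: hN; rewrite mem_cat cu orbT.
- by apply: hN; rewrite mem_cat cu.
move=> le.
have le1 x y : corner x y u <= corner x y v.
  rewrite (corner_chain _ _ ch) -h1 -h2 leq_min.
  by apply/andP; split; apply: sub_count => c /andP[].
have le2 x : \sum_(y < N) corner x y u <= \sum_(y < N) corner x y v.
  by apply: leq_sum => y _; apply: le1.
have eq2 x : x < N -> \sum_(y < N) corner x y u = \sum_(y < N) corner x y v.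
  move=> xN; apply/eqP; rewrite eqn_leq le2 /= leqNgt; apply/negP => lt.
  move: le; rewrite leqNgt => /negP; apply.
  rewrite (bigD1 (Ordinal xN)) //= [ltnRHS](bigD1 (Ordinal xN)) //=.
  by rewrite -addSn leq_add // leq_sum.
have eq1 x y : x < N -> y < N -> corner x y u = corner x y v.
  move=> xN yN; apply/eqP; rewrite eqn_leq le1 /= leqNgt; apply/negP => lt.
  have := eq2 x xN; apply/eqP; rewrite neq_ltn; apply/orP; left.
  rewrite (bigD1 (Ordinal yN)) //= [ltnRHS](bigD1 (Ordinal yN)) //=.
  by rewrite -addSn leq_add // leq_sum.
have big0 w x y : {subset w <= u ++ v} -> ~~ ((x < N) && (y < N)) -> corner x y w = 0.
  move=> sw xy; apply/eqP; rewrite -leqn0 leqNgt -has_count; apply/hasPn => c /sw /hN [c1 c2] /=.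
  by apply: contra xy => /andP[xc yc]; rewrite (leq_ltn_trans xc) ?(leq_ltn_trans yc).
apply: corner_perm => x y; have [/andP[xN yN]|xy] := boolP ((x < N) && (y < N)).
  exact: eq1.
by rewrite !big0 // => c cu; rewrite mem_cat cu ?orbT.
Qed.

End Chains.

Section DyckPaths.
Variable n : nat.
Local Open Scope nat_scope.
Implicit Types (b c d : posroot n) (p q : seq (posroot n)) (m : 'I_n -> nat).

Definition root_le b c := (root_fst b <= root_fst c) && (root_snd b <= root_snd c).

Lemma root_le_refl : reflexive root_le.
Proof. by move=> b; rewrite /root_le !leqnn. Qed.

Lemma root_le_trans : transitive root_le.
Proof. by move=> b c d; rewrite /root_le; lia. Qed.

Lemma root_fst_snd b : root_fst b <= root_snd b.
Proof. exact: (valP b). Qed.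

Lemma root_inj b c : root_fst b = root_fst c -> root_snd b = root_snd c -> b = c.
Proof. by case: b c => [[x y] h] [[x' y'] h'] /= e1 e2; apply: val_inj; congr (_, _). Qed.

Definition mkroot (x y : 'I_n) (xy : x <= y) : posroot n :=
  exist (fun b : 'I_n * 'I_n => b.1 <= b.2) (x, y) xy.

Lemma mkroot_fst (x y : 'I_n) (xy : x <= y) : root_fst (mkroot xy) = x. Proof. by []. Qed.

Lemma mkroot_snd (x y : 'I_n) (xy : x <= y) : root_snd (mkroot xy) = y. Proof. by []. Qed.

Definition mkrootE := (mkroot_fst, mkroot_snd).

(** The right end moves first, and the left end only once the right ends agree; in this order every
    intermediate pair is still a root. *)
Lemma dyck_connect b c : root_le b c ->
  exists2 q, path (@dyck_step n) b q & last b q = c.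
Proof.
move: {2}(_ - _) (erefl ((root_fst c + root_snd c) - (root_fst b + root_snd b))) => k.
elim: k b => [|k IH] b.
  rewrite /root_le => h1 h2; exists [::] => //=; apply: root_inj; apply: val_inj => /=; lia.
move=> e bc; move: (bc); rewrite /root_le => /andP[b1 b2].
have := root_fst_snd b; have := root_fst_snd c => hc hb.
have [lt|ge] := ltnP (root_snd b) (root_snd c).
  have sn : (root_snd b).+1 < n by apply: leq_ltn_trans lt _.
  have hd : root_fst b <= Ordinal sn by rewrite /= leqW.
  have [||q pq <-] := IH (mkroot hd).
  - rewrite !mkrootE /=; lia.
  - by rewrite /root_le !mkrootE /= b1.
  by exists (mkroot hd :: q) => //=; rewrite pq /dyck_step !mkrootE /= !eqxx.
have lt : root_fst b < root_fst c by lia.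
have sn : (root_fst b).+1 < n by apply: leq_ltn_trans lt _.
have hd : Ordinal sn <= root_snd b by rewrite /=; lia.
have [||q pq <-] := IH (mkroot hd).
- rewrite !mkrootE /=; lia.
- by rewrite /root_le !mkrootE /= lt.
by exists (mkroot hd :: q) => //=; rewrite pq /dyck_step !mkrootE /= !eqxx orbT.
Qed.

(** Distinctness makes each connecting segment nonempty, so that it visits the next element of the
    chain as its end point. *)
Lemma dyck_cover b p : path root_le b p -> uniq (b :: p) ->
  exists q, [/\ path (@dyck_step n) b q, last b q = last b p & subseq p q].
Proof.
elim: p b => [|c p IH] b; first by exists [::].
move=> /= /andP[bc pc] /andP[nb /andP[nc up]].
have [|q [h1 h2 h3]] := IH c pc; first by rewrite /= nc up.
have [q1 h4 h5] := dyck_connect bc.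
exists (q1 ++ q); rewrite cat_path last_cat h4 h5 h1 h2; split=> //.
rewrite -cat1s cat_subseq // sub1seq -h5.
case: q1 h4 h5 => [|x q1] _ /=; last by rewrite mem_last.
by move=> e; move: nb; rewrite e inE eqxx.
Qed.

Lemma dyck_path_le b p : path (@dyck_step n) b p -> path root_le b p.
Proof.
apply: sub_path => c d; rewrite /dyck_step /root_le; lia.
Qed.

Lemma path_root_le b p c : path root_le b p -> c \in b :: p ->
  root_le b c && root_le c (last b p).
Proof.
elim: p b c => [|d p IH] b c /=.
  by rewrite inE => _ /eqP ->; rewrite /root_le !leqnn.
move=> /andP[bd pd]; rewrite inE => /predU1P[->|/(IH _ _ pd)/andP[dc ->]].
  have /andP[_ h] := IH _ _ pd (mem_head _ _).
  by rewrite (root_le_trans bd h) /root_le !leqnn.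
by rewrite (root_le_trans bd dc).
Qed.

Lemma dyck_path_uniq b p : path (@dyck_step n) b p -> uniq (b :: p).
Proof.
move=> h; apply: (@sorted_uniq _ (fun c d => root_fst c + root_snd c < root_fst d + root_snd d)).
- by move=> c d e; apply: ltn_trans.
- by move=> c; rewrite ltnn.
by rewrite /=; apply: sub_path h => c d; rewrite /dyck_step; lia.
Qed.

Lemma dyck_path_size b p : path (@dyck_step n) b p ->
  root_fst (last b p) + root_snd (last b p) = root_fst b + root_snd b + size p.
Proof.
elim: p b => [|c p IH] b /=; first by rewrite addn0.
by move=> /andP[bc /IH ->]; move: bc; rewrite /dyck_step; lia.
Qed.

Lemma leq_sum_subseq (s : posroot n -> nat) p q : subseq p q ->
  \sum_(b <- p) s b <= \sum_(b <- q) s b.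
Proof.
elim: q p => [|c q IH] [|b p] //= h; rewrite ?big_nil // !big_cons.
case: eqP h => [->|_] h; first by rewrite leq_add2l IH.
by apply: leq_trans (leq_addl _ _); rewrite -(big_cons _ _ b p xpredT) IH.
Qed.

(** The defining inequalities pass from Dyck paths to chains: refine the chain and prolong it down
    to the simple root at [root_fst b] and up to the one at [root_snd (last b p)]. The added entries
    are nonnegative. *)
Lemma S_lambda_chain m s b p : S_lambda m s -> path root_le b p -> uniq (b :: p) ->
  \sum_(c <- b :: p) s c <=
  \sum_(j < n | root_fst b <= j <= root_snd (last b p)) m j.
Proof.
move=> Ss pb up.
pose a := mkroot (leqnn (root_fst b)).
pose e := mkroot (leqnn (root_snd (last b p))).
have [|q0 h1 h2] := @dyck_connect a b.
  by rewrite /root_le !mkrootE /= leqnn root_fst_snd.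
have [q1 [h3 h4 h5]] := dyck_cover pb up.
have [|q2 h6 h7] := @dyck_connect (last b p) e.
  by rewrite /root_le !mkrootE /= leqnn root_fst_snd.
have hp : path (@dyck_step n) a (q0 ++ q1 ++ q2) by rewrite !cat_path h1 h2 h3 h4 h6.
have hl : last a (q0 ++ q1 ++ q2) = e by rewrite !last_cat h2 h4 h7.
have /Ss le : dyck_path a (q0 ++ q1 ++ q2).
  rewrite /dyck_path hp hl /is_simple !mkrootE !eqxx /=.
  have := dyck_path_size hp; rewrite hl !mkrootE /=.
  case: (q0 ++ q1 ++ q2) => //= x r; lia.
move: le; rewrite hl; apply: leq_trans; apply: leq_sum_subseq.
rewrite -cat_cons -cat1s; apply: cat_subseq.
  by rewrite sub1seq -h2 mem_last.
by rewrite -[p]cats0; apply: cat_subseq; rewrite ?sub0seq.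
Qed.

Lemma S_lambda0 m s b :
  S_lambda m s -> (forall j : 'I_n, root_fst b <= j <= root_snd b -> m j = 0) -> s b = 0.
Proof.
move=> Ss m0; have := S_lambda_chain Ss (isT : path root_le b [::]) isT.
by rewrite big_seq1 big1 /= ?leqn0 => [/eqP|j /m0].
Qed.

(** Two roots are incomparable for [root_le] exactly when one is nested in the other, in this strict
    sense. *)
Definition nested b c := (root_fst b < root_fst c) && (root_snd c < root_snd b).

(* [a] lists the minimal elements of the support of [s] among the roots that
   contain [alpha_i]. *)
Lemma S_lambda_split m s (i : 'I_n) : S_lambda m s -> 0 < m i ->
  (forall j : 'I_n, j < i -> m j = 0) ->
  exists (a : seq (posroot n)) (s' : {ffun posroot n -> nat}),
  [/\ uniq a, (forall b, b \in a -> root_fst b <= i <= root_snd b),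
      {in a &, forall b c, b != c -> nested b c || nested c b} &
      S_lambda (fun j => m j - (j == i)) s' /\ forall b, s b = (b \in a) + s' b].
Proof.
move=> Ss mi m0.
pose R b := [&& root_fst b <= i, i <= root_snd b & 0 < s b].
pose A b := R b && [forall c, R c && root_le c b ==> (c == b)].
have Amin c : R c -> exists2 y, A y & root_le y c.
  move=> Rc; pose P y := R y && root_le y c.
  have Pc : P c by rewrite /P Rc /root_le !leqnn.
  have [y /andP[Ry yc] ymin] := arg_minnP (fun y => root_fst y + root_snd y) Pc.
  exists y => //; rewrite /A /= Ry; apply/forallP => d; apply/implyP => /andP[Rd dy].
  have := ymin d; rewrite /P Rd (root_le_trans dy yc) => /(_ isT).
  move: dy; rewrite /root_le => dy le; apply/eqP.
  by apply: root_inj; apply: val_inj => /=; lia.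
exists (enum A), [ffun b => s b - A b]; split=> //.
- exact: enum_uniq.
- by move=> b; rewrite mem_enum => /andP[/and3P[-> ->]].
- move=> b c; rewrite !mem_enum => /andP[Rb /forallP/(_ c) Ab] /andP[Rc /forallP/(_ b) Ac] bc.
  move: Ab Ac; rewrite Rb Rc [c == b]eq_sym (negbTE bc) !implybF /root_le /nested /=; lia.
have sA b : (A b : nat) <= s b.
  by case Ab: (A b) => //; move: Ab => /andP[/and3P[]].
split; last by move=> b; rewrite mem_enum ffunE -[_ \in A]/(A b) subnKC.
move=> b0 p dp; move: (dp) => /and4P[/eqP sb0 /eqP sl pp _].
have le0 : \sum_(b <- b0 :: p) s b <= _ := Ss _ _ dp.
have le1 (q : seq _) : \sum_(b <- q) [ffun b => s b - A b] b <= \sum_(b <- q) s b.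
  by apply: leq_sum => b _; rewrite ffunE leq_subr.
set e := last b0 p in sl le0 *.
(* If the interval of the path misses [i], its bound is unchanged and [s' <= s] suffices. Otherwise
   the bound drops by one, and the sum has to drop too or to have been strictly smaller already. *)
have [/andP[b0i ie]|nie] := boolP (root_fst b0 <= i <= root_fst e); last first.
  apply: leq_trans (le1 _) _; apply: (leq_trans le0); apply: leq_sum => j hj.
  by case: eqP => [ji|]; rewrite ?subn0 //; case/negP: nie; rewrite -ji.
suff key : (\sum_(b <- b0 :: p) [ffun b => s b - A b] b).+1 <=
    \sum_(j < n | root_fst b0 <= j <= root_fst e) m j.
  rewrite -ltnS; apply: leq_trans key _.
  rewrite (bigD1 i) ?b0i //= [X in _ <= X.+1](bigD1 i) ?b0i //= eqxx.
  rewrite -addSn subn1 prednK // leq_add2l; apply: leq_sum => j /andP[_ /negbTE ->].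
  by rewrite subn0.
have [/hasP[c cp Ac]|/hasPn nA] := boolP (has A (b0 :: p)).
  apply: leq_trans le0; rewrite (big_rem c) //= [X in _ <= X](big_rem c) //=.
  rewrite -addSn; apply: leq_add (le1 _).
  by move: (sA c); rewrite ffunE Ac => sc; rewrite subn1 prednK.
have -> : \sum_(b <- b0 :: p) [ffun b => s b - A b] b = \sum_(b <- b0 :: p) s b.
  by apply: eq_big_seq => b /nA /negbTE Ab; rewrite ffunE Ab subn0.
(* The path now avoids the removed antichain. All roots of its support [q] end at or after [i],
   since those ending earlier have exponent zero. *)
pose q := [seq c <- b0 :: p | 0 < s c].
have -> : \sum_(b <- b0 :: p) s b = \sum_(b <- q) s b.
  rewrite big_filter [RHS]big_mkcond /=; apply: eq_bigr => b _; case: (s b) => //.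
have qi c : c \in q -> i <= root_snd c.
  rewrite mem_filter => /andP[sc _]; rewrite leqNgt; apply/negP => ci.
  have s0 : s c = 0 by apply: (S_lambda0 Ss) => j /andP[_ jc]; apply: m0; exact: leq_ltn_trans ci.
  by rewrite s0 in sc.
have pq c : c \in q -> c \in b0 :: p by rewrite mem_filter => /andP[].
have qe c : c \in q -> root_snd c <= root_fst e.
  by move=> /pq/(path_root_le (dyck_path_le pp))/andP[_ /andP[_]]; rewrite sl.
have sq : sorted root_le q.
  by apply: sorted_filter; [exact: root_le_trans|exact: dyck_path_le].
have uq : uniq q by apply: filter_uniq; exact: dyck_path_uniq.
have hi : m i <= \sum_(j < n | root_fst b0 <= j <= root_fst e) m j.
  by rewrite (bigD1 i) ?b0i //= leq_addr.
have q0 c : c \in q -> 0 < s c by rewrite mem_filter => /andP[].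
case Eq: q sq uq => [|c r] sq uq; first by rewrite big_nil; apply: leq_trans hi.
have cq x : x \in c :: r -> x \in q by rewrite Eq.
have le_e := qe _ (cq _ (mem_last c r)).
have cq0 := cq _ (mem_head c r).
(* If [q] starts beyond [i], its chain bound does not contain [m i], and this leaves the missing
   unit. *)
have [ci|ic] := leqP (root_fst c) i; last first.
  have := S_lambda_chain Ss sq uq; rewrite -ltnS => h; apply: leq_trans h _.
  rewrite [X in _ <= X](bigD1 i) ?b0i //= -[X in X <= _]add1n; apply: leq_add => //.
  rewrite big_mkcond [X in _ <= X]big_mkcond /=; apply: leq_sum => j _.
  case: ifP => // h; rewrite ifT //; apply/andP; split; last by apply/eqP => ji; rewrite ji in h; lia.
  case/andP: h => h1 h2; rewrite (leq_trans h2 le_e) andbT.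
  exact: leq_trans b0i (leq_trans (ltnW ic) h1).
(* Otherwise [c] contains alpha_i and dominates a minimal root [y], which is off the path.
   Prepending [y] to [q] gives a longer chain, and [s y] is the missing unit. *)
have Rc : R c by rewrite /R ci qi ?q0.
have [y Ay yc] := Amin c Rc.
have yq : y \notin c :: r by apply/negP => /cq/pq/nA; rewrite Ay.
have py : path root_le y (c :: r) by rewrite /= yc.
have uy : uniq (y :: c :: r) by rewrite cons_uniq yq.
have := S_lambda_chain Ss py uy; rewrite big_cons => h.
have sy : 0 < s y by move: Ay => /andP[/and3P[]].
apply: leq_trans (_ : _ <= \sum_(j < n | root_fst y <= j <= root_snd (last c r)) m j) _.
  by apply: leq_trans h; rewrite -add1n leq_add.
rewrite big_mkcond [X in _ <= X]big_mkcond /=; apply: leq_sum => j _.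
case: ifP => // h1; have [ji|ij] := ltnP j i; first by rewrite m0.
by case/andP: h1 => _ h2; rewrite ifT // (leq_trans h2 le_e) (leq_trans b0i ij).
Qed.
End DyckPaths.

(** * Tensor powers of the natural representation *)

Section TensorModule.
Variables (C : numClosedFieldType) (n : nat).
Local Notation M := 'M[C]_n.+1.

Section OneIndexSet.
Variable D : finType.

Definition tensor : Type := {ffun {ffun D -> 'I_n.+1} -> C^o}.
HB.instance Definition _ := GRing.Lmodule.on tensor.
Implicit Types (F G : tensor) (g : {ffun D -> 'I_n.+1}) (x y : M).

Definition upd g d (a : 'I_n.+1) : {ffun D -> 'I_n.+1} :=
  [ffun e => if e == d then a else g e].

(* [F] stands for the tensor [\sum_g F g e_g], [e_g] being the product of the
   basis vectors [e_(g d)] of C^(n+1); [tact] is the usual action of gl_(n+1). *)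
Definition tact x F : tensor :=
  [ffun g : {ffun D -> 'I_n.+1} => \sum_d \sum_b x (g d) b * F (upd g d b)].

Lemma upd_same g d a b : upd (upd g d a) d b = upd g d b.
Proof. by apply/ffunP => e; rewrite !ffunE; case: eqP. Qed.

Lemma updC g d e a b : d != e -> upd (upd g d a) e b = upd (upd g e b) d a.
Proof.
move=> de; apply/ffunP => k; rewrite !ffunE.
by case: (k =P e) => // ->; rewrite eq_sym (negbTE de).
Qed.

Lemma upd_id g d : upd g d (g d) = g.
Proof. by apply/ffunP => e; rewrite !ffunE; case: eqP => [->|]. Qed.

Lemma upd_eq g d a : upd g d a d = a.
Proof. by rewrite ffunE eqxx. Qed.

Lemma tact_linear x : linear (tact x).
Proof.
move=> a F G; apply/ffunP => g; rewrite !ffunE scaler_sumr -big_split /=.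
apply: eq_bigr => d _; rewrite scaler_sumr -big_split /=; apply: eq_bigr => b _.
by rewrite !ffunE mulrDr /GRing.scale /= mulrCA.
Qed.
HB.instance Definition _ x := GRing.isLinear.Build C tensor tensor _ (tact x) (tact_linear x).

Lemma tact_linearl a x y F : tact (a *: x + y) F = a *: tact x F + tact y F.
Proof.
apply/ffunP => g; rewrite !ffunE scaler_sumr -big_split /=.
apply: eq_bigr => d _; rewrite scaler_sumr -big_split /=; apply: eq_bigr => b _.
by rewrite !mxE mulrDl /GRing.scale /= mulrA.
Qed.

(** The part of the product of two operators that acts in two different tensor factors. Being
    symmetric in [x] and [y], it drops out of the commutator. *)
Definition tact2 x y F g := \sum_d \sum_(e | e != d) \sum_a \sum_b
  x (g d) a * y (g e) b * F (upd (upd g d a) e b).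

Lemma tact2C x y F g : tact2 x y F g = tact2 y x F g.
Proof.
rewrite /tact2 (exchange_big_dep xpredT) //=.
apply: eq_bigr => d _; apply: eq_big => [e|e ne]; first by rewrite eq_sym.
rewrite exchange_big; apply: eq_bigr => a _; apply: eq_bigr => b _.
by rewrite [x _ _ * _]mulrC updC // eq_sym.
Qed.

Lemma tact_tact x y F g : tact x (tact y F) g = tact (x *m y) F g + tact2 x y F g.
Proof.
rewrite !ffunE -big_split /=; apply: eq_bigr => d _.
transitivity (\sum_a \sum_e \sum_b x (g d) a * y (upd g d a e) b * F (upd (upd g d a) e b)).
  apply: eq_bigr => a _; rewrite ffunE mulr_sumr; apply: eq_bigr => e _.
  by rewrite mulr_sumr; apply: eq_bigr => b _; rewrite mulrA.
rewrite exchange_big (bigD1 d) //=; congr (_ + _).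
  rewrite exchange_big /=; apply: eq_bigr => b _; rewrite mxE mulr_suml.
  by apply: eq_bigr => a _; rewrite upd_eq upd_same.
apply: eq_bigr => e ne; apply: eq_bigr => a _; apply: eq_bigr => b _.
by rewrite [upd g d a e]ffunE (negbTE ne).
Qed.

Lemma tact_bracket x y F :
  tact (lie_bracket x y) F = tact x (tact y F) - tact y (tact x F).
Proof.
have -> : lie_bracket x y = (-1) *: (y *m x) + x *m y by rewrite scaleN1r addrC.
apply/ffunP => g; rewrite tact_linearl scaleN1r.
by rewrite [LHS]ffunE [RHS]ffunE [in X in X + _ = _]ffunE [in X in _ = _ + X]ffunE !tact_tact tact2C opprD addrACA subrr addr0 addrC.
Qed.

Definition herm F G : C := \sum_g F g * (G g)^*%R.

Lemma herm_adjoint x F G : herm (tact x F) G = herm F (tact (map_mx Num.conj x^T) G).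
Proof.
rewrite /herm.
transitivity (\sum_d \sum_(g : {ffun D -> 'I_n.+1}) \sum_b x (g d) b * F (upd g d b) * (G g)^*%R).
  rewrite exchange_big /=; apply: eq_bigr => g _; rewrite ffunE mulr_suml.
  by apply: eq_bigr => d _; rewrite mulr_suml.
transitivity (\sum_d \sum_(g : {ffun D -> 'I_n.+1}) \sum_b F g * (x b (g d) * (G (upd g d b))^*%R)); last first.
  rewrite exchange_big /=; apply: eq_bigr => g _; rewrite ffunE rmorph_sum mulr_sumr.
  apply: eq_bigr => d _; rewrite rmorph_sum mulr_sumr; apply: eq_bigr => b _.
  by rewrite rmorphM !mxE /= conjCK.
apply: eq_bigr => d _; rewrite !pair_bigA /=.
(* This involution exchanges the entry [g d] with the summation index [b]. *)
rewrite (reindex_inj (h := fun p : {ffun D -> 'I_n.+1} * 'I_n.+1 => (upd p.1 d p.2, p.1 d))).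
  apply: eq_bigr => -[g b] _ /=; rewrite upd_eq upd_same upd_id.
  by rewrite [x _ _ * _]mulrC mulrA.
apply: (can_inj (g := fun p : {ffun D -> 'I_n.+1} * 'I_n.+1 => (upd p.1 d p.2, p.1 d))) => -[g b] /=.
by rewrite upd_same upd_id upd_eq.
Qed.

Lemma herm_eq0 F : herm F F = 0 -> F = 0.
Proof.
move=> h; apply/ffunP => g; rewrite ffunE; apply/eqP; rewrite -normr_eq0 -sqrf_eq0.
rewrite normCK; move: h; rewrite /herm => /eqP; rewrite psumr_eq0; last first.
  by move=> k _; rewrite -normCK exprn_ge0.
by move=> /allP /(_ g); rewrite mem_index_enum => /(_ isT).
Qed.

Lemma herm_linear G : linear (herm^~ G : tensor -> C^o).
Proof.
move=> a F F'; rewrite /herm scaler_sumr -big_split /=; apply: eq_bigr => g _.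
by rewrite !ffunE mulrDl /GRing.scale /= mulrA.
Qed.

Lemma herm_conj F G : herm F G = (herm G F)^*%R.
Proof.
by rewrite /herm rmorph_sum; apply: eq_bigr => g _; rewrite rmorphM /= conjCK mulrC.
Qed.

End OneIndexSet.

(** With indices from 0, the root [(p, q)] has the matrix unit at row [q.+1] and column [p] as its
    negative root vector. *)
Definition lower_gen (b : posroot n) : M :=
  delta_mx (lift ord0 (root_snd b)) (widen_ord (leqnSn n) (root_fst b)).

Definition word_act (W : Type) (act : M -> W -> W) (u : seq (posroot n)) (w : W) : W :=
  foldr (fun b => act (lower_gen b)) w u.

Lemma tact_lower D (b : posroot n) (F : tensor D) g :
  tact (lower_gen b) F g =
  \sum_(d | g d == lift ord0 (root_snd b)) F (upd g d (widen_ord (leqnSn n) (root_fst b))).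
Proof.
rewrite ffunE [RHS]big_mkcond /=; apply: eq_bigr => d _.
rewrite (bigD1 (widen_ord (leqnSn n) (root_fst b))) //= big1 => [|a ne].
  by rewrite addr0 mxE eqxx andbT; case: eqP; rewrite ?mul1r ?mul0r.
by rewrite mxE (negbTE ne) andbF mul0r.
Qed.

Section Product.
Variables D D' : finType.
Implicit Types (F : tensor D) (G : tensor D').

Definition tens F G : tensor (D + D')%type :=
  [ffun g : {ffun D + D' -> 'I_n.+1} => F [ffun d => g (inl d)] * G [ffun d => g (inr d)]].

Lemma tact_tens x F G :
  tact x (tens F G) = tens (tact x F) G + tens F (tact x G).
Proof.
apply/ffunP => g; rewrite !ffunE big_sumType /=; congr (_ + _).
  rewrite mulr_suml; apply: eq_bigr => d _; rewrite mulr_suml; apply: eq_bigr => b _.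
  rewrite !ffunE mulrA; congr (_ * F _ * G _); apply/ffunP => e; rewrite !ffunE //.
rewrite mulr_sumr; apply: eq_bigr => d _; rewrite mulr_sumr; apply: eq_bigr => b _.
rewrite !ffunE mulrCA; congr (F _ * (_ * G _)); apply/ffunP => e; rewrite !ffunE //.
Qed.

Lemma tens0l G : tens 0 G = 0.
Proof. by apply/ffunP => g; rewrite !ffunE mul0r. Qed.

Lemma tens0r F : tens F 0 = 0.
Proof. by apply/ffunP => g; rewrite !ffunE mulr0. Qed.

Lemma tensZl a F G : tens (a *: F) G = a *: tens F G.
Proof. by apply/ffunP => g; rewrite !ffunE /GRing.scale /= mulrA. Qed.

Lemma tensZr a F G : tens F (a *: G) = a *: tens F G.
Proof. by apply/ffunP => g; rewrite !ffunE /GRing.scale /= mulrCA. Qed.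

(** By the Leibniz rule the power is a combination of tensors of [x^r F] and [x^(N-r) G], and
    [k + l <= N.+1] forces [k <= r] or [l <= N - r]. Peeling off one application at a time avoids
    binomial coefficients. *)
Lemma iter_tens0 x F G k l N :
  (forall r, (k <= r)%N -> iter r (tact x) F = 0) ->
  (forall r, (l <= r)%N -> iter r (tact x) G = 0) ->
  (k + l <= N.+1)%N -> iter N (tact x) (tens F G) = 0.
Proof.
have it0 r : iter r (tact x) (0 : tensor (D + D')%type) = 0.
  by elim: r => //= r ->; rewrite linear0.
elim: N k l F G => [|N IH] k l F G hk hl le.
  have [k0|k0] := posnP k.
    by have := hk 0 ; rewrite k0 => /(_ isT) /= ->; rewrite tens0l.
  have l0 : l = 0 by lia.
  by have := hl 0 ; rewrite l0 => /(_ isT) /= ->; rewrite tens0r.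
have [k0|k0] := posnP k.
  have := hk 0 ; rewrite k0 => /(_ isT) /= ->; rewrite tens0l.
  exact: (it0 N.+1).
have [l0|l0] := posnP l.
  have := hl 0 ; rewrite l0 => /(_ isT) /= ->; rewrite tens0r.
  exact: (it0 N.+1).
rewrite iterSr tact_tens.
have iterD r A B : iter r (tact x) (A + B) = iter r (tact x) A + iter r (tact x) B :> tensor (D + D')%type.
  by elim: r => //= r ->; rewrite linearD.
rewrite iterD (IH k.-1 l) ?(IH k l.-1) ?addr0 //; try lia.
- by move=> r lr; rewrite -iterSr hl //; lia.
- by move=> r kr; rewrite -iterSr hk //; lia.
Qed.

(** The coproduct of a word: all distributions of its letters over two tensor factors, with
    multiplicity. *)
Fixpoint splits (u : seq (posroot n)) : seq (seq (posroot n) * seq (posroot n)) :=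
  if u is b :: u' then
    [seq (b :: p.1, p.2) | p <- splits u'] ++ [seq (p.1, b :: p.2) | p <- splits u']
  else [:: ([::], [::])].

Lemma splits_perm u p : p \in splits u -> perm_eq (p.1 ++ p.2) u.
Proof.
elim: u p => [|b u IH] p /=; first by rewrite inE => /eqP ->.
rewrite mem_cat => /orP[] /mapP[q /IH h ->] /=; first by rewrite perm_cons.
by rewrite -cat1s perm_catCA perm_cons.
Qed.

Lemma splits_perm_ex u v v' : perm_eq (v ++ v') u ->
  exists2 p, p \in splits u & perm_eq p.1 v && perm_eq p.2 v'.
Proof.
elim: u v v' => [|b u IH] v v' h.
  exists ([::], [::]) => //=; move/perm_nilP: h; case: v => [|//] /=; by case: v'.
have := perm_mem h b; rewrite mem_head mem_cat => /orP[bv|bv].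
  have [|p ps /andP[p1 p2]] := IH (rem b v) v'.
    rewrite -(perm_cons b) -cat_cons; apply: perm_trans h.
    by rewrite perm_cat2r perm_sym perm_to_rem.
  exists (b :: p.1, p.2); first by rewrite mem_cat; apply/orP; left; apply/mapP; exists p.
  by rewrite /= p2 andbT perm_sym (permPl (perm_to_rem bv)) perm_cons perm_sym.
have [|p ps /andP[p1 p2]] := IH v (rem b v').
  rewrite -(perm_cons b) -cat1s perm_catCA; apply: perm_trans h.
  by rewrite perm_cat2l perm_sym perm_to_rem.
exists (p.1, b :: p.2); first by rewrite mem_cat; apply/orP; right; apply/mapP; exists p.
by rewrite /= p1 /= perm_sym (permPl (perm_to_rem bv)) perm_cons perm_sym.
Qed.

Lemma word_act_tens u F G : word_act (@tact _) u (tens F G) =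
  \sum_(p <- splits u) tens (word_act (@tact _) p.1 F) (word_act (@tact _) p.2 G).
Proof.
elim: u => [|b u IH] /=; first by rewrite big_seq1.
rewrite IH linear_sum big_cat /= !big_map -big_split /=; apply: eq_bigr => p _.
exact: tact_tens.
Qed.

End Product.
End TensorModule.

(** * Exterior powers and nilpotent matrices of rank one *)

Section Alternating.
Variables (C : numClosedFieldType) (n k : nat) (hk : (k <= n.+1)%N).
Local Notation M := 'M[C]_n.+1.
Local Notation w_ := (widen_ord hk).
Implicit Types (g : {ffun 'I_k -> 'I_n.+1}) (x : M).

Definition alt_mx g : 'M[C]_k := \matrix_(d, c) (g d == w_ c)%:R.

(** The wedge of the first [k] basis vectors, without a factor 1/k!: the coordinate at [g] is the
    sign of [g] if [g] permutes the first [k] indices, and 0 otherwise. *)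
Definition alt : tensor C n 'I_k :=
  [ffun g : {ffun 'I_k -> 'I_n.+1} => \det (alt_mx g)].

Lemma cofactor_alt g d b c : cofactor (alt_mx (upd g d b)) d c = cofactor (alt_mx g) d c.
Proof.
rewrite /cofactor; congr (_ * \det _); apply/matrixP => i j.
by rewrite !mxE ffunE ifN // eq_sym neq_lift.
Qed.

(* The derivative of [det (A (1 + t x))] at [t = 0] is [tr x * det A]. *)
Lemma tact_alt x :
  (forall a b : 'I_n.+1, (b < k)%N -> (k <= a)%N -> x a b = 0) ->
  tact x alt = (\sum_(c < k) x (w_ c) (w_ c)) *: alt.
Proof.
move=> x0; apply/ffunP => g; rewrite !ffunE.
pose A := alt_mx g; pose x' := \matrix_(e, c) x (w_ e) (w_ c).
(* [x'] is the leading block of [x]. Expanding each modified row along its cofactors yields this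
   trace, and the product of the adjugate with [A] is scalar. *)
transitivity (\tr (A *m x' *m \adj A)); last first.
  rewrite -mulmxA mxtrace_mulC -mulmxA mul_adj_mx mul_mx_scalar mxtraceZ mulrC.
  by congr (_ * _); apply: eq_bigr => c _; rewrite mxE.
apply: eq_bigr => d _; rewrite [RHS]mxE.
transitivity (\sum_b \sum_(c < k) x (g d) b * (b == w_ c)%:R * cofactor A d c).
  apply: eq_bigr => b _; rewrite ffunE (expand_det_row _ d) mulr_sumr.
  apply: eq_bigr => c _; rewrite mulrA cofactor_alt; congr (_ * _ * _).
  by rewrite mxE upd_eq.
rewrite exchange_big; apply: eq_bigr => c _; rewrite mxE [in RHS]mxE.
rewrite (bigD1 (w_ c)) //= big1 => [|b ne]; last by rewrite (negbTE ne) mulr0 mul0r.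
rewrite eqxx mulr1 addr0; congr (_ * _).
have [gk|gk] := ltnP (g d) k.
  rewrite (bigD1 (Ordinal gk)) //= big1 => [|e ne].
    rewrite addr0 !mxE; have -> : w_ (Ordinal gk) = g d by apply: val_inj.
    by rewrite eqxx mul1r.
  rewrite !mxE; case: eqP => [ge|]; last by rewrite mul0r.
  by case/eqP: ne; apply: val_inj; rewrite /= ge.
have -> : x (g d) (w_ c) = 0 by apply: x0 => //; apply: (ltn_ord c).
rewrite big1 // => e _; rewrite !mxE; case: eqP => [ge|]; last by rewrite mul0r.
by move: gk; rewrite ge /= leqNgt ltn_ord.
Qed.

Lemma alt_swap g d e a b : d != e ->
  alt (upd (upd g d b) e a) = - alt (upd (upd g d a) e b).
Proof.
move=> de; rewrite !ffunE.
have -> : alt_mx (upd (upd g d b) e a) = xrow d e (alt_mx (upd (upd g d a) e b)).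
  apply/matrixP => i j; rewrite !mxE !ffunE; case: tpermP => [->|->|/eqP ne1 /eqP ne2].
  - by rewrite eqxx (negbTE de) eqxx.
  - by rewrite eqxx (negbTE de) eqxx.
  - by rewrite (negbTE ne1) (negbTE ne2).
by rewrite xrowE det_mulmx det_perm odd_tperm de expr1 mulN1r.
Qed.

Lemma alt_neq0_inj g : alt g != 0 -> injective g.
Proof.
move=> ne d e gde; apply: contraNeq ne => de; rewrite ffunE.
by apply/eqP/(determinant_alternate de) => c; rewrite !mxE gde.
Qed.

Lemma alt_neq0_lt g d : alt g != 0 -> (g d < k)%N.
Proof.
apply: contraNT; rewrite -leqNgt => kd; rewrite ffunE (expand_det_row _ d).
rewrite big1 // => c _; rewrite mxE; case: eqP => [gd|]; last by rewrite mul0r.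
by move: kd; rewrite gd /= leqNgt ltn_ord.
Qed.

Lemma alt_id : alt [ffun d => w_ d] = 1.
Proof.
rewrite ffunE -(det1 C k); congr (\det _); apply/matrixP => i j.
by rewrite !mxE ffunE; congr (_ %:R); congr nat_of_bool; apply/eqP/eqP => [[]/val_inj|->].
Qed.

Definition rank1 (t s : 'I_n.+1 -> C) : M := \matrix_(a, b) (t a * s b).

Lemma rank1_sqr t s : \sum_a s a * t a = 0 -> rank1 t s *m rank1 t s = 0.
Proof.
move=> st; apply/matrixP => a b; rewrite !mxE.
transitivity (t a * (\sum_c s c * t c) * s b); last by rewrite st mulr0 mul0r.
rewrite mulr_sumr mulr_suml; apply: eq_bigr => c _; rewrite !mxE.
by rewrite !mulrA.
Qed.

(** Action twice in one factor vanishes because the matrix has square zero. Action in two factors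
    pairs the symmetric [s a * s b] with the antisymmetric coordinates of [alt]. *)
Lemma tact_rank1_sqr t s : \sum_a s a * t a = 0 ->
  tact (rank1 t s) (tact (rank1 t s) alt) = 0.
Proof.
move=> st; apply/ffunP => g; rewrite tact_tact rank1_sqr // [RHS]ffunE.
rewrite [X in X + _]ffunE big1 => [|d _]; last by rewrite big1 // => b _; rewrite mxE mul0r.
rewrite add0r; apply: big1 => d _; apply: big1 => e ne.
set S := \sum_a _.
have : S = - S.
  rewrite {1}/S exchange_big -sumrN; apply: eq_bigr => a _; rewrite -sumrN.
  apply: eq_bigr => b _; rewrite alt_swap 1?eq_sym // !mxE mulrN; congr (- (_ * _)).
  by rewrite mulrACA [s b * _]mulrC mulrACA.
by move/eqP; rewrite -addr_eq0 -mulr2n mulrn_eq0 => /orP[//|/eqP].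
Qed.

(** The image of the matrix lies in the span of the first [k] basis vectors, so it acts on [alt] by
    its trace, which is zero. *)
Lemma tact_rank1_alt0 t s : (forall a : 'I_n.+1, (k <= a)%N -> t a = 0) ->
  \sum_a s a * t a = 0 -> tact (rank1 t s) alt = 0.
Proof.
move=> t0 st; rewrite tact_alt => [|a b _ ka]; last by rewrite mxE t0 ?mul0r.
suff -> : \sum_(c < k) rank1 t s (w_ c) (w_ c) = \sum_a s a * t a by rewrite st scale0r.
rewrite (bigID (fun a : 'I_n.+1 => (a < k)%N)) /= [X in _ + X]big1 => [|a]; last first.
  by rewrite -leqNgt => /t0 ->; rewrite mulr0.
rewrite addr0 (big_ord_narrow hk); apply: eq_bigr => c _.
by rewrite mxE mulrC.
Qed.

Lemma tact_rank1_alt0' t s : (forall a : 'I_n.+1, (a < k)%N -> s a = 0) ->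
  tact (rank1 t s) alt = 0.
Proof.
move=> s0; rewrite tact_alt => [|a b bk ka]; last by rewrite mxE s0 ?mulr0.
rewrite big1 ?scale0r // => c _; rewrite mxE s0 ?mulr0 //=; exact: ltn_ord.
Qed.

End Alternating.

Lemma fund_le n (l : 'I_n) : (l.+1 <= n.+1)%N. Proof. exact: leqW (ltn_ord l). Qed.

(** * Antichains as leading words in an exterior power *)

Section LeadingWords.
Variables (C : numClosedFieldType) (n : nat) (l : 'I_n).
Local Notation k := (nat_of_ord l).+1.
Local Notation hk := (fund_le l).
Local Notation w_ := (widen_ord hk).
Local Notation alt := (alt C hk).
Implicit Types (g : {ffun 'I_k -> 'I_n.+1}) (b : posroot n) (u a : seq (posroot n)).

Definition word_weight u : nat := (\sum_(b <- u) (root_fst b).+1 * (root_snd b).+1)%N.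

Definition antichain a : Prop :=
  [/\ uniq a, (forall b, b \in a -> root_fst b <= l <= root_snd b)%N &
      {in a &, forall b c, b != c -> nested b c || nested c b}].

Let cnt g (P : pred nat) : nat := (\sum_d P (g d))%N.

Let cnt_upd g d (x : 'I_n.+1) P : (cnt (upd g d x) P + P (g d) = cnt g P + P x)%N.
Proof.
rewrite /cnt (bigD1 d) //= [in RHS](bigD1 d) //= upd_eq addnC [RHS]addnC addnCA.
by congr (_ + (_ + _))%N; apply: eq_bigr => e ne; rewrite ffunE (negbTE ne).
Qed.

Let row b : 'I_n.+1 := lift ord0 (root_snd b).
Let col b : 'I_n.+1 := widen_ord (leqnSn n) (root_fst b).

Let high (x : nat) := (k <= x)%N.

(** Read backwards, each letter [b] replaces one entry [row b] of [g] by [col b], so it removes at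
    most one high entry, and the word has to end at a permutation of the low indices. If the number
    of high entries equals the length, every letter carries a low index to a high one, and [g]
    determines both margins of [u]. *)
Lemma word_alt_neq0 u g : word_act (@tact _ _ _) u alt g != 0 ->
  (cnt g high <= size u)%N /\ (cnt g high = size u ->
  [/\ forall x, high x -> cnt g (pred1 x) = count (fun b => (root_snd b).+1 == x) u,
      forall x, ~~ high x -> (cnt g (pred1 x) + count (fun b => root_fst b == x :> nat) u = 1)%N &
      forall b, b \in u -> ~~ high (root_fst b) && high (root_snd b).+1]).
Proof.
elim: u g => [|b u IH] g /=.
  move=> ne; have lt d := alt_neq0_lt d ne; have inj := alt_neq0_inj ne.
  have e0 (P : pred nat) : (forall d : 'I_k, ~~ P (g d)) -> cnt g P = 0.
    by move=> h; rewrite /cnt big1 // => d _; rewrite (negbTE (h d)).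
  have e1 : cnt g high = 0 by apply: e0 => d; rewrite /high -ltnNge.
  split=> [|_]; first by rewrite e1.
  split=> // [x hx|x]; first by apply: e0 => d /=; move: hx (lt d); rewrite /high; lia.
  rewrite addn0 /high -ltnNge => xk.
  pose h d : 'I_k := Ordinal (lt d).
  have hinj : injective h by move=> d e [] /val_inj/inj.
  have [h' _ hK] := injF_bij hinj.
  rewrite /cnt (bigD1 (h' (Ordinal xk))) //= big1 ?addn0.
    by have := congr1 val (hK (Ordinal xk)) => /= ->; rewrite eqxx.
  move=> d ne1; case: eqP => // gx; case/eqP: ne1; apply: hinj; rewrite hK.
  exact: val_inj.
rewrite tact_lower; have [d /andP[/eqP gd ne] _|none] := pickP
  (fun d => (g d == row b) && (word_act (@tact _ _ _) u alt (upd g d (col b)) != 0)); last first.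
  rewrite big1 ?eqxx // => d gd; apply/eqP; have := none d; rewrite gd /=.
  by move/negbFE.
have [le eq] := IH _ ne; have up (P : pred nat) := cnt_upd g d (col b) P.
have gd' : g d = (root_snd b).+1 :> nat by rewrite gd.
rewrite gd' /= in up.
split=> [|sz].
  by move: le (up high); case: (high _); case: (high _); lia.
have [h1 h2 sz'] : [/\ high (root_snd b).+1, ~~ high (root_fst b) & cnt (upd g d (col b)) high = size u].
  by move: le (up high) sz; case: (high _); case: (high _); split=> //; lia.
have [c1 c2 c3] := eq sz'; split.
- move=> x hx; move: (up (pred1 x)); rewrite (c1 x hx) /=.
  have -> : (root_fst b == x :> nat) = false.
    by apply/eqP => e; move: h2; rewrite e hx.
  by rewrite addn0 addnC => ->.
- move=> x hx; move: (c2 x hx) (up (pred1 x)); rewrite /=.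
  by case: (_.+1 =P x) => [e|_]; [move: hx; rewrite -e h1|lia].
by move=> c; rewrite inE => /predU1P[->|/c3 //]; rewrite h1 h2.
Qed.

(** The index of the basis tensor reached from the identity arrangement when each [b] in [a] moves
    its own left end to [row b]. *)
Definition lead_point a : {ffun 'I_k -> 'I_n.+1} :=
  [ffun d : 'I_k => if [pick b | (b \in a) && (root_fst b == d :> nat)] is Some b
    then row b else w_ d].

Lemma lead_point_perm a u : perm_eq a u -> lead_point a = lead_point u.
Proof.
move=> au; apply/ffunP => d; rewrite !ffunE.
by rewrite (@eq_pick _ _ (fun b => (b \in u) && (root_fst b == d :> nat))) // => b; rewrite (perm_mem au).
Qed.

(** Members of an antichain have distinct left ends and distinct right ends, so each letter can act
    at one site only and no multiplicities or signs arise. *)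
Lemma word_alt_lead a : antichain a ->
  word_act (@tact _ _ _) a alt (lead_point a) = 1 /\ cnt (lead_point a) high = size a.
Proof.
elim: a => [|b a IH] [un hR an].
  have -> : lead_point [::] = [ffun d => w_ d].
    by apply/ffunP => d; rewrite !ffunE; case: pickP.
  rewrite /= alt_id; split=> //; rewrite /cnt big1 // => d _.
  by rewrite ffunE /high /= leqNgt ltn_ord.
have /IH[e1 e2] : antichain a.
  have ua : uniq a by case/andP: un.
  split=> [//|c ca|c d ca da].
    by apply: hR; rewrite inE ca orbT.
  by apply: an; rewrite inE ?ca ?da orbT.
have /andP[bl lb] := hR b (mem_head _ _).
have ba c : c \in b :: a -> (root_fst c == root_fst b :> nat) || (root_snd c == root_snd b :> nat) -> c = b.
  move=> ca; case: (c =P b) => // /eqP ne; have := an _ _ ca (mem_head _ _) ne.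
  rewrite /nested; lia.
have bk : (root_fst b < k)%N by rewrite ltnS.
pose d0 : 'I_k := Ordinal bk.
have nba : b \notin a by case/andP: un.
have up : upd (lead_point (b :: a)) d0 (col b) = lead_point a.
  apply/ffunP => d; rewrite !ffunE; case: (d =P d0) => [->|ne].
    case: pickP => [c /andP[ca /eqP cb]|_]; last exact: val_inj.
    by case/negP: nba; rewrite -(ba c) ?inE ?ca ?orbT // cb eqxx.
  rewrite (@eq_pick _ _ (fun c => (c \in a) && (root_fst c == d :> nat))) // => c.
  rewrite inE; case: (c =P b) => //= ->; rewrite (negbTE nba) /=.
  by apply/eqP => e; apply: ne; apply: val_inj.
have gd0 : lead_point (b :: a) d0 = row b.
  rewrite ffunE; case: pickP => [c /andP[ca cb]|/(_ b)]; last by rewrite mem_head eqxx.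
  by rewrite (ba c) // cb.
split; last first.
  have := cnt_upd (lead_point (b :: a)) d0 (col b) high.
  have -> : high (lead_point (b :: a) d0) by rewrite gd0.
  have -> : high (col b) = false by apply/negbTE; rewrite -ltnNge.
  by rewrite up e2 /=; lia.
rewrite /= tact_lower (bigD1 d0) ?gd0 //= up e1 big1 ?addr0 // => d /andP[/eqP gd ne].
case/eqP: ne; apply: val_inj => /=; move: gd; rewrite ffunE.
case: pickP => [c /andP[ca /eqP <-]|_] /(congr1 val) /=; rewrite /bump /= !add1n.
  by case=> cb; rewrite (ba c) // cb eqxx orbT.
by move=> e; have := ltn_ord d; rewrite e; lia.
Qed.

(** For [u] not larger than [a], a nonzero coordinate fixes the size and both margins of [u]; with
    these margins the antichain is the only minimum of [word_weight]. *)
Lemma word_alt_leading a u : antichain a ->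
  (perm_eq u a -> word_act (@tact _ _ _) u alt (lead_point a) = 1) /\
  (~~ perm_eq u a ->
   (size u < size a)%N || (size u == size a) && (word_weight u <= word_weight a)%N ->
   word_act (@tact _ _ _) u alt (lead_point a) = 0).
Proof.
move=> an; split.
  move=> ua; rewrite -(lead_point_perm ua); apply: (proj1 (word_alt_lead _)).
  case: an => un hR an; split=> [|b|b c]; rewrite ?(perm_uniq ua) // ?(perm_mem ua); first exact: hR.
  exact: an.
have [e1 e2] := word_alt_lead an.
move=> nua le; apply/eqP; apply: contraNT nua => ne.
have ne' : word_act (@tact _ _ _) a alt (lead_point a) != 0 by rewrite e1 oner_eq0.
have [le1 /(_ _)eq1] := word_alt_neq0 ne; have [_ /(_ e2)[a1 a2 a3]] := word_alt_neq0 ne'.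
have {le} [sz wt] : size u = size a /\ (word_weight u <= word_weight a)%N by move: le le1; rewrite e2; lia.
have [|u1 u2 u3] := eq1; first by rewrite e2.
have pf : perm_eq [seq nat_of_ord (root_fst b) | b <- u] [seq nat_of_ord (root_fst b) | b <- a].
  apply/allP => x _; apply/eqP; rewrite /= !count_map.
  have [hx|hx] := boolP (high x); last first.
    have E v : count (preim (fun b => nat_of_ord (root_fst b)) (pred1 x)) v =
      count (fun b => root_fst b == x :> nat) v by [].
    by have := u2 x hx; have := a2 x hx; rewrite !E; lia.
  have z v : (forall b, b \in v -> ~~ high (root_fst b) && high (root_snd b).+1) ->
      count (preim (fun b => nat_of_ord (root_fst b)) (pred1 x)) v = 0.
    move=> h; apply/eqP; rewrite -leqn0 leqNgt -has_count; apply/hasPn => b /h /= /andP[hb _].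
    by apply: contraNneq hb => ->.
  by rewrite !z.
have ps : perm_eq [seq nat_of_ord (root_snd b) | b <- u] [seq nat_of_ord (root_snd b) | b <- a].
  apply/allP => x _; apply/eqP; rewrite /= !count_map.
  have [hx|hx] := boolP (high x.+1).
    have := u1 _ hx; rewrite (a1 _ hx) => h; symmetry; move: h.
    by rewrite (@eq_count _ _ (preim (fun b => nat_of_ord (root_snd b)) (pred1 x))) // => ->.
  have z v : (forall b, b \in v -> ~~ high (root_fst b) && high (root_snd b).+1) ->
      count (preim (fun b => nat_of_ord (root_snd b)) (pred1 x)) v = 0.
    move=> h; apply/eqP; rewrite -leqn0 leqNgt -has_count; apply/hasPn => b /h /= /andP[_ hb].
    by apply: contraNneq hx => <-.
  by rewrite !z.
(* Reflecting the right end turns the antichain into a chain. The reflected weight and [word_weight]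
   add up to [(n + 1)] times the sum of the [(root_fst b).+1], which the margins fix, so [chain_max]
   applies. *)
pose f b : nat * nat := (nat_of_ord (root_fst b), n - (root_snd b).+1)%N.
have finj : injective f.
  move=> b c [h1 h2]; apply: root_inj; apply: val_inj => //=.
  by have := ltn_ord (root_snd b); have := ltn_ord (root_snd c); lia.
apply: (perm_map_inj finj); apply: chain_max.
- move=> _ _ /mapP[b ba ->] /mapP[c ca ->]; rewrite /chain_comparable /=.
  have [->|bc] := eqVneq b c; first by rewrite !leqnn.
  case: an => _ _ /(_ _ _ ba ca bc); rewrite /nested.
  by have := ltn_ord (root_snd b); have := ltn_ord (root_snd c); lia.
- move=> x; rewrite !count_map; have /seq.permP/(_ (leq x)) := pf; rewrite !count_map; exact.
- move=> x; rewrite !count_map; have /seq.permP/(_ (fun y => x <= n - y.+1)%N) := ps; rewrite !count_map; exact.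
rewrite !big_map /=.
have E v : (\sum_(b <- v) (root_fst b).+1 * (n - (root_snd b).+1).+1 + word_weight v =
    (n + 1) * \sum_(b <- v) (root_fst b).+1)%N.
  rewrite /word_weight -big_split big_distrr /=; apply: eq_bigr => b _.
  by rewrite -mulnDr mulnC; congr (_ * _)%N; have := ltn_ord (root_snd b); lia.
have := E u; have := E a.
have -> : (\sum_(b <- u) (root_fst b).+1 = \sum_(b <- a) (root_fst b).+1)%N.
  by rewrite -(big_map (fun b => nat_of_ord (root_fst b)) xpredT succn)
     -(big_map (fun b => nat_of_ord (root_fst b)) xpredT succn); apply: perm_big.
lia.
Qed.

End LeadingWords.

(** * Highest weight vectors in tensor products *)

Section Models.
Variables (C : numClosedFieldType) (n : nat).
Local Notation M := 'M[C]_n.+1.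
Implicit Types (u : seq (posroot n)) (s : {ffun posroot n -> nat}) (m : 'I_n -> nat).

Definition has_content u s := [forall b, count_mem b u == s b].

Lemma has_contentP u s : reflect (forall b, count_mem b u = s b) (has_content u s).
Proof. by apply: (iffP forallP) => h b; apply/eqP. Qed.

Definition content_size s := (\sum_b s b)%N.
Definition content_weight s := (\sum_b s b * ((root_fst b).+1 * (root_snd b).+1))%N.

Definition content_word s := flatten [seq nseq (s b) b | b <- enum {: posroot n}].

Lemma content_wordP s : has_content (content_word s) s.
Proof.
apply/has_contentP => b; rewrite count_flatten sumnE 2!big_map big_enum (bigD1 b) //=.
rewrite count_nseq /= eqxx mul1n big1 ?addn0 // => c cb.
by rewrite count_nseq /= (negbTE cb).
Qed.

Lemma sum_content (F : posroot n -> nat) u :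
  (\sum_(b <- u) F b = \sum_b count_mem b u * F b)%N.
Proof.
elim: u => [|c u IH]; first by rewrite big_nil big1 // => b _; rewrite mul0n.
rewrite big_cons IH [RHS](bigD1 c) //= [X in (_ + X)%N](bigD1 c) //= eqxx mulnDl mul1n addnA.
by congr (_ + _)%N; apply: eq_bigr => b; rewrite eq_sym => /negbTE ->.
Qed.

Lemma content_sizeE u s : has_content u s -> size u = content_size s.
Proof.
move=> /has_contentP h; rewrite -sum1_size sum_content.
by apply: eq_bigr => b _; rewrite h muln1.
Qed.

Lemma content_weightE u s : has_content u s -> word_weight u = content_weight s.
Proof.
by move=> /has_contentP h; rewrite /word_weight sum_content; apply: eq_bigr => b _; rewrite h.
Qed.

Definition word_le u s :=
  (size u < content_size s)%N ||
  (size u == content_size s) && (word_weight u <= content_weight s)%N.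

Definition highest_weight m (x : M) : C :=
  \sum_(i < n) (m i)%:R * \sum_(a < n.+1 | (a <= i)%N) x a a.

Definition is_upper (x : M) := forall a b : 'I_n.+1, (b < a)%N -> x a b = 0.

(* The irreducible module of highest weight [m] is generated by a vector [w] of
   a tensor power of C^(n+1); [good_model] lists what is needed about [w].
   In [gm_lead], the [g]-coordinate of [w] detects the words of content [s]:
   it vanishes on the other words that are not larger than [s]. *)
Record good_model m (D : finType) (w : tensor C n D) : Prop := {
  gm_hw : forall x, is_upper x -> tact x w = highest_weight m x *: w;
  gm_lead : forall s, S_lambda m s -> exists g, forall u,
    (has_content u s -> 0 < word_act (@tact _ _ _) u w g) /\
    (~~ has_content u s -> word_le u s -> word_act (@tact _ _ _) u w g = 0);
  gm_nil : forall (i j : 'I_n) (t s : 'I_n.+1 -> C),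
    (forall a : 'I_n.+1, ~~ (i <= a <= j)%N -> s a = 0) ->
    (forall a : 'I_n.+1, ~~ (i <= a <= j.+1)%N -> t a = 0) ->
    \sum_a s a * t a = 0 ->
    forall N, (\sum_(l < n | i <= l <= j) m l < N)%N -> iter N (tact (rank1 t s)) w = 0 }.

Lemma iter_tact0 D x N (w : tensor C n D) : tact x w = 0 -> (0 < N)%N -> iter N (tact x) w = 0.
Proof.
case: N => // N x0 _; rewrite iterSr x0.
by elim: N => //= N ->; rewrite linear0.
Qed.

Lemma good_model0 m : (forall i, m i = 0) -> good_model m (alt C (leq0n n.+1)).
Proof.
move=> m0; have t0 x : tact x (alt C (leq0n n.+1)) = 0.
  by rewrite (tact_alt (leq0n n.+1)) // big_ord0 scale0r.
split=> [x _|s Ss|i j t s _ _ _ N hN].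
- by rewrite t0 /highest_weight big1 ?scale0r // => i _; rewrite m0 mul0r.
- have s0 b : s b = 0 by apply: (S_lambda0 Ss) => j _; apply: m0.
  exists [ffun d => ord0] => u; split.
    move=> /content_sizeE; rewrite /content_size big1 // => /size0nil -> /=.
    by rewrite ffunE det_mx00 ltr01.
  case: u => [/has_contentP[]//|b u _]; rewrite /word_le /content_size /content_weight !big1 //=.
  by move=> c _; rewrite s0.
- by apply: iter_tact0 => //; apply: leq_ltn_trans hN.
Qed.

Lemma tact_alt_upper (l : 'I_n) (x : M) : is_upper x ->
  tact x (alt C (fund_le l)) = (\sum_(a < n.+1 | (a <= l)%N) x a a) *: alt C (fund_le l).
Proof.
move=> ux; rewrite tact_alt => [|a b bk ka]; last by apply: ux; apply: leq_trans ka.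
by rewrite (big_ord_narrow (fund_le l)).
Qed.

(** The exterior power of degree [l.+1] contributes one to the nilpotency bound exactly for [l]
    between [i] and [j]. For [l < i] the matrix kills the low basis vectors, for [l > j] it maps
    into their span with trace zero, and in between its square acts by zero. *)
Lemma tact_alt_nil (l i j : 'I_n) (t s : 'I_n.+1 -> C) N :
    (forall a : 'I_n.+1, ~~ (i <= a <= j)%N -> s a = 0) ->
    (forall a : 'I_n.+1, ~~ (i <= a <= j.+1)%N -> t a = 0) ->
    \sum_a s a * t a = 0 ->
  ((i <= l <= j)%N < N)%N -> iter N (tact (rank1 t s)) (alt C (fund_le l)) = 0.
Proof.
move=> s0 t0 st; have [il|li] := leqP i l; last first.
  by rewrite /= => N0; apply: iter_tact0 => //; apply: tact_rank1_alt0' => a al; apply: s0; lia.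
have [lj|jl] := leqP l j; last first.
  by rewrite /= => N0; apply: iter_tact0 => //; apply: tact_rank1_alt0 => // a al; apply: t0; lia.
case: N => [|[|N]] //= _; rewrite -!iterS !iterSr tact_rank1_sqr //.
by elim: N => //= N ->; rewrite linear0.
Qed.

Lemma lead_point_lt (l : 'I_n) a u : antichain l a ->
  [\/ perm_eq u a /\ word_act (@tact _ _ _) u (alt C (fund_le l)) (lead_point l a) = 1,
      ~~ perm_eq u a /\ word_act (@tact _ _ _) u (alt C (fund_le l)) (lead_point l a) = 0 |
      (size a < size u)%N || (size a == size u) && (word_weight a < word_weight u)%N].
Proof.
move=> an; have [h1 h2] := word_alt_leading C u an.
case pa: (perm_eq u a); first by constructor 1; rewrite h1.
have npa : ~~ perm_eq u a by rewrite pa.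
case: (boolP ((size u < size a)%N ||
  (size u == size a) && (word_weight u <= word_weight a)%N)) => [le|nle].
  by constructor 2; split=> //; apply: h2.
constructor 3; move: nle; lia.
Qed.

(** An exterior factor of degree [i.+1] adds one fundamental weight. The detecting coordinate for
    [s] joins the leading point of the antichain [a] to the coordinate that detects [s']. *)
Lemma good_model_step m (i : 'I_n) D (w : tensor C n D) : (0 < m i)%N ->
  good_model (fun j => m j - (j == i))%N w ->
  (forall s, S_lambda m s -> exists2 a, antichain i a & exists2 s',
     S_lambda (fun j => m j - (j == i))%N s' & forall b, s b = ((b \in a) + s' b)%N) ->
  good_model m (tens (alt C (fund_le i)) w).
Proof.
move=> mi gw split_s; have mE j : (m j = (j == i) + (m j - (j == i)))%N.
  by case: eqP => [->|]; rewrite ?subn0 // subnKC.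
split=> [x ux|s Ss|k l t s s0 t0 st N lN].
- rewrite tact_tens (gm_hw gw ux) tact_alt_upper // tensZl tensZr -scalerDl; congr (_ *: _).
  rewrite /highest_weight (bigD1 i) //= [in RHS](bigD1 i) //= addrA; congr (_ + _).
    by rewrite eqxx -[X in X + _]mul1r -mulrDl {2}(mE i) eqxx natrD.
  by apply: eq_bigr => j /negbTE ji; rewrite ji subn0.
- have [a an [s' Ss' sE]] := split_s s Ss.
  have [g hg] := gm_lead gw Ss'.
  have ca b : count_mem b a = (b \in a) by case: an => ua _ _; rewrite count_uniq_mem.
  have szE : content_size s = (size a + content_size s')%N.
    rewrite -sum1_size sum_content -big_split /=; apply: eq_bigr => b _.
    by rewrite sE ca muln1.
  have wtE : content_weight s = (word_weight a + content_weight s')%N.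
    rewrite /word_weight sum_content -big_split /=; apply: eq_bigr => b _.
    by rewrite sE ca mulnDl.
  pose g0 : {ffun 'I_i.+1 + D -> 'I_n.+1} :=
    [ffun d => match d with inl d => lead_point i a d | inr d => g d end].
  have tg F (G : tensor C n D) : tens F G g0 = F (lead_point i a) * G g.
    by rewrite ffunE; congr (F _ * G _); apply/ffunP => d; rewrite !ffunE.
  have cp (p : seq (posroot n) * seq (posroot n)) u : perm_eq (p.1 ++ p.2) u -> forall b, (count_mem b p.1 + count_mem b p.2 = count_mem b u)%N.
    by move=> /seq.permP pu b; rewrite -pu count_cat.
  exists g0 => u.
  (* Size and weight are additive over a splitting. If the first part is smaller than [a], or ties
     with it without being a rearrangement, its factor vanishes; if it is larger, the second part is
     strictly below [s'] and its factor vanishes. *)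
  have term (p : seq (posroot n) * seq (posroot n)) : p \in splits u -> has_content u s || word_le u s ->
     word_act (@tact _ _ _) p.1 (alt C (fund_le i)) (lead_point i a) *
     word_act (@tact _ _ _) p.2 w g =
     (if perm_eq p.1 a && has_content p.2 s' then word_act (@tact _ _ _) p.2 w g else 0).
    move=> /splits_perm pu us.
    have sz : (size p.1 + size p.2 = size u)%N by rewrite -size_cat (perm_size pu).
    have wt : (word_weight p.1 + word_weight p.2 = word_weight u)%N.
      by rewrite /word_weight -big_cat; apply: perm_big.
    have ule : word_le u s.
      case/orP: us => // us; rewrite /word_le (content_sizeE us) (content_weightE us).
      by rewrite eqxx leqnn orbT.
    have [h1 h2] := hg p.2.
    have [[pa ->]|[npa ->]|lt] := lead_point_lt p.1 an.
    + rewrite pa mul1r /=; case: ifP => // /negbT nc; rewrite h2 //.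
      have sza : size p.1 = size a := perm_size pa; have wta : word_weight p.1 = word_weight a by apply: perm_big.
      move: ule; rewrite /word_le szE wtE. lia.
    + by rewrite (negbTE npa) mul0r.
    + case: ifP => [/andP[pa _]|_].
        have sza : size p.1 = size a := perm_size pa; have wta : word_weight p.1 = word_weight a by apply: perm_big.
        move: lt; lia.
      rewrite h2 ?mulr0 //; last by move: ule lt; rewrite /word_le szE wtE; lia.
      apply/negP => c2; move: ule lt (content_sizeE c2) (content_weightE c2).
      by rewrite /word_le szE wtE; lia.
  have E : has_content u s || word_le u s ->
     word_act (@tact _ _ _) u (tens (alt C (fund_le i)) w) g0 =
     \sum_(p <- splits u | perm_eq p.1 a && has_content p.2 s') word_act (@tact _ _ _) p.2 w g.
    move=> us; rewrite word_act_tens sum_ffunE [RHS]big_mkcond; apply: eq_big_seq => p pu.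
    by rewrite tg term.
  split=> [us|us le].
    have ge0 (p : seq (posroot n) * seq (posroot n)) : perm_eq p.1 a && has_content p.2 s' ->
      0 <= word_act (@tact _ _ _) p.2 w g.
      by case/andP => _ c2; apply/ltW/(proj1 (hg p.2)).
    rewrite E ?us // lt0r sumr_ge0 // andbT psumr_eq0 // -has_predC.
    (* All surviving terms are nonnegative; one that is positive suffices, and it comes from the
       decomposition of [s] into [a] and [s']. *)
    have [p pu /andP[p1 p2]] : exists2 p, p \in splits u & perm_eq p.1 a && has_content p.2 s'.
      pose v := content_word s'; have /has_contentP cv := content_wordP s'.
      have [|p pu /andP[p1 p2]] := @splits_perm_ex _ u a v.
        apply/allP => b _; apply/eqP; rewrite /= count_cat ca cv -sE.
        by move/has_contentP: us.
      exists p => //; rewrite p1; apply/has_contentP => b; rewrite -cv.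
      by move/seq.permP: p2 => ->.
    apply/hasP; exists p => //=; rewrite p1 p2 /= gt_eqF //; exact: (proj1 (hg p.2)).
  rewrite E ?le ?orbT // big_seq_cond big1 // => p /andP[/splits_perm pu /andP[p1 p2]].
  case/negP: us; apply/has_contentP => b; rewrite sE -ca -(cp _ _ pu).
  by move/seq.permP: p1 => ->; move/has_contentP: p2 => ->.
- have mS : (\sum_(j < n | k <= j <= l) m j =
      (k <= i <= l) + \sum_(j < n | k <= j <= l) (m j - (j == i)))%N.
    rewrite (eq_bigr _ (fun j _ => mE j)) big_split /=; congr (_ + _)%N.
    rewrite big_mkcond (bigD1 i) //= eqxx big1 ?addn0; first by case: ifP.
    by move=> j /negbTE ->; case: ifP.
  apply: (@iter_tens0 _ _ _ _ _ _ _ (k <= i <= l)%N.+1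
    (\sum_(j < n | k <= j <= l) (m j - (j == i)))%N.+1) => [r hr|r hr|].
  + exact: tact_alt_nil hr.
  + exact: (gm_nil gw s0 t0 st hr).
  + by rewrite addSn addnS ltnS -mS.
Qed.

Theorem good_model_ex m : exists (D : finType) (w : tensor C n D), good_model m w.
Proof.
have [N le] := ubnP (\sum_i m i)%N; elim: N m le => // N IH m le.
have [[i mi]|m0] := pselect (exists i, 0 < m i)%N; last first.
  exists 'I_0, (alt C (leq0n n.+1)); apply: good_model0 => i.
  by apply/eqP; rewrite -leqn0 leqNgt; apply/negP => mi; apply: m0; exists i.
(* The least index with [m k > 0], as [S_lambda_split] requires. *)
have [k mk kmin] := arg_minnP (P := fun i => (0 < m i)%N) (@nat_of_ord n) mi.
have m0 (j : 'I_n) : (j < k)%N -> m j = 0.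
  by move=> jk; apply/eqP; rewrite -leqn0 leqNgt; apply/negP => /kmin; rewrite leqNgt jk.
have [|D [w gw]] := IH (fun j => m j - (j == k))%N.
  rewrite ltnS in le; apply: leq_trans le; rewrite (bigD1 k) //= [X in (_ < X)%N](bigD1 k) //= eqxx.
  rewrite -addSn subn1 prednK // leq_add2l; apply: leq_sum => j _; exact: leq_subr.
exists ('I_k.+1 + D)%type, (tens (alt C (fund_le k)) w).
apply: good_model_step => // s Ss.
have [a [s' [h1 h2 h3 [h4 h5]]]] := S_lambda_split Ss mk m0.
by exists a => //; exists s'.
Qed.

End Models.

(** * Highest weight modules *)

Section LinSpan.
Variables (K : fieldType) (V : lmodType K).
Implicit Types (A B : set V).

Lemma lin_span_min A B : submodule B -> (forall z, A z -> B z) -> forall z, lin_span A z -> B z.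
Proof.
move=> [B0 Bl] AB _ [r hr ->]; elim: r hr => [|t r IH] hr; first by rewrite big_nil.
rewrite big_cons; apply: Bl; first by apply/AB/hr; rewrite mem_head.
by apply: IH => s sr; apply: hr; rewrite inE sr orbT.
Qed.

Lemma submoduleD B x y : submodule B -> B x -> B y -> B (x + y).
Proof. by move=> [_ Bl] Bx By; rewrite -[x]scale1r; apply: Bl. Qed.

Lemma submoduleZ B a x : submodule B -> B x -> B (a *: x).
Proof. by move=> [B0 Bl] Bx; rewrite -[_ *: x]addr0; apply: Bl. Qed.

Lemma submoduleN B x : submodule B -> B x -> B (- x).
Proof. by move=> sB Bx; rewrite -scaleN1r; apply: submoduleZ. Qed.

Lemma submoduleB B x y : submodule B -> B x -> B y -> B (x - y).
Proof. by move=> sB Bx By; apply: submoduleD => //; apply: submoduleN. Qed.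

Lemma submodule_sum B (I : eqType) (r : seq I) (P : pred I) (F : I -> V) : submodule B ->
  (forall i, i \in r -> P i -> B (F i)) -> B (\sum_(i <- r | P i) F i).
Proof.
move=> sB BF; rewrite big_seq_cond; elim/big_ind: _ => [|x y|i /andP[]]; last exact: BF.
  by case: sB.
exact: submoduleD.
Qed.

Lemma submodule_preim (W : lmodType K) (f : {linear V -> W}) (B : set W) :
  submodule B -> submodule (fun z => B (f z)).
Proof.
move=> [B0 Bl]; split; first by rewrite linear0.
by move=> a x y Bx By; rewrite linearP; apply: Bl.
Qed.

End LinSpan.

Section HighestWeightModule.
Variables (C : numClosedFieldType) (n : nat).
Local Notation M := 'M[C]_n.+1.
Implicit Types (x y : M) (b : posroot n) (u : seq (posroot n)).

Lemma sl_lower b : sl (lower_gen C b).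
Proof.
rewrite /sl /= /mxtrace big1 // => a _; rewrite mxE; case: eqP => [->|//].
rewrite andTb; case: eqP => // /(congr1 val) /=; rewrite /bump /= add1n => e.
by have := root_fst_snd b; rewrite -e ltnn.
Qed.

Lemma sl_sub x y a : sl x -> sl y -> sl (a *: x + y).
Proof. by rewrite /sl /= => hx hy; rewrite mxtraceD mxtraceZ hx hy mulr0 addr0. Qed.

Lemma sl_bracket x y : sl (lie_bracket x y).
Proof. by rewrite /sl /= /lie_bracket linearB /= mxtrace_mulC subrr. Qed.

Lemma lower_part_upper x :
  is_upper (x - \sum_b x (lift ord0 (root_snd b)) (widen_ord (leqnSn n) (root_fst b)) *: lower_gen C b).
Proof.
move=> a c ca; rewrite !mxE summxE; apply/eqP; rewrite subr_eq0; apply/eqP.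
have an : (a.-1 < n)%N by have := ltn_ord a; lia.
have cn : (c < n)%N by have := ltn_ord a; lia.
have h : (Ordinal cn <= Ordinal an)%N by rewrite /=; lia.
have ea : lift ord0 (Ordinal an) = a.
  by apply: val_inj; rewrite /= /bump /= add1n prednK //; lia.
have ec : widen_ord (leqnSn n) (Ordinal cn) = c by apply: val_inj.
rewrite (bigD1 (mkroot h)) //= big1 ?addr0 => [|b nb].
  by rewrite !mxE mkroot_fst mkroot_snd ea ec !eqxx mulr1.
rewrite !mxE; case: eqP => [e1|_]; last by rewrite mulr0.
case: eqP => [e2|_]; last by rewrite mulr0.
case/eqP: nb; apply: root_inj; apply: val_inj; rewrite ?mkroot_fst ?mkroot_snd /=.
  by rewrite e2.
by rewrite e1.
Qed.

Section Module.
Variables (U : lmodType C) (act : M -> {linear U -> U}) (u0 : U) (wt : M -> C).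
Hypothesis act_rep : sl_representation act.
Hypothesis act_hw : forall x, sl x -> is_upper x -> act x u0 = wt x *: u0.

Definition wact u : U := word_act (fun x => act x) u u0.

Definition fil_word k : set U := lin_span [set z | exists2 u, (size u <= k)%N & z = wact u].

Lemma fil_word_sub k : submodule (fil_word k). Proof. exact: lin_span_submodule. Qed.

Lemma fil_word_wact u k : (size u <= k)%N -> fil_word k (wact u).
Proof. by move=> uk; apply: lin_span_incl; exists u. Qed.

Lemma fil_word_mono k l z : (k <= l)%N -> fil_word k z -> fil_word l z.
Proof.
by move=> kl; apply: lin_span_sub => t [u uk ->]; exists u => //; apply: leq_trans kl.
Qed.

Lemma fil_word_lower b k z : fil_word k z -> fil_word k.+1 (act (lower_gen C b) z).
Proof.
apply: (lin_span_min (submodule_preim (act (lower_gen C b)) (fil_word_sub k.+1))).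
by move=> _ [u uk ->]; apply: (@fil_word_wact (b :: u)).
Qed.

Lemma sl0 : sl (0 : M). Proof. by rewrite /sl /= mxtrace0. Qed.

Lemma act0 z : act 0 z = 0.
Proof.
by have := (proj1 act_rep) (-1) 0 0 z sl0 sl0; rewrite scaler0 addr0 scaleN1r addNr.
Qed.

Lemma act_sum (I : finType) (x : I -> M) (c : I -> C) z : (forall i, sl (x i)) ->
  sl (\sum_i c i *: x i) /\ act (\sum_i c i *: x i) z = \sum_i c i *: act (x i) z.
Proof.
move=> slx; elim: (index_enum I) => [|i r [IH1 IH2]]; first by rewrite !big_nil act0; split=> //; exact: sl0.
by rewrite !big_cons (proj1 act_rep) // IH2; split=> //; apply: sl_sub.
Qed.

(** Move [x] past the first letter; the commutator is again in sl and meets a shorter word. On the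
    empty word, the strictly lower part of [x] adds one letter and the upper part acts by a
    scalar. *)
Lemma act_fil_word_wact x u : sl x ->
  fil_word (size u).+1 (act x (wact u)) /\
  (is_upper x -> fil_word (size u) (act x (wact u))).
Proof.
elim: u x => [|b u IH] x slx.
  split; last first.
    by move=> ux; rewrite act_hw //; apply: submoduleZ (fil_word_sub _) (@fil_word_wact [::] _ _).
  set c := fun b => x (lift ord0 (root_snd b)) (widen_ord (leqnSn n) (root_fst b)).
  set y := \sum_b c b *: lower_gen C b.
  have [sly acty] := act_sum c u0 sl_lower.
  have slz : sl (x - y) by rewrite -scaleN1r addrC; apply: sl_sub.
  have -> : x = 1 *: y + (x - y) by rewrite scale1r addrC subrK.
  rewrite /wact /= (proj1 act_rep) // scale1r acty act_hw //; last exact: lower_part_upper.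
  apply: submoduleD; first exact: fil_word_sub.
    apply: submodule_sum => [|b _ _]; first exact: fil_word_sub.
    by apply: submoduleZ (fil_word_sub _) _; apply: (@fil_word_wact [:: b]).
  by apply: submoduleZ (fil_word_sub _) _; apply: (@fil_word_wact [::]).
have E : act x (wact (b :: u)) = act (lower_gen C b) (act x (wact u)) +
    act (lie_bracket x (lower_gen C b)) (wact u).
  by rewrite (proj2 act_rep) //; [rewrite addrC subrK|exact: sl_lower].
have [h1 h2] := IH x slx; have [h3 _] := IH _ (sl_bracket x (lower_gen C b)).
rewrite E; split=> [|ux]; (apply: submoduleD; first exact: fil_word_sub).
- exact: fil_word_lower.
- exact: fil_word_mono h3.
- exact/fil_word_lower/h2.
- exact: h3.
Qed.

Lemma fil_word_sl x k z : sl x -> fil_word k z -> fil_word k.+1 (act x z).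
Proof.
move=> slx; apply: (lin_span_min (submodule_preim (act x) (fil_word_sub k.+1))).
by move=> _ [u uk ->]; apply: fil_word_mono (proj1 (act_fil_word_wact u slx)).
Qed.

Lemma fil_word_upper x k z : sl x -> is_upper x -> fil_word k z -> fil_word k (act x z).
Proof.
move=> slx ux; apply: (lin_span_min (submodule_preim (act x) (fil_word_sub k))).
by move=> _ [u uk ->]; apply: fil_word_mono (proj2 (act_fil_word_wact u slx) ux).
Qed.

Definition word_span : set U := fun z => exists k, fil_word k z.

Lemma word_span_sub : submodule word_span.
Proof.
split; first by exists 0; case: (fil_word_sub 0).
move=> a x y [k kx] [l ly]; exists (maxn k l); apply: (proj2 (fil_word_sub _)).
  by apply: fil_word_mono kx; rewrite leq_maxl.
by apply: fil_word_mono ly; rewrite leq_maxr.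
Qed.

Lemma word_span_sl x z : sl x -> word_span z -> word_span (act x z).
Proof. by move=> slx [k kz]; exists k.+1; apply: fil_word_sl. Qed.

Definition strict_span : set U := lin_span [set z | exists2 u, (0 < size u)%N & z = wact u].

Lemma word_span_split z : word_span z -> exists c z', z = c *: u0 + z' /\ strict_span z'.
Proof.
pose B z := exists c z', z = c *: u0 + z' /\ strict_span z'.
move=> [k]; apply: (@lin_span_min _ _ _ B).
  split; first by exists 0, 0; rewrite scale0r addr0; split=> //; apply: (proj1 (lin_span_submodule _)).
  move=> a _ _ [c [x [-> hx]]] [d [y [-> hy]]]; exists (a * c + d), (a *: x + y).
  split; last exact: (proj2 (lin_span_submodule _)).
  by rewrite scalerDr scalerA scalerDl addrACA.
move=> _ [[|b u] _ ->].
  by exists 1, 0; rewrite scale1r addr0; split=> //; apply: (proj1 (lin_span_submodule _)).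
by exists 0, (wact (b :: u)); rewrite scale0r add0r; split=> //; apply: lin_span_incl; exists (b :: u).
Qed.

(* The dual Weyl vector, which acts on the weight spaces of the
   module by [wt grading - height]. *)
Definition grading : M :=
  \matrix_(a, c) ((a == c)%:R * ((\sum_(e < n.+1) (e : nat)%:R) / n.+1%:R - (a : nat)%:R)).

Lemma sl_grading : sl grading.
Proof.
rewrite /sl /= /mxtrace; under eq_bigr => a _ do rewrite mxE eqxx mul1r.
by rewrite sumrB sumr_const card_ord -[(_ / _) *+ _]mulr_natr divfK ?subrr // pnatr_eq0.
Qed.

Lemma upper_grading : is_upper grading.
Proof. by move=> a b ba; rewrite mxE [a == b]gtn_eqF ?mul0r. Qed.

Definition height u := (\sum_(b <- u) (root_snd b - root_fst b).+1)%N.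

Lemma grading_lower b :
  lie_bracket grading (lower_gen C b) = - ((root_snd b - root_fst b).+1)%:R *: lower_gen C b.
Proof.
have mul (d : 'I_n.+1 -> C) : (forall y : M, (\matrix_(a, c) ((a == c)%:R * d a)) *m y = \matrix_(a, c) (d a * y a c)) /\
   (forall y : M, y *m (\matrix_(a, c) ((a == c)%:R * d a)) = \matrix_(a, c) (y a c * d c)).
  split=> y; apply/matrixP => a c; rewrite !mxE.
    rewrite (bigD1 a) //= big1 => [|e ea]; first by rewrite mxE eqxx mul1r addr0.
    by rewrite mxE eq_sym (negbTE ea) !mul0r.
  rewrite (bigD1 c) //= big1 => [|e ea]; first by rewrite mxE eqxx mul1r addr0.
  by rewrite mxE (negbTE ea) mul0r mulr0.
rewrite /lie_bracket /grading; set t := _ / _; have [m1 m2] := mul (fun a => t - (a : nat)%:R); rewrite m1 m2; apply/matrixP => a c; rewrite !mxE.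
case: eqP => [->|_]; last by rewrite /= !mulr0 mul0r subrr.
case: eqP => [->|_]; last by rewrite /= !mulr0 mul0r subrr.
rewrite !mulr1 mul1r /= /bump /= add1n -subSn ?root_fst_snd // natrB; last first.
  by have := root_fst_snd b; lia.
by rewrite !opprB addrC addrA subrK.
Qed.

Lemma grading_wact u : act grading (wact u) = (wt grading - (height u)%:R) *: wact u.
Proof.
elim: u => [|b u IH].
  by rewrite /height big_nil subr0 act_hw //; [exact: sl_grading|exact: upper_grading].
have -> : act grading (wact (b :: u)) = act (lie_bracket grading (lower_gen C b)) (wact u) + act (lower_gen C b) (act grading (wact u)).
  by rewrite (proj2 act_rep) ?subrK //; [exact: sl_grading|exact: sl_lower].
rewrite grading_lower IH linearZ /= -[X in act X]addr0 (proj1 act_rep) //; [|exact: sl_lower|exact: sl0].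
rewrite act0 addr0 -scalerDl /height big_cons natrD; congr (_ *: _).
by rewrite opprD addrCA.
Qed.

Hypothesis u0_neq0 : u0 <> 0.

(** The product of the operators [grading - (wt grading - i)] for i from 1 to [k]. It annihilates
    words of height 1 to [k] and multiplies the generator by k!. *)
Fixpoint kill k (z : U) : U :=
  if k is k'.+1 then kill k' (act grading z - (wt grading - k%:R) *: z) else z.

Lemma kill_linear k : linear (kill k).
Proof.
elim: k => [|k IH] a x y //=; rewrite -IH; congr (kill k _).
rewrite linearP scalerDr scalerBr opprD addrACA; congr (_ + _ + _).
by rewrite !scalerA mulrC.
Qed.

Lemma kill_wact k u : kill k (wact u) = (\prod_(i < k) (i.+1%:R - (height u)%:R)) *: wact u.
Proof.
elim: k => [|k IH]; first by rewrite big_ord0 scale1r.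
rewrite /= grading_wact -scalerBl big_ord_recr /=.
set c := k.+1%:R - (height u)%:R.
have -> : wt grading - (height u)%:R - (wt grading - k.+1%:R) = c.
  by rewrite opprB addrC addrA subrK.
have := kill_linear k c (wact u) 0; rewrite !addr0 => ->.
have k0 : kill k 0 = 0 by have := kill_linear k (-1) 0 0; rewrite scaler0 addr0 scaleN1r addNr.
by rewrite k0 addr0 IH scalerA mulrC.
Qed.

(** Nonempty words have positive height, and only finitely many heights occur in [z]. Thus some
    [kill k] erases [z] while scaling [u0] by a factorial, which is nonzero in characteristic
    zero. *)
Lemma strict_span_indep c z : strict_span z -> c *: u0 + z = 0 -> c = 0.
Proof.
move=> sz; have [k hk] : exists k, forall l, (k <= l)%N -> kill l z = 0.
  pose B z := exists k, forall l, (k <= l)%N -> kill l z = 0.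
  apply: (@lin_span_min _ _ _ B) sz.
    split; first by exists 0 => l _; have := kill_linear l (-1) 0 0; rewrite scaler0 addr0 scaleN1r addNr.
    move=> a x y [k hx] [l hy]; exists (maxn k l) => i; rewrite geq_max => /andP[h1 h2].
    by rewrite kill_linear hx // hy // scaler0 addr0.
  move=> _ [u u_gt0 ->]; exists (height u) => l hl; rewrite kill_wact.
  have h0 : (0 < height u)%N by case: u u_gt0 {hl} => //= b u _; rewrite /height big_cons.
  have hl' : ((height u).-1 < l)%N by rewrite prednK.
  by rewrite (bigD1 (Ordinal hl')) //= prednK // subrr mul0r scale0r.
move=> /(congr1 (kill k)); rewrite kill_linear hk // addr0.
have := kill_wact k [::]; rewrite /wact /= => ->.
have k0 : kill k 0 = 0 by have := kill_linear k (-1) 0 0; rewrite scaler0 addr0 scaleN1r addNr.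
rewrite k0 scalerA => /eqP; rewrite scaler_eq0 => /orP[|/eqP //].
rewrite mulf_eq0 => /orP[/eqP //|]; rewrite prodf_seq_eq0 => /hasP[i _ /=].
by rewrite /height big_nil subr0 pnatr_eq0.
Qed.

End Module.
End HighestWeightModule.

Section ProductAction.
Variables (C : numClosedFieldType) (n : nat) (U W : lmodType C).
Variables (act : 'M[C]_n.+1 -> {linear U -> U}) (act' : 'M[C]_n.+1 -> {linear W -> W}).

Definition act_pair (x : 'M[C]_n.+1) (z : U * W) : U * W := (act x z.1, act' x z.2).

Lemma act_pair_linear x : linear (act_pair x).
Proof. by move=> a y z; rewrite /act_pair /= !linearP. Qed.
HB.instance Definition _ x :=
  GRing.isLinear.Build C (U * W)%type (U * W)%type _ (act_pair x) (act_pair_linear x).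

Lemma act_pair_rep : sl_representation act -> sl_representation act' ->
  sl_representation (fun x => act_pair x : {linear _ -> _}).
Proof.
move=> [h1 h2] [h3 h4]; split=> [a x y [z z'] sx sy|x y [z z'] sx sy] /=.
  by rewrite /act_pair /= h1 // h3.
by rewrite /act_pair /= h2 // h4.
Qed.

End ProductAction.

(** * The submodule generated by [(v, w)] as a bridge to the tensor model *)

Section Comparison.
Variables (C : numClosedFieldType) (n : nat).
Local Notation M := 'M[C]_n.+1.
Variables (V : lmodType C) (rho : M -> {linear V -> V}) (v : V) (m : 'I_n -> nat).
Hypothesis rho_rep : sl_representation rho.
Hypothesis rho_irr : irreducible rho.
Hypothesis v_neq0 : v <> 0.
Hypothesis rho_hw : forall x, sl x -> is_upper x -> rho x v = highest_weight m x *: v.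
Variables (D : finType) (w : tensor C n D).
Hypothesis gw : good_model m w.

Local Notation tau := (fun x : M => tact x : {linear tensor C n D -> tensor C n D}).
Local Notation act2 := (fun x : M => act_pair rho tau x : {linear _ -> _}).

Lemma tau_rep : sl_representation tau.
Proof. by split=> [a x y u _ _|x y u _ _] /=; rewrite ?tact_linearl ?tact_bracket. Qed.

Lemma tau_hw x : sl x -> is_upper x -> tau x w = highest_weight m x *: w.
Proof. by move=> _ ux; apply: (gm_hw gw). Qed.

Lemma w_neq0 : w <> 0.
Proof.
have S0 : S_lambda m [ffun=> 0%N] by move=> b p _; rewrite big1 // => c _; rewrite ffunE.
have [g /(_ [::])[h _]] := gm_lead gw S0.
have hc : has_content [::] ([ffun=> 0%N] : {ffun posroot n -> nat}).
  by apply/has_contentP => b; rewrite ffunE.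
by move=> w0; have := h hc; rewrite /= w0 ffunE ltxx.
Qed.

Lemma act2_hw x : sl x -> is_upper x -> act2 x (v, w) = highest_weight m x *: (v, w).
Proof. by move=> sx ux; rewrite /= /act_pair /= rho_hw // tau_hw. Qed.

Let act2_rep : sl_representation act2 := act_pair_rep rho_rep tau_rep.

Local Notation N := (word_span act2 (v, w)).

Lemma wact_pair u : wact act2 (v, w) u = (wact rho v u, wact tau w u).
Proof. by elim: u => //= b u; rewrite /wact /= => ->. Qed.

(** The coefficient [c] is common to both components; this excludes a vector such as [(v, 0)] from
    [N]. *)
Lemma word_span_pair z : N z -> exists c, exists z1 z2,
  [/\ z = c *: (v, w) + (z1, z2), strict_span rho v z1 & strict_span tau w z2].
Proof.
move=> /word_span_split[c [z' [-> sz]]]; exists c, z'.1, z'.2; split.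
- by case: z' sz.
- apply: (@lin_span_min _ _ _ (fun z => strict_span rho v z.1)) sz.
    have [h0 hl] : submodule (strict_span rho v) := lin_span_submodule _.
    by split=> [|a x y]; [exact: h0|exact: hl].
  by move=> _ [u hu ->]; rewrite wact_pair /=; apply: lin_span_incl; exists u.
- apply: (@lin_span_min _ _ _ (fun z => strict_span tau w z.2)) sz.
    have [h0 hl] : submodule (strict_span tau w) := lin_span_submodule _.
    by split=> [|a x y]; [exact: h0|exact: hl].
  by move=> _ [u hu ->]; rewrite wact_pair /=; apply: lin_span_incl; exists u.
Qed.

(** Such [a] form a submodule of the irreducible [V]. If it were everything, [(v, 0)] would lie in
    [N], whose second component gives [c = 0] and whose first gives [c = 1]. *)
Lemma word_span_fst0 a : N (a, 0) -> a = 0.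
Proof.
move=> Na; have sN := word_span_sub act2 (v, w).
pose K : set V := fun a => N (a, 0).
have [|||] := proj2 rho_irr K.
- split; first exact: (proj1 sN).
  move=> c x y hx hy; have := (proj2 sN) c _ _ hx hy.
  by rewrite -[X in N X -> _]/(c *: x + y, c *: 0 + 0) scaler0 addr0.
- move=> x u sx hu; have := word_span_sl act2_rep act2_hw sx hu.
  by rewrite /= /act_pair /= linear0.
- by move=> h; have : K a by []; rewrite h.
move=> h; have /word_span_pair[c [z1 [z2 [e h1 h2]]]] : N (v, 0).
  by rewrite -[N _]/(K v) h.
case: e => e1 e2.
have c0 : c = 0 by apply: (strict_span_indep tau_rep tau_hw w_neq0 h2); rewrite -e2.
have c1 : c - 1 = 0.
  apply: (strict_span_indep rho_rep rho_hw v_neq0 h1).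
  by rewrite scalerBl scale1r addrAC -e1 subrr.
by move/eqP: c1; rewrite c0 sub0r oppr_eq0 oner_eq0.
Qed.

Lemma lower_adjoint (b : posroot n) : map_mx Num.conj (map_mx Num.conj (lower_gen C b)^T)^T = lower_gen C b.
Proof. by apply/matrixP => i j; rewrite !mxE /= conjCK. Qed.

Lemma sl_adjoint (x : M) : sl x -> sl (map_mx Num.conj x^T).
Proof.
rewrite /sl /= => tx; have -> : \tr (map_mx Num.conj x^T) = Num.conj (\tr x).
  by rewrite /mxtrace rmorph_sum; apply: eq_bigr => i _; rewrite !mxE.
by rewrite tx rmorph0.
Qed.

(* The submodule of the [b] with [(0, b)] in [N] has no component along [w],
   hence is orthogonal to the module generated by [w], in which it lies. *)
Lemma word_span_snd0 b : N (0, b) -> b = 0.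
Proof.
move=> Nb; have strict0 z : N (0, z) -> strict_span tau w z.
  move=> /word_span_pair[c [z1 [z2 [e h1 h2]]]]; case: e => e1 e2.
  have c0 : c = 0 by apply: (strict_span_indep rho_rep rho_hw v_neq0 h1); rewrite -e1.
  by rewrite e2 c0 scale0r add0r.
have herm_sub G : submodule [set z : tensor C n D | herm z G = 0].
  split=> [|a x y /= hx hy].
    by apply: big1 => g _; rewrite ffunE mul0r.
  by have /= -> := herm_linear G a x y; rewrite hx hy scaler0 addr0.
have orth z : N (0, z) -> herm z w = 0.
  move/strict0; apply: (lin_span_min (herm_sub w)).
  move=> _ [[|d u] // _ ->]; rewrite /= /wact /= herm_adjoint.
  set x := map_mx _ _; have dx (a c : 'I_n.+1) : (c <= a)%N -> x a c = 0.
    move=> ca; rewrite !mxE; case: eqP => [e1|_]; last by rewrite rmorph0.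
    case: eqP => [e2|_]; last by rewrite rmorph0.
    by move: ca (root_fst_snd d); rewrite e1 e2 /= /bump /= add1n; lia.
  rewrite (gm_hw gw) => [|a c ca]; last by apply/dx/ltnW.
  rewrite /highest_weight big1 => [|i _]; last by rewrite big1 ?mulr0 // => a _; apply: dx.
  by rewrite scale0r /herm big1 // => g _; rewrite ffunE rmorph0 mulr0.
(* Letters of the word pass to the other side of the form as their adjoints, and these keep [(0, z)]
   inside [N]. *)
have orthw u z : N (0, z) -> herm z (wact tau w u) = 0.
  elim: u z => [|d u IH] z Nz; first exact: orth.
  rewrite /wact /= -[lower_gen C d]lower_adjoint -herm_adjoint; apply: IH.
  have := word_span_sl act2_rep act2_hw (sl_adjoint (sl_lower C d)) Nz.
  by rewrite /= /act_pair /= linear0.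
apply: herm_eq0; apply: (lin_span_min (herm_sub b)) (strict0 _ Nb).
move=> _ [u _ ->]; have e := orthw u b Nb; change (herm (wact tau w u) b = 0).
by rewrite (herm_conj (wact tau w u)) e rmorph0.
Qed.

(** A relation between words on [v] puts the pair of 0 and the same combination on [w] into [N]. *)
Lemma wact_transfer (r : seq (C * seq (posroot n))) :
  \sum_(t <- r) t.1 *: wact rho v t.2 = 0 -> \sum_(t <- r) t.1 *: wact tau w t.2 = 0.
Proof.
move=> h; apply: word_span_snd0; rewrite -h.
have -> : (\sum_(t <- r) t.1 *: wact rho v t.2, \sum_(t <- r) t.1 *: wact tau w t.2) =
  \sum_(t <- r) t.1 *: wact act2 (v, w) t.2.
  elim: r {h} => [|t r IH]; first by rewrite !big_nil.
  by rewrite !big_cons -IH wact_pair.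
apply: submodule_sum => [|t _ _]; first exact: word_span_sub.
apply: submoduleZ; first exact: word_span_sub.
by exists (size t.2); apply: fil_word_wact.
Qed.

Lemma iter_transfer x k : sl x -> iter k (tact x) w = 0 -> iter k (rho x) v = 0.
Proof.
move=> sx h; apply: word_span_fst0; rewrite -h.
elim: {h} k => [|k IH]; first by exists 0%N; apply: (@fil_word_wact _ _ _ act2 (v, w) [::]).
exact: (word_span_sl act2_rep act2_hw sx IH).
Qed.

End Comparison.

(** * Straightening *)

Section CoefficientComparison.
Variables (C : numClosedFieldType) (V : lmodType C) (A : set V).
Hypothesis subA : submodule A.

(** Comparing the value at [2 * x] with [2 ^+ N] times the value at [x] cancels the top term and
    scales each other [c k] by a nonzero number. Only nonzero [x] are tested, because the
    application divides by a variable. *)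
Lemma poly_extract N (c : nat -> V) :
  (forall x : C, x != 0 -> A (\sum_(k < N) x ^+ k *: c k)) -> forall k, (k < N)%N -> A (c k).
Proof.
elim: N c => [//|N IH] c h.
have hlt k : (k < N)%N -> A (c k).
  move=> kN; have nz : (2 ^+ k - 2 ^+ N : C) != 0.
    by rewrite subr_eq0 -!natrX eqr_nat eqn_exp2l // ltn_eqF.
  suff : A ((2 ^+ k - 2 ^+ N) *: c k).
    by move/(submoduleZ (2 ^+ k - 2 ^+ N)^-1 subA); rewrite scalerA mulVf // scale1r.
  apply: (IH (fun k => (2 ^+ k - 2 ^+ N) *: c k)) => // x x0.
  have x20 : 2 * x != 0 by rewrite mulf_neq0 // pnatr_eq0.
  have := submoduleB subA (h _ x20) (submoduleZ (2 ^+ N) subA (h _ x0)).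
  rewrite scaler_sumr -sumrB big_ord_recr /= exprMn scalerA subrr addr0.
  congr (A _); apply: eq_bigr => i _.
  by rewrite exprMn !scalerA -scalerBl mulrBr [x ^+ i * 2 ^+ i]mulrC [x ^+ i * 2 ^+ N]mulrC.
move=> k; rewrite ltnS leq_eqVlt => /predU1P[->|]; last exact: hlt.
have := h 1 (oner_neq0 _); rewrite big_ord_recr /= expr1n scale1r => hN.
have hs : A (\sum_(i < N) 1 ^+ i *: c i).
  by apply: submodule_sum => // i _ _; apply: submoduleZ => //; apply: hlt.
by have := submoduleB subA hN hs; rewrite addrAC subrr add0r.
Qed.

Lemma monomial_extract1 (T : Type) (r : seq T) (E : T -> nat) (U : T -> V) :
  (forall x : C, x != 0 -> A (\sum_(t <- r) x ^+ E t *: U t)) ->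
  forall e, A (\sum_(t <- r | E t == e) U t).
Proof.
move=> h e; pose N := (\max_(t <- r) E t + e).+1.
have eN : (e < N)%N by rewrite ltnS leq_addl.
apply: (@poly_extract N (fun e => \sum_(t <- r | E t == e) U t)) eN => x x0.
have := h x x0; congr (A _).
transitivity (\sum_(k < N) \sum_(t <- r | E t == k) x ^+ k *: U t); last first.
  by apply: eq_bigr => k _; rewrite scaler_sumr.
have hN : all (fun t => E t < N)%N r.
  rewrite /N; clear h N; elim: r => //= t r IH; rewrite big_cons; apply/andP; split.
    by rewrite ltnS; apply: leq_trans (leq_addr _ _); apply: leq_maxl.
  apply: sub_all IH => s hs; apply: leq_trans hs _.
  by rewrite ltnS leq_add2r leq_maxr.
move: N hN => N hN; elim: r {h} hN => [_|t r IH /= /andP[tN rN]].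
  by rewrite big_nil big1 // => k _; rewrite big_nil.
rewrite big_cons IH //.
have -> : x ^+ E t *: U t = \sum_(k < N) (if E t == k then x ^+ k *: U t else 0).
  rewrite (bigD1 (Ordinal tN)) //= eqxx big1 ?addr0 // => k ne.
  by case: eqP => // e1; case/eqP: ne; apply: val_inj.
rewrite -big_split; apply: eq_bigr => k _; rewrite big_cons /=.
by case: ifP; rewrite ?add0r.
Qed.

Lemma monomial_extract (J : finType) (T : Type) (r : seq T) (E : T -> J -> nat) (U : T -> V) :
  (forall x : J -> C, (forall j, x j != 0) -> A (\sum_(t <- r) (\prod_j x j ^+ E t j) *: U t)) ->
  forall e : J -> nat, A (\sum_(t <- r | [forall j, E t j == e j]) U t).
Proof.
move=> h e.
(* The exponents of the variables in [js] are already prescribed; variables are extracted one at a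
   time. *)
have key (js : seq J) : uniq js -> forall x : J -> C, (forall j, x j != 0) ->
  A (\sum_(t <- r | all (fun j => E t j == e j) js) (\prod_(j | j \notin js) x j ^+ E t j) *: U t).
  elim: js => [_ x x0|j js IH /= /andP[jjs ujs] x x0]; first exact: h.
  rewrite (eq_bigl (fun t => all (fun j => E t j == e j) js && (E t j == e j))); last first.
    by move=> t; rewrite andbC.
  rewrite -big_filter_cond; apply: monomial_extract1 => y y0.
  pose x' i := if i == j then y else x i.
  have x'0 i : x' i != 0 by rewrite /x'; case: (i =P j) => _; [exact: y0|exact: x0].
  have := IH ujs x' x'0; rewrite big_filter; congr (A _); apply: eq_bigr => t _.
  rewrite scalerA (bigD1 j) //= /x' eqxx; congr ((_ * _) *: _).
  apply: eq_big => [i|i /andP[_ /negbTE ->] //].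
  by rewrite inE; case: (i == j); case: (i \in js).
have := key _ (enum_uniq J) (fun=> 1) (fun=> oner_neq0 _); congr (A _).
apply: eq_big => [t|t _].
  by apply/allP/forallP => [ha j|ha j _]; [apply: ha; rewrite mem_enum|].
by rewrite big1 ?scale1r // => j; rewrite mem_enum.
Qed.

End CoefficientComparison.

Lemma word_chain_max n (u v : seq (posroot n)) :
  {in v &, forall b c, root_le b c || root_le c b} ->
  (forall x : 'I_n, count (fun b => root_fst b == x) u = count (fun b => root_fst b == x) v) ->
  (forall x : 'I_n, count (fun b => root_snd b == x) u = count (fun b => root_snd b == x) v) ->
  (word_weight v <= word_weight u)%N -> perm_eq u v.
Proof.
move=> ch hf hs le.
have pf (f : posroot n -> 'I_n) : (forall x, count (fun b => f b == x) u = count (fun b => f b == x) v) ->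
   forall x, count (fun b => x <= f b)%N u = count (fun b => x <= f b)%N v.
  move=> h x; have /seq.permP/(_ (fun i : 'I_n => x <= i)%N) : perm_eq (map f u) (map f v).
    by apply/allP => i _; apply/eqP; rewrite /= !count_map; apply: h.
  by rewrite !count_map.
pose f (b : posroot n) : nat * nat := (nat_of_ord (root_fst b), nat_of_ord (root_snd b)).
have finj : injective f by move=> b c [/val_inj h1 /val_inj h2]; apply: root_inj.
apply: (perm_map_inj finj); apply: chain_max.
- by move=> _ _ /mapP[b bv ->] /mapP[c cv ->]; apply: ch.
- by move=> x; rewrite !count_map; apply: pf.
- by move=> x; rewrite !count_map; apply: pf.
- by rewrite !big_map.
Qed.

Section Words.
Variable n : nat.

Fixpoint words k : seq (seq (posroot n)) :=
  if k is k'.+1 then [seq b :: u | b <- enum {: posroot n}, u <- words k'] else [:: [::]].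

Lemma mem_words k u : (u \in words k) = (size u == k).
Proof.
elim: k u => [|k IH] [|b u] //=; first by apply/allpairsP => -[[c v] [_ _]].
rewrite eqSS -IH; apply/allpairsP/idP => [[[c v] /= [_ h [_ ->]]] //|h].
by exists (b, u); rewrite mem_enum.
Qed.

End Words.

Section Straightening.
Variables (C : numClosedFieldType) (n : nat).
Local Notation M := 'M[C]_n.+1.
Variables (V : lmodType C) (rho : M -> {linear V -> V}) (v : V) (m : 'I_n -> nat).
Hypothesis rho_rep : sl_representation rho.
Hypothesis rho_irr : irreducible rho.
Hypothesis v_neq0 : v <> 0.
Hypothesis rho_hw : forall x, sl x -> is_upper x -> rho x v = highest_weight m x *: v.
Implicit Types (u : seq (posroot n)) (b : posroot n).

Local Notation wa := (wact rho v).
Local Notation F := (fil_word rho v).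
Local Notation row b := (lift ord0 (root_snd b)).
Local Notation col b := (widen_ord (leqnSn n) (root_fst b)).

Definition fil_below k : set V := if k is k'.+1 then F k' else [set 0].

Lemma fil_below_sub k : submodule (fil_below k).
Proof.
case: k => [|k]; last exact: fil_word_sub.
by split=> // a x y -> ->; rewrite scaler0 addr0.
Qed.

Lemma fil_below_lower b k z : fil_below k z -> fil_below k.+1 (rho (lower_gen C b) z).
Proof.
case: k => [->|k]; last exact: fil_word_lower.
by rewrite linear0; apply: (proj1 (fil_word_sub _ _ _)).
Qed.

Lemma wact_swap b p q : F (size (p ++ q)) (wa (b :: p ++ q) - wa (p ++ b :: q)).
Proof.
elim: p => [|c p IH]; first by rewrite subrr; apply: (proj1 (fil_word_sub _ _ _)).
rewrite -[wa (b :: _)]/(rho (lower_gen C b) (rho (lower_gen C c) (wa (p ++ q)))).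
rewrite -[wa ((c :: p) ++ _)]/(rho (lower_gen C c) (wa (p ++ b :: q))).
have -> : rho (lower_gen C b) (rho (lower_gen C c) (wa (p ++ q))) =
   rho (lie_bracket (lower_gen C b) (lower_gen C c)) (wa (p ++ q)) +
   rho (lower_gen C c) (wa (b :: p ++ q)).
  by rewrite (proj2 rho_rep) ?subrK //; exact: sl_lower.
rewrite -addrA -linearB; apply: submoduleD; first exact: fil_word_sub.
  apply: (fil_word_sl rho_rep rho_hw); [exact: sl_bracket|exact: fil_word_wact].
exact: fil_word_lower.
Qed.

Lemma wact_perm u u' : perm_eq u u' -> fil_below (size u) (wa u - wa u').
Proof.
elim: u u' => [|b u IH] u' pu.
  by move: pu; rewrite perm_sym => /perm_nilP ->; rewrite subrr.
have bu : b \in u' by rewrite -(perm_mem pu) mem_head.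
case/splitPr: bu pu => p q pu.
have {}pu : perm_eq u (p ++ q).
  by move: pu; rewrite perm_sym -cat1s perm_catCA cat1s perm_cons perm_sym.
have -> : wa (b :: u) - wa (p ++ b :: q) =
    rho (lower_gen C b) (wa u - wa (p ++ q)) + (wa (b :: p ++ q) - wa (p ++ b :: q)).
  by rewrite linearB /= addrA subrK.
apply: submoduleD; first exact: fil_below_sub.
  exact/fil_below_lower/IH.
by rewrite /= (perm_size pu); apply: wact_swap.
Qed.

(** Replacing [y] by [x] one factor at a time leaves corrections with an upper triangular factor,
    which does not raise the filtration degree. *)
Lemma iter_upper (y x : M) k : sl y -> sl x -> is_upper (y - x) ->
  F k (iter k.+1 (rho y) v - iter k.+1 (rho x) v).
Proof.
move=> sy sx ux; have sz : sl (y - x) by rewrite -scaleN1r addrC; apply: sl_sub.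
have yE z : rho y z = rho x z + rho (y - x) z.
  have {1}-> : y = 1 *: x + (y - x) by rewrite scale1r addrC subrK.
  by rewrite (proj1 rho_rep) // scale1r.
have Fx l : F l (iter l (rho x) v).
  elim: l => [|l IH]; first exact: (@fil_word_wact _ _ _ rho v [::]).
  exact: (fil_word_sl rho_rep rho_hw).
elim: k => [|k IH].
  rewrite /= yE addrC addKr; apply: (fil_word_upper rho_rep rho_hw) => //; exact: (Fx 0%N).
rewrite 2!iterS; set y1 := iter k.+1 (rho y) v in IH *; have Fx1 := Fx k.+1; set x1 := iter k.+1 (rho x) v in IH Fx1 *.
have -> : rho y y1 - rho x x1 = rho y (y1 - x1) + rho (y - x) x1.
  by rewrite linearB /= yE [rho y x1]yE opprD addrA addrNK.
apply: submoduleD; first exact: fil_word_sub.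
  exact: (fil_word_sl rho_rep rho_hw).
exact: (fil_word_upper rho_rep rho_hw).
Qed.

Lemma iter_words (c : posroot n -> C) k :
  iter k (rho (\sum_b c b *: lower_gen C b)) v =
  \sum_(u <- words n k) (\prod_(b <- u) c b) *: wa u.
Proof.
elim: k => [|k IH]; first by rewrite big_seq1 big_nil scale1r.
rewrite iterS (proj2 (act_sum rho_rep c _ (@sl_lower C n))) /= big_allpairs_dep big_enum /=.
apply: eq_bigr => b _; rewrite IH linear_sum scaler_sumr; apply: eq_bigr => u _.
by rewrite big_cons linearZ scalerA.
Qed.

Lemma prod_count (J : finType) (T : eqType) (f : T -> J) (x : J -> C) (u : seq T) :
  \prod_(t <- u) x (f t) = \prod_j x j ^+ count (fun t => f t == j) u.
Proof.
elim: u => [|t u IH]; first by rewrite big_nil big1 // => j _; rewrite expr0.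
rewrite big_cons IH [RHS](bigD1 (f t)) //= [X in _ * X = _](bigD1 (f t)) //= eqxx exprS mulrA.
by congr (_ * _); apply: eq_bigr => j; rewrite eq_sym => /negbTE ->.
Qed.

(* [y] below is a nilpotent matrix of rank one, so a large power of it kills
   [v]; its strictly lower part has coefficients [x_row * x_col], and the power
   of that part expands into sums over words with prescribed margins. *)
Lemma straighten (i j : 'I_n) u0 (B : set V) :
  {in u0 &, forall b c, root_le b c || root_le c b} ->
  (forall b, b \in u0 -> i <= root_fst b /\ root_snd b <= j)%N ->
  (\sum_(l < n | i <= l <= j) m l < size u0)%N ->
  submodule B -> (forall z, F (size u0).-1 z -> B z) ->
  (forall u, size u = size u0 -> word_weight u < word_weight u0 -> B (wa u))%N ->
  B (wa u0).
Proof.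
move=> ch box0 lt subB FB wB.
have [k sz] : exists k, size u0 = k.+1 by case: u0 lt {ch box0 FB wB} => // b u _; exists (size u).
have ij : (i <= j)%N.
  case: u0 sz box0 {ch lt FB wB} => // b u _ /(_ b (mem_head _ _))[h1 h2].
  exact: leq_trans h1 (leq_trans (root_fst_snd b) h2).
pose box b := (i <= root_fst b)%N && (root_snd b <= j)%N.
pose ci : 'I_n.+1 := widen_ord (leqnSn n) i.
pose E u (a : 'I_n.+1 + 'I_n.+1) := match a with
  | inl a => count (fun b => col b == a) u | inr a => count (fun b => row b == a) u end.
have main : F k (\sum_(u <- [seq u <- words n k.+1 | all box u] |
    [forall a, E u a == E u0 a]) wa u).
  apply: monomial_extract; first exact: fil_word_sub.
  move=> x x0.
  (* The free variables are the columns [i..j] and the rows [i+1..j+1]. The remaining entry [t ci]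
     is solved from the trace condition; it belongs to row [i], which has no strictly lower entry in
     columns [i..j], so it never reaches the coefficients [c b]. *)
  pose s (a : 'I_n.+1) := if (i <= a <= j)%N then x (inl a) else 0.
  pose t' (a : 'I_n.+1) := if (i < a <= j.+1)%N then x (inr a) else 0.
  pose t a := if a == ci then - (\sum_(e | e != ci) s e * t' e) / x (inl ci) else t' a.
  have st : \sum_a s a * t a = 0.
    rewrite (bigD1 ci) //= /t eqxx /s leqnn ij /= mulrC divfK // addrC; apply/eqP.
    rewrite subr_eq0; apply/eqP; apply: eq_bigr => e /negbTE -> //.
  have s0 (a : 'I_n.+1) : ~~ (i <= a <= j)%N -> s a = 0 by rewrite /s => /negbTE ->.
  have t0 (a : 'I_n.+1) : ~~ (i <= a <= j.+1)%N -> t a = 0.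
    move=> h; rewrite /t /t'; case: eqP => [e|_]; first by case/negP: h; rewrite e /= leqnn leqW.
    by rewrite ifN //; apply: contra h => /andP[/ltnW -> ->].
  have slr : sl (rank1 t s).
    by rewrite /sl /= -[RHS]st; apply: eq_bigr => a _; rewrite mxE mulrC.
  have it0 : iter k.+1 (rho (rank1 t s)) v = 0.
    have [D [w gw]] := good_model_ex C m.
    apply: (iter_transfer rho_rep rho_irr v_neq0 rho_hw gw slr).
    by apply: (gm_nil gw s0 t0 st); rewrite -sz.
  pose c b := rank1 t s (row b) (col b).
  have sx : sl (\sum_b c b *: lower_gen C b) := proj1 (act_sum rho_rep c v (@sl_lower C n)).
  have := iter_upper k slr sx (lower_part_upper (rank1 t s)).
  rewrite it0 sub0r => /(submoduleN (fil_word_sub _ _ _)); rewrite opprK iter_words.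
  congr (F k _).
  have cE b : c b = if box b then x (inl (col b)) * x (inr (row b)) else 0.
    rewrite /c mxE /box; have hb := root_fst_snd b.
    have [ib|bi] := leqP i (root_fst b); last by rewrite s0 ?mulr0 //= leqNgt bi.
    have nci : (row b == ci) = false.
      by apply/eqP => /(congr1 val); rewrite /= /bump /= add1n; lia.
    rewrite /t nci /t' /s /= /bump /= add1n ltnS ib (leq_trans ib hb) ltnS /=.
    have [bj|jb] := leqP (root_snd b) j; last by rewrite mul0r.
    by rewrite (leq_trans hb bj) mulrC.
  rewrite big_filter [RHS]big_mkcond; apply: eq_bigr => u _.
  case: ifP => [bu|/negbT]; last first.
    rewrite -has_predC => /hasP[b bu nb]; rewrite (big_rem b) //= cE.
    by rewrite (negbTE nb) mul0r scale0r.
  congr (_ *: _); rewrite big_sumType /= -!prod_count -big_split /=.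
  by apply: eq_big_seq => b /(allP bu) hb; rewrite cE hb.
have wi : injective (widen_ord (leqnSn n)) by move=> a c /(congr1 val) /= /val_inj.
pose P u := all box u && [forall a, E u a == E u0 a].
have PE u : P u -> ~~ perm_eq u u0 -> (word_weight u < word_weight u0)%N.
  move=> /andP[_ /forallP eE] np; rewrite ltnNge; apply: contra np => le.
  apply: word_chain_max => // x.
    have /eqP := eE (inl (widen_ord (leqnSn n) x)).
    rewrite /E; under eq_count do rewrite (inj_eq wi).
    by move=> ->; under eq_count do rewrite (inj_eq wi).
  have /eqP := eE (inr (lift ord0 x)).
  rewrite /E; under eq_count do rewrite (inj_eq lift_inj).
  by move=> ->; under eq_count do rewrite (inj_eq lift_inj).
have Pu0 : P u0.
  rewrite /P; apply/andP; split; last by apply/forallP => a.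
  by apply/allP => b /box0[h1 h2]; rewrite /box h1.
(* Words in the extracted sum that do not rearrange [u0] have smaller weight and lie in [B]. The
   others agree with [u0] up to lower degree, so a positive multiple of [wa u0] remains. *)
move: main; rewrite big_filter_cond (bigID (fun u => perm_eq u u0)) /= => main.
have {main} hB : B (\sum_(u <- words n k.+1 | P u && perm_eq u u0) wa u).
  rewrite -[X in B X](addrK (\sum_(u <- words n k.+1 | P u && ~~ perm_eq u u0) wa u)).
  apply: submoduleB => //; first by apply: FB; rewrite sz.
  apply: submodule_sum => // u; rewrite mem_words => /eqP su /andP[Pu np].
  by apply: wB; [rewrite su sz|apply: PE].
have {hB} : B (\sum_(u <- words n k.+1 | P u && perm_eq u u0) wa u0).
  rewrite -[X in B X](subrK (\sum_(u <- words n k.+1 | P u && perm_eq u u0) wa u)).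
  apply: submoduleD => //; rewrite -sumrB; apply: submodule_sum => // u _ /andP[_ pu].
  apply: FB; have := @wact_perm u0 u; rewrite perm_sym sz => /(_ pu); exact.
rewrite big_const_seq iter_addr_0; set N := count _ _.
have N0 : N != 0%N.
  rewrite -lt0n -has_count; apply/hasP; exists u0; rewrite ?mem_words ?sz //.
  by rewrite Pu0 perm_refl.
rewrite -scaler_nat => /(submoduleZ N%:R^-1 subB).
by rewrite scalerA mulVf ?scale1r // pnatr_eq0.
Qed.

Definition S_span k : set V :=
  lin_span [set z | exists u, exists2 s, S_lambda m s & [/\ has_content u s, (size u <= k)%N & z = wa u]].

Lemma S_span_mono k l z : (k <= l)%N -> S_span k z -> S_span l z.
Proof.
move=> kl; apply: lin_span_sub => t [u [s Ss [h1 h2 h3]]]; exists u, s => //; split=> //.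
exact: leq_trans kl.
Qed.

(** Induction on the size and, within one size, on the weight. A violated inequality picks out the
    letters on one Dyck path, which are moved to the right end and straightened. *)
Lemma wact_S_span u : S_span (size u) (wa u).
Proof.
have subS k : submodule (S_span k) := lin_span_submodule _.
have [K uK] := ubnP (size u); elim: K u uK => // K IHK u; rewrite ltnS => uK.
have FS k z : (k < K)%N -> F k z -> S_span k z.
  move=> kK; apply: lin_span_min => // _ [u' u'k ->]; apply: (S_span_mono u'k).
  exact: IHK (leq_ltn_trans u'k kK).
have belowS k z : (k <= K)%N -> fil_below k z -> S_span k z.
  case: k => [_ ->|k kK Fz]; first exact: (proj1 (subS _)).
  by apply: (@S_span_mono k) => //; apply: FS.
have [W uW] := ubnP (word_weight u); elim: W u uK uW => // W IHW u uK; rewrite ltnS => uW.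
pose s : {ffun posroot n -> nat} := [ffun b => count_mem b u].
have us : has_content u s by apply/has_contentP => b; rewrite ffunE.
have [Ss|nS] := pselect (S_lambda m s).
  by apply: lin_span_incl; exists u, s.
have [b0 [p [dp lt]]] : exists b0 p, dyck_path b0 p /\
    (\sum_(i < n | root_fst b0 <= i <= root_fst (last b0 p)) m i < \sum_(b <- b0 :: p) s b)%N.
  apply: contrapT => h; apply: nS => b0 p dp; rewrite leqNgt; apply/negP => lt.
  by apply: h; exists b0, p.
have /and4P[/eqP sb0 /eqP sl pp _] := dp; have pl := dyck_path_le pp.
pose u0 := [seq b <- u | b \in b0 :: p]; pose u1 := [seq b <- u | b \notin b0 :: p].
have pu : perm_eq u (u1 ++ u0) by rewrite perm_sym perm_catC; apply/permPl/perm_filterC.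
have szu := perm_size pu.
have wt_cat x y : word_weight (x ++ y) = (word_weight x + word_weight y)%N.
  by rewrite /word_weight big_cat.
have wtu : word_weight u = (word_weight u1 + word_weight u0)%N.
  by rewrite -wt_cat; apply: perm_big.
have sz0 : size u0 = (\sum_(b <- b0 :: p) s b)%N.
  have -> : (\sum_(b <- b0 :: p) s b = \sum_(b <- b0 :: p) count_mem b u)%N.
    by apply: eq_bigr => b _; rewrite ffunE.
  rewrite size_filter -sum1_count big_mkcond /=.
  transitivity (\sum_(c <- u) \sum_(b <- b0 :: p) (c == b))%N; last first.
    rewrite exchange_big /=; apply: eq_bigr => b _; rewrite -sum1_count [RHS]big_mkcond /=.
    by apply: eq_bigr => c _; case: (c == b).
  apply: eq_bigr => c _; have up := dyck_path_uniq pp.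
  transitivity (count_mem c (b0 :: p)); first by rewrite count_uniq_mem.
  rewrite -sum1_count [LHS]big_mkcond /=.
  by apply: eq_bigr => b _; rewrite eq_sym; case: (c == b).
have -> : wa u = (wa u - wa (u1 ++ u0)) + wa (u1 ++ u0) by rewrite subrK.
apply: submoduleD => //; first exact/belowS/wact_perm.
have wcat x : wa (u1 ++ x) = word_act (fun x => rho x) u1 (wa x) by rewrite /wact /word_act foldr_cat.
(* The prefix [u1] is absorbed by taking for [B] the preimage of the span under its action. *)
rewrite wcat; apply: (@straighten (root_fst b0) (root_fst (last b0 p)) u0
  (fun z => S_span (size u) (word_act (fun x => rho x) u1 z))).
- move=> b c; rewrite !mem_filter => /andP[bp _] /andP[cp _].
  have h := @sorted_leq_index _ _ (@root_le_trans n) (@root_le_refl n) (b0 :: p) pl.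
  by case: (leqP (index b (b0 :: p)) (index c (b0 :: p))) => [/h|/ltnW/h] -> //;
    rewrite ?orbT.
- move=> b; rewrite mem_filter => /andP[bp _].
  have /andP[/andP[h1 _] /andP[_ h2]] := path_root_le pl bp.
  by rewrite h1 sl h2.
- by rewrite sz0.
- elim: u1 {pu szu wtu wcat} (S_span (size u)) (subS (size u)) => //= b u1 IH B subB.
  exact: (IH _ (submodule_preim (rho (lower_gen C b)) subB)).
- move=> z Fz; case E : (size u0) Fz => [|k] Fz; first by move: lt; rewrite -sz0 E.
  apply: (@S_span_mono (size u1 + k)); first by rewrite szu size_cat E leq_add2l.
  apply: FS; first by apply: leq_trans uK; rewrite szu size_cat E addnS.
  elim: u1 {pu szu wtu wcat} => //= b u1 IH; exact: fil_word_lower.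
- move=> x sx wx; rewrite -wcat; have -> : size u = size (u1 ++ x) by rewrite szu !size_cat sx.
  apply: IHW; first by rewrite size_cat sx -size_cat -szu.
  by apply: leq_trans uW; rewrite wt_cat wtu ltn_add2l.
Qed.

Lemma fil_below_seq k z : fil_below k z -> exists2 r : seq (C * seq (posroot n)),
  (forall t, t \in r -> (size t.2 < k)%N) & z = \sum_(t <- r) t.1 *: wa t.2.
Proof.
case: k => [->|k]; first by exists [::]; rewrite ?big_nil.
pose B z := exists2 r : seq (C * seq (posroot n)),
  (forall t, t \in r -> (size t.2 < k.+1)%N) & z = \sum_(t <- r) t.1 *: wa t.2.
apply: (@lin_span_min _ _ _ B).
  split; first by exists [::]; rewrite ?big_nil.
  move=> a _ _ [r1 h1 ->] [r2 h2 ->].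
  exists ([seq (a * t.1, t.2) | t <- r1] ++ r2).
    by move=> t; rewrite mem_cat => /orP[/mapP[t' /h1 ? ->]|/h2].
  rewrite big_cat big_map scaler_sumr; congr (_ + _).
  by apply: eq_bigr => t _; rewrite scalerA.
move=> _ [u uk ->]; exists [:: (1, u)]; last by rewrite big_seq1 scale1r.
by move=> t; rewrite inE => /eqP ->.
Qed.

Lemma seq_argmax (T : eqType) (f : T -> nat) (r : seq T) x : x \in r ->
  exists2 y, y \in r & forall z, z \in r -> (f z <= f y)%N.
Proof.
elim: r x => // a [|b r] IH x _.
  by exists a; rewrite ?mem_head // => z; rewrite inE => /eqP ->.
have [y yr ymax] := IH b (mem_head _ _); have [ya|ay] := leqP (f y) (f a).
  exists a; rewrite ?mem_head // => z; rewrite inE => /predU1P[->//|/ymax zy].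
  exact: leq_trans zy ya.
exists y => [|z]; first by rewrite inE yr orbT.
rewrite inE => /predU1P[->|/ymax //]; exact: ltnW.
Qed.

(** After transfer to [w], evaluate at the coordinate detecting an element of greatest weight among
    those with nonzero coefficient: the others are not larger, and words of lower degree are
    shorter, so only one term survives. *)
Lemma wact_indep k (r : seq {ffun posroot n -> nat}) (c : {ffun posroot n -> nat} -> C) :
  uniq r -> (forall s, s \in r -> S_lambda m s /\ content_size s = k) ->
  fil_below k (\sum_(s <- r) c s *: wa (content_word s)) ->
  forall s, s \in r -> c s = 0.
Proof.
move=> ur hr /fil_below_seq[r' hr' e].
have [D [w gw]] := good_model_ex C m.
have := wact_transfer rho_rep v_neq0 rho_hw gw
  (r := [seq (c s, content_word s) | s <- r] ++ [seq (- t.1, t.2) | t <- r']).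
rewrite !big_cat !big_map /= {}e.
under [X in _ + X = 0 -> _]eq_bigr do rewrite scaleNr.
rewrite sumrN subrr => /(_ erefl) e0 s sr; apply/eqP/negP => /negP cs0.
have [s1 /andP[sr1 cs1] smax] : exists2 s1, (s1 \in r) && (c s1 != 0) &
    forall s, s \in r -> c s != 0 -> (content_weight s <= content_weight s1)%N.
  have sc : s \in [seq s <- r | c s != 0] by rewrite mem_filter cs0.
  have [s1] := seq_argmax (@content_weight n) sc; rewrite mem_filter => /andP[c1 r1] h.
  by exists s1 => [|s2 sr2 c2]; rewrite ?r1 //; apply: h; rewrite mem_filter c2.
have [Ss1 ks1] := hr _ sr1; have [g hg] := gm_lead gw Ss1.
move/(congr1 (fun F : tensor C n D => F g)): e0.
rewrite !ffunE !sum_ffunE (bigD1_seq s1) //= big1_seq ?addr0; last first.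
  move=> s2 /andP[ne sr2]; rewrite ffunE.
  have [->|cs2] := eqVneq (c s2) 0; first by rewrite scale0r.
  have [_ ks2] := hr _ sr2; have hc := content_wordP s2.
  have [_ ->] := hg (content_word s2); rewrite ?scaler0 //.
    apply: contraNN ne => hc1; apply/eqP/ffunP => b.
    by move/has_contentP: hc => <-; move/has_contentP: hc1 => <-.
  by rewrite /word_le (content_sizeE hc) (content_weightE hc) ks1 ks2 eqxx smax ?orbT.
rewrite big1_seq ?addr0; last first.
  move=> t /andP[_ /hr' tk]; rewrite ffunE.
  have [_ ->] := hg t.2; rewrite ?scaler0 //; last by rewrite /word_le ks1 tk.
  by apply: contraL tk => /content_sizeE ->; rewrite ks1 ltnn.
rewrite ffunE => /eqP; rewrite mulf_eq0 (negbTE cs1) /=.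
by rewrite gt_eqF //; have [h _] := hg (content_word s1); apply: h; apply: content_wordP.
Qed.

End Straightening.

(** * Bases of associated graded spaces *)

Section GradedBasis.
Local Open Scope quotient_scope.
Variables (K : fieldType) (V : lmodType K) (F : filtration V).
Variables (I : eqType) (D : set I) (deg : I -> nat) (e : I -> V).
Hypothesis Fe : forall i, F (deg i) (e i).

Lemma sum_pairs (W : lmodType K) (b : I -> W) (R : seq (K * I)) :
  \sum_(t <- R) t.1 *: b t.2 =
  \sum_(i <- undup [seq t.2 | t <- R]) (\sum_(t <- R | t.2 == i) t.1) *: b i.
Proof.
under [RHS]eq_bigr => i _ do rewrite scaler_suml.
rewrite (exchange_big_dep xpredT) //=; apply: eq_big_seq => t tR.
rewrite (eq_bigl (pred1 t.2)) => [|i]; last by rewrite eq_sym.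
by rewrite -big_filter filter_pred1_uniq ?undup_uniq ?mem_undup ?map_f // big_seq1.
Qed.

Definition hom_elt i : dsum F := insubd (0 : dsum F) (fun k => if k == deg i then e i else 0).

Lemma hom_eltE i k : hom_elt i k = if k == deg i then e i else 0.
Proof. by rewrite val_insubd dsum_class. Qed.

Lemma hom_elt_sum (R : seq (K * I)) k :
  (\sum_(t <- R) t.1 *: hom_elt t.2) k = \sum_(t <- R | deg t.2 == k) t.1 *: e t.2.
Proof.
elim: R => [|t R IH]; first by rewrite !big_nil.
rewrite !big_cons -IH.
rewrite -[LHS]/(t.1 *: hom_elt t.2 k + (\sum_(j <- R) j.1 *: hom_elt j.2) k) hom_eltE eq_sym.
by case: ifP; rewrite ?scaler0 ?add0r.
Qed.

Lemma pi_gr0 : \pi_(gr F) 0 = 0.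
Proof. by apply: (addrI (\pi_(gr F) 0)); rewrite -pi_gr_add !addr0. Qed.

Lemma gr_class_sum (R : seq (K * I)) :
  \sum_(t <- R) t.1 *: gr_class F (deg t.2) (e t.2) =
  \pi_(gr F) (\sum_(t <- R) t.1 *: hom_elt t.2).
Proof.
elim: R => [|t R IH]; first by rewrite !big_nil pi_gr0.
by rewrite !big_cons IH pi_gr_add -pi_gr_scale.
Qed.

(** Homogeneous classes form a basis once, in each degree, they span and are independent modulo the
    previous step of the filtration. The finitely many components of an element are treated
    separately. *)
Lemma gr_basis :
  (forall k u, F k u -> exists2 R : seq (K * I),
     (forall t, t \in R -> D t.2 /\ deg t.2 = k) &
     fil_prev F k (u - \sum_(t <- R) t.1 *: e t.2)) ->
  (forall k (r : seq I) (c : I -> K), uniq r ->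
     (forall i, i \in r -> D i /\ deg i = k) ->
     fil_prev F k (\sum_(i <- r) c i *: e i) -> forall i, i \in r -> c i = 0) ->
  is_basis D (fun i => gr_class F (deg i) (e i)).
Proof.
move=> span indep; split.
  move=> r c ur Dr.
  have -> : \sum_(i <- r) c i *: gr_class F (deg i) (e i) =
      \sum_(t <- [seq (c i, i) | i <- r]) t.1 *: gr_class F (deg t.2) (e t.2).
    by rewrite big_map.
  rewrite gr_class_sum => /eqP; rewrite -pi_gr0 => /gr_eqP h i ir.
  apply: (indep (deg i) [seq j <- r | deg j == deg i] c).
  - exact: filter_uniq.
  - by move=> j; rewrite mem_filter => /andP[/eqP -> /Dr].
  - have := h (deg i); rewrite -[X in fil_prev F _ X]/(_ - 0) subr0 hom_elt_sum big_map.
    by rewrite big_filter.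
  - by rewrite mem_filter eqxx.
elim/quotW => x.
suff [R DR xR] : exists2 R : seq (K * I), (forall t, t \in R -> D t.2) &
    \pi_(gr F) x = \sum_(t <- R) t.1 *: gr_class F (deg t.2) (e t.2).
  exists (undup [seq t.2 | t <- R]), (fun i => \sum_(t <- R | t.2 == i) t.1).
  rewrite xR -(sum_pairs (fun i => gr_class F (deg i) (e i))); split=> // i.
  by rewrite mem_undup => /mapP[t tR ->]; apply: DR.
have [xF [N xN]] : (forall s, F s (x s)) /\ exists N, forall s, (N <= s)%N -> x s = 0.
  by apply/asboolP; exact: (valP x).
have [R DR xR] : exists2 R : seq (K * I), (forall t, t \in R -> D t.2 /\ (deg t.2 < N)%N) &
    forall k, (k < N)%N -> fil_prev F k (x k - \sum_(t <- R | deg t.2 == k) t.1 *: e t.2).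
  elim: {xN} N => [|N [R DR xR]]; first by exists [::].
  have [R' DR' xR'] := span _ _ (xF N); exists (R' ++ R).
    move=> t; rewrite mem_cat => /orP[/DR'[h1 ->]|/DR[h1 h2]]; first by rewrite ltnSn.
    by rewrite ltnS ltnW.
  move=> k; rewrite ltnS leq_eqVlt big_cat /= => /predU1P[->|kN].
    rewrite [X in _ - (_ + X)]big1_seq ?addr0 => [|t /andP[/eqP dt /DR[_]]]; last by rewrite dt ltnn.
    rewrite [X in _ - X]big_seq_cond (eq_bigl (fun t => t \in R')) -?big_seq // => t.
    by case tR: (t \in R') => //=; have [_ ->] := DR' _ tR; rewrite eqxx.
  rewrite [X in _ - (X + _)]big1_seq ?add0r; first exact: xR.
  by move=> t /andP[/eqP dt /DR'[_ tN]]; move: kN; rewrite -dt tN ltnn.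
exists R => [t /DR[] //|]; rewrite gr_class_sum; apply/eqP/gr_eqP => k; rewrite hom_elt_sum.
have [kN|Nk] := ltnP k N; first exact: xR.
rewrite xN // big1_seq ?subr0; first exact: (proj1 (fil_prev_submodule _ _)).
by move=> t /andP[/eqP dt /DR[_]]; rewrite dt ltnNge Nk.
Qed.

End GradedBasis.

(** * Reduction to the standard triangular decomposition *)

Section WeightBasis.
Variables (C : numClosedFieldType) (n : nat).
Local Notation M := 'M[C]_n.+1.
Variables (h : {vspace M}) (alpha : 'I_n -> {scalar M}).
Hypothesis hcartan : cartan_decomposition h alpha.

Definition weight_row (z : 'rV[C]_n.+1) := forall y, y \in h -> exists c, z *m y = c *: z.

Lemma cartan_comm y y' : y \in h -> y' \in h -> y *m y' = y' *m y.
Proof.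
move=> yh /(cartan_zero_weight hcartan)[_ /(_ y yh)].
by rewrite scale0r /lie_bracket => /eqP; rewrite subr_eq0 => /eqP.
Qed.

Lemma weight_row_root a (x : M) z : root_space h a x -> weight_row z -> weight_row (z *m x).
Proof.
move=> [_ xa] wz y yh; have [c zy] := wz y yh; exists (c - a y).
have -> : z *m x *m y = z *m y *m x - z *m lie_bracket y x.
  by rewrite /lie_bracket mulmxBr !mulmxA opprB addrCA subrr addr0.
by rewrite xa // zy -scalemxAl -scalemxAr scalerBl.
Qed.

Lemma weight_row_exists : exists2 z, z != 0 & weight_row z.
Proof.
have cB : {in vbasis h &, forall A B, comm_mx A B}.
  by move=> A B /vbasis_mem Ah /vbasis_mem Bh; apply: cartan_comm.
have [z z0 /allP zh] := common_eigenvector (ltn0Sn n) cB.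
exists z => // y yh; rewrite (coord_vbasis yh).
suff /choice[c hc] : forall i : 'I_(\dim h), exists c, z *m (vbasis h)`_i = c *: z.
  exists (\sum_i coord (vbasis h) i y * c i); rewrite mulmx_sumr scaler_suml.
  by apply: eq_bigr => i _; rewrite -scalemxAr hc scalerA.
move=> i; have /zh/sub_rVP[c e] : (vbasis h)`_i \in vbasis h by rewrite mem_nth ?size_tuple.
by exists c.
Qed.

(** This yields diagonalisability of [h], which the decomposition does not state. Every row is
    [u *m X0] for one weight row [u]; subtract the scalar part of [X0] and decompose the rest into
    root vectors and an element of [h], each of which sends [u] to a weight row. *)
Lemma weight_rows_span (e : 'rV[C]_n.+1) : exists r : seq 'rV[C]_n.+1,
  (forall z, z \in r -> weight_row z) /\ e = \sum_(z <- r) z.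
Proof.
have [u u0 wu] := weight_row_exists.
have [j uj] : exists j, u 0 j != 0 by apply/rV0Pn.
pose X0 : M := (u 0 j)^-1 *: (delta_mx j 0 *m e).
have uX0 : u *m X0 = e.
  rewrite -scalemxAr mulmxA -colE; apply/rowP => k; rewrite !mxE big_ord1 !mxE.
  by rewrite mulrA mulVf ?mul1r.
pose c := \tr X0 / n.+1%:R; pose X := X0 - c%:M.
have slX : sl X.
  by rewrite /sl /= linearB /= mxtrace_scalar -mulr_natr divfK ?subrr // pnatr_eq0.
have [xm [y [xp [[xm_ hm xmE] yh [xp_ hp xpE] XE]]]] := cartan_sum hcartan slX.
have eE : e = u *m X + c *: u by rewrite mulmxBr uX0 mul_mx_scalar subrK.
have [d uy] := wu y yh.
exists (c *: u :: u *m y :: [seq u *m xm_ b | b <- index_enum (posroot n)] ++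
  [seq u *m xp_ b | b <- index_enum (posroot n)]); split.
  have wZ k : weight_row (k *: u).
    move=> y' y'h; have [d' e'] := wu y' y'h; exists d'.
    by rewrite -scalemxAl e' scalerA mulrC -scalerA.
  move=> z; rewrite !inE => /orP[/eqP ->|/orP[/eqP ->|]]; rewrite ?uy //.
  rewrite mem_cat => /orP[] /mapP[b _ ->].
    exact: weight_row_root (hm b) wu.
  exact: weight_row_root (hp b) wu.
rewrite !big_cons big_cat !big_map /= -!mulmx_sumr -xmE -xpE -!mulmxDr eE addrC XE.
by congr (_ + _ *m _); rewrite addrA [y + _]addrC.
Qed.

Lemma weight_basis : exists2 P : M, P \in unitmx &
  forall y, y \in h -> is_diag_mx (P *m y *m invmx P).
Proof.
have [r hr] := choice weight_rows_span.
pose R := flatten [seq r (delta_mx 0 i) | i <- enum 'I_n.+1].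
have wR z : z \in R -> weight_row z.
  by move=> /flattenP[s /mapP[i _ ->]]; apply: (proj1 (hr _)).
pose A : 'M[C]_(size R, n.+1) := \matrix_(i < size R) R`_i.
have fA : row_full A.
  rewrite -sub1mx; apply/row_subP => i; rewrite row1 (proj2 (hr (delta_mx 0 i))).
  rewrite big_seq; apply: summx_sub => z zr.
  have zR : z \in R by apply/flattenP; exists (r (delta_mx 0 i)); rewrite ?map_f ?mem_enum.
  have zi : (index z R < size R)%N by rewrite index_mem.
  have -> : z = row (Ordinal zi) A by rewrite rowK nth_index.
  exact: row_sub.
pose P := rowsub (fullrankfun fA) A.
have Pu : P \in unitmx by apply: fullrowsub_unit.
exists P => // y yh.
have /choice[c hc] : forall i, exists c, row i P *m y = c *: row i P.
  by move=> i; rewrite /P row_rowsub rowK; apply: wR => //; apply: mem_nth.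
have -> : P *m y = diag_mx (\row_i c i) *m P.
  apply/row_matrixP => i; by rewrite row_mul hc mul_diag_mx; apply/rowP => k; rewrite !mxE.
by rewrite mulmxK // diag_mx_is_diag.
Qed.

(** Shifting by a constant makes any diagonal traceless without changing differences, so indicator
    functions may be used for testing. *)
Lemma traceless_pair_inj (a c a' c' : 'I_n.+1) : a != c ->
  (forall D : 'I_n.+1 -> C, \sum_e D e = 0 -> D a - D c = D a' - D c') -> a = a' /\ c = c'.
Proof.
move=> ac hD; have {}hD (d : 'I_n.+1 -> C) : d a - d c = d a' - d c'.
  pose k := (\sum_e d e) / n.+1%:R.
  have := hD (fun e => d e - k); rewrite sumrB sumr_const card_ord -[_ *+ n.+1]mulr_natr.
  rewrite divfK ?subrr ?pnatr_eq0 // => /(_ erefl).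
  by rewrite !opprB !addrA !subrK.
split; apply/eqP/negPn/negP => ne.
  have /eqP := hD (fun e => (e == a)%:R).
  rewrite eqxx [c == a]eq_sym (negbTE ac) subr0 [a' == a]eq_sym (negbTE ne) sub0r.
  by rewrite -addr_eq0 -natrD pnatr_eq0.
have /eqP := hD (fun e => (e == c)%:R).
rewrite eqxx (negbTE ac) [c' == c]eq_sym (negbTE ne) sub0r subr0 eq_sym -addr_eq0.
by rewrite -natrD pnatr_eq0 addnC.
Qed.

Variable f : posroot n -> M.
Hypothesis hf : forall b, root_space h (fun y => - root_form alpha b y) (f b) /\ f b <> 0.

Variables (P : M) (Pu : P \in unitmx).
Hypothesis diagP : forall y, y \in h -> is_diag_mx (P *m y *m invmx P).

Definition diagf (D : 'I_n.+1 -> C) : M := diag_mx (\row_a D a).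

(** In the weight basis these matrices are diagonal, hence commute with [h], and [h] is its own
    centraliser in sl. *)
Lemma diagf_mem D : \sum_a D a = 0 -> invmx P *m diagf D *m P \in h.
Proof.
move=> D0; apply/(cartan_zero_weight hcartan); split.
  by rewrite /sl /= mxtrace_mulC mulmxA mulmxV // mul1mx mxtrace_diag -[RHS]D0; apply: eq_bigr => a _; rewrite mxE.
move=> y yh; rewrite scale0r /lie_bracket.
have /diag_mxP[d yE] : is_diag_mx (P *m y *m invmx P) := diagP yh.
have -> : y = invmx P *m diag_mx d *m P.
  by rewrite -yE !mulmxA mulVmx // mul1mx -mulmxA mulVmx // mulmx1.
have cj (X Y : M) : invmx P *m X *m P *m (invmx P *m Y *m P) = invmx P *m (X *m Y) *m P.
  by rewrite !mulmxA -[_ *m P *m invmx P]mulmxA mulmxV // mulmx1.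
by rewrite !cj diag_mxC subrr.
Qed.

Lemma root_entry a x : root_space h a x -> forall D i j, \sum_e D e = 0 ->
  (P *m x *m invmx P) i j != 0 -> D i - D j = a (invmx P *m diagf D *m P).
Proof.
move=> [_ hx] D i j D0 ne; have := hx _ (diagf_mem D0).
set y := invmx P *m diagf D *m P => e.
have {}e : diagf D *m (P *m x *m invmx P) - P *m x *m invmx P *m diagf D = a y *: (P *m x *m invmx P).
  have -> : a y *: (P *m x *m invmx P) = P *m (a y *: x) *m invmx P.
    by rewrite -scalemxAr -scalemxAl.
  rewrite -e /lie_bracket /y mulmxBr mulmxBl !mulmxA mulmxV // mul1mx; congr (_ - _).
  by rewrite -[in RHS]mulmxA mulmxV // mulmx1.
move: e ne; move: (P *m x *m invmx P) => G e ne.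
move/matrixP/(_ i j): e; rewrite /diagf mul_diag_mx mul_mx_diag !mxE => e.
by apply: (mulIf ne); rewrite mulrBl [D j * _]mulrC e.
Qed.

Lemma root_form_neq0 b : exists2 D : 'I_n.+1 -> C, \sum_e D e = 0 &
  root_form alpha b (invmx P *m diagf D *m P) != 0.
Proof.
apply: contrapT => h0.
have := cartan_simple_free hcartan (c := fun i => ((root_fst b <= i <= root_snd b)%N)%:R) _ (root_fst b).
rewrite leqnn root_fst_snd => /(_ _)/eqP; rewrite oner_eq0 => H.
suff : false by []. apply: H => y yh.
have /diag_mxP[d yE] : is_diag_mx (P *m y *m invmx P) := diagP yh.
have yE' : y = invmx P *m diagf (d 0) *m P.
  have -> : diagf (d 0) = diag_mx d by congr diag_mx; apply/rowP => j; rewrite mxE.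
  by rewrite -yE !mulmxA mulVmx // mul1mx -mulmxA mulVmx // mulmx1.
have /(cartan_zero_weight hcartan)[sly _] := yh.
apply/eqP/negPn/negP => ne; apply: h0; exists (d 0).
  move: sly; rewrite /sl /= yE' mxtrace_mulC mulmxA mulmxV // mul1mx mxtrace_diag => e.
  by rewrite -[RHS]e; apply: eq_bigr => a _; rewrite mxE.
rewrite -yE'; move: ne; rewrite /root_form [in X in _ -> X]big_mkcond; congr (_ != _).
by apply: eq_bigr => i _; case: ifP => _; rewrite ?mul1r ?mul0r.
Qed.

(** A nonzero entry at [(i, j)] identifies the weight as the difference of diagonal entries [i] and
    [j]. Distinct off-diagonal positions have distinct differences, so a root vector has a single
    nonzero entry. *)
Lemma root_vector_shape b : exists k a c, [/\ k != 0, a != c,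
  f b = k *: (invmx P *m delta_mx a c *m P) &
  forall D : 'I_n.+1 -> C, \sum_e D e = 0 ->
    root_form alpha b (invmx P *m diagf D *m P) = D c - D a].
Proof.
have [hb fb0] := hf b; set G := P *m f b *m invmx P.
have fE : f b = invmx P *m G *m P.
  by rewrite /G !mulmxA mulVmx // mul1mx -mulmxA mulVmx // mulmx1.
have [a [c ac]] : exists a c, G a c != 0.
  apply: contrapT => h0; apply: fb0; rewrite fE (_ : G = 0) ?mulmx0 ?mul0mx //.
  by apply/matrixP => a c; rewrite [RHS]mxE; apply/eqP/negPn/negP => ne; apply: h0; exists a, c.
have hD D : \sum_e D e = 0 -> root_form alpha b (invmx P *m diagf D *m P) = D c - D a.
  by move=> D0; have /= /(congr1 -%R) := root_entry hb D0 ac; rewrite opprB opprK => ->.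
have nac : a != c.
  apply/eqP => e; have [D D0] := root_form_neq0 b; rewrite hD // e subrr eqxx //.
exists (G a c), a, c; split=> //.
rewrite {1}fE scalemxAl scalemxAr; congr (_ *m _ *m _).
apply/matrixP => i j; rewrite [RHS]mxE [X in _ * X]mxE.
have [/andP[/eqP -> /eqP ->]|nij] := boolP ((i == a) && (j == c)); first by rewrite mulr1.
rewrite mulr0; apply/eqP/negPn/negP => ne; case/negP: nij.
have [|<- <-] := @traceless_pair_inj a c i j nac; last by rewrite !eqxx.
move=> D D0; by have /= -> := root_entry hb D0 ne; rewrite hD // opprB.
Qed.

End WeightBasis.

(** * Simple roots as arrows forming an oriented path *)

Section SimpleRootPath.
Variables (C : numClosedFieldType) (n : nat).
Local Notation J := 'I_n.+1.

(** Simple root [l] is an arrow from [A l] to [B l]; every sum over consecutive arrows has to be a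
    single arrow with distinct ends. *)
Definition root_differences (A B : 'I_n -> J) : Prop :=
  forall b : posroot n, exists a c : J, a != c /\ forall d : J -> C,
  \sum_(l < n | (root_fst b <= l <= root_snd b)%N) (d (B l) - d (A l)) = d c - d a.

Lemma root_differences_swap A B : root_differences A B -> root_differences B A.
Proof.
move=> H b; have [a [c [ac hd]]] := H b; exists c, a; rewrite eq_sym; split=> // d.
by rewrite -opprB -hd -sumrN; apply: eq_bigr => l _; rewrite opprB.
Qed.

Let diff_neq2 (x y : bool) : (x%:R - y%:R == 2%:R :> C) = false.
Proof. by rewrite subr_eq -natrD eqr_nat; case: x; case: y. Qed.

Let sum1 (G : 'I_n -> C) (i : 'I_n) : \sum_(l < n | (i <= l <= i)%N) G l = G i.
Proof.
rewrite (big_pred1 i) // => l /=; rewrite -eqn_leq.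
by apply/eqP/eqP => [/val_inj|->].
Qed.

Let sumS (G : 'I_n -> C) (i j k : 'I_n) : (i <= j)%N -> k = j.+1 :> nat ->
  \sum_(l < n | (i <= l <= k)%N) G l = \sum_(l < n | (i <= l <= j)%N) G l + G k.
Proof.
move=> ij kj; rewrite (bigD1 k) /= ?leqnn ?kj ?andbT; last by lia.
rewrite addrC; congr (_ + _); apply: eq_bigl => l.
rewrite -val_eqE /= kj; lia.
Qed.

Lemma sum_path (X : J -> C) (i j : 'I_n) : (i <= j)%N ->
  \sum_(l < n | (i <= l <= j)%N) (X (widen_ord (leqnSn n) l) - X (lift ord0 l)) =
  X (widen_ord (leqnSn n) i) - X (lift ord0 j).
Proof.
move=> ij; have [k jE] : exists k, j = (i + k)%N :> nat by exists (j - i)%N; rewrite subnKC.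
elim: k j jE {ij} => [|k IH] j jE.
  by have -> : j = i; [apply: val_inj; rewrite /= jE addn0|rewrite sum1].
have kn : (i + k < n)%N by apply: leq_ltn_trans (ltn_ord j); rewrite jE leq_add2l.
have jk : j = (Ordinal kn).+1 :> nat by rewrite jE addnS.
rewrite (sumS _ _ jk) ?leq_addr // (IH (Ordinal kn)) //.
have -> : lift ord0 (Ordinal kn) = widen_ord (leqnSn n) j by apply: val_inj; rewrite /= /bump /= add1n jk.
by rewrite addrA subrK.
Qed.

Variables (A B : 'I_n -> J).
Hypothesis H : root_differences A B.

Lemma root_differences_neq l : A l != B l.
Proof.
have [a [c [ac hd]]] := H (mkroot (leqnn l)); rewrite mkroot_fst mkroot_snd in hd.
apply/eqP => e; have := hd (fun x => (x == c)%:R); rewrite sum1 e subrr eqxx (negbTE ac) subr0.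
by move/eqP; rewrite eq_sym oner_eq0.
Qed.

(** Consecutive arrows meet head to tail at exactly one end. With both equalities their sum would be
    0; with neither, the indicator of the two heads would take the value 2 on it, impossible for a
    difference of two booleans. *)
Lemma root_differences_meet (l k : 'I_n) : k = l.+1 :> nat -> (A l == B k) = (B l != A k).
Proof.
move=> kl; have lk : (l <= k)%N by rewrite kl.
have [a [c [ac hd]]] := H (mkroot lk); rewrite mkroot_fst mkroot_snd in hd.
have {}hd (d : J -> C) : d (B l) - d (A l) + (d (B k) - d (A k)) = d c - d a.
  by rewrite -hd (sumS _ (leqnn l) kl) sum1.
have [e1|n1] := eqVneq (A l) (B k); have [e2|n2] := eqVneq (B l) (A k) => //=.
  have := hd (fun x => (x == c)%:R); rewrite e1 e2 eqxx (negbTE ac) subr0.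
  by rewrite addrC subrKA subrr => /eqP; rewrite eq_sym oner_eq0.
have := hd (fun x => ((x == B l) || (x == B k))%:R) => /eqP.
rewrite !eqxx orbT (negbTE (root_differences_neq l)) (negbTE n1) /=.
rewrite [A k == B l]eq_sym (negbTE n2) (negbTE (root_differences_neq k)) !subr0.
by rewrite -(natrD _ 1 1) eq_sym diff_neq2.
Qed.

(** The orientation persists: a turn after two aligned arrows would make the sum of the three take
    the value 2 on the indicator of the heads of the first and last. *)
Lemma root_differences_step (l k j : 'I_n) : k = l.+1 :> nat -> j = k.+1 :> nat ->
  A l = B k -> A k = B j.
Proof.
move=> kl jk e; apply/eqP; rewrite (root_differences_meet jk); apply/eqP => e'.
have nj : A k != B j by rewrite (root_differences_meet jk) e' eqxx.
have nl : B l != A k by rewrite -(root_differences_meet kl) e.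
have lj : (l <= j)%N by rewrite jk kl; lia.
have lk : (l <= k)%N by rewrite kl.
have [a [c [ac hd]]] := H (mkroot lj); rewrite mkroot_fst mkroot_snd in hd.
have {}hd (d : J -> C) : d (B l) - d (A l) + (d (B k) - d (A k)) + (d (B j) - d (A j)) = d c - d a.
  by rewrite -hd (sumS _ lk jk) (sumS _ (leqnn l) kl) sum1.
have al := root_differences_neq l; have aj := root_differences_neq j.
have := hd (fun x => ((x == B l) || (x == B j))%:R) => /eqP.
have -> : (B k == B l) || (B k == B j) = false by rewrite -{1}e (negbTE al) e' (negbTE aj).
have -> : (A l == B l) || (A l == B j) = false by rewrite (negbTE al) e e' (negbTE aj).
have -> : (A j == B l) || (A j == B j) = false by rewrite -e' -{1}e (negbTE al) e' (negbTE aj).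
rewrite !eqxx orbT [A k == B l]eq_sym (negbTE nl) (negbTE nj) !subr0 addr0.
by rewrite -(natrD _ 1 1) eq_sym diff_neq2.
Qed.

(** Vertex 0 is the head of the first arrow and vertex [l.+1] the tail of arrow [l]. The default
    [ord0] is reached only for [n = 0]. *)
Definition path_vertex (a : J) : J :=
  if unlift ord0 a is Some l then A l else
  if [pick l : 'I_n | l == 0 :> nat] is Some l then B l else ord0.

Lemma root_differences_path : (forall l k : 'I_n, k = l.+1 :> nat -> A l = B k) ->
  [/\ injective path_vertex,
      forall l, A l = path_vertex (lift ord0 l) &
      forall l, B l = path_vertex (widen_ord (leqnSn n) l)].
Proof.
move=> st.
have pA l : A l = path_vertex (lift ord0 l) by rewrite /path_vertex liftK.
have pB l : B l = path_vertex (widen_ord (leqnSn n) l).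
  rewrite /path_vertex; case: unliftP => [k /(congr1 val)|/(congr1 val)] /=.
    by rewrite /bump add1n => e; rewrite (st k l).
  move=> l0; case: pickP => [k /eqP k0|/(_ l)]; last by rewrite l0.
  by congr B; apply: val_inj; rewrite /= l0 k0.
split=> //.
have lt_neq (i j : 'I_n) : (i <= j)%N -> path_vertex (widen_ord (leqnSn n) i) != path_vertex (lift ord0 j).
  move=> ij; have [a [c [ac hd]]] := H (mkroot ij); rewrite mkroot_fst mkroot_snd in hd.
  apply/eqP => e.
  have tel (d : J -> C) : \sum_(l < n | (i <= l <= j)%N) (d (B l) - d (A l)) = d (B i) - d (A j).
    rewrite [B i]pB [A j]pA -(sum_path (d \o path_vertex) ij).
    by apply: eq_bigr => l _; rewrite /= -pA -pB.
  have := etrans (esym (tel (fun x => (x == c)%:R))) (hd _).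
  rewrite pB pA e subrr eqxx (negbTE ac) subr0.
  by move/eqP; rewrite eq_sym oner_eq0.
move=> a c /eqP e; apply/eqP; apply: contraLR e => ne.
wlog ac : a c ne / (a < c)%N.
  move=> h; move: (ne); rewrite neq_ltn => /orP[/h->//|ca].
  by rewrite eq_sym; apply: h => //; rewrite eq_sym.
have an : (a < n)%N by apply: leq_trans ac _; rewrite -ltnS ltn_ord.
have cn : (c.-1 < n)%N by have := ltn_ord c; lia.
have := @lt_neq (Ordinal an) (Ordinal cn).
have -> : widen_ord (leqnSn n) (Ordinal an) = a by apply: val_inj.
have -> : lift ord0 (Ordinal cn) = c.
  by apply: val_inj; rewrite /= /bump /= add1n prednK //; lia.
apply; rewrite /=; lia.
Qed.

End SimpleRootPath.

Lemma root_path (C : numClosedFieldType) n (A B : 'I_n -> 'I_n.+1) : root_differences C A B ->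
  exists2 x : 'I_n.+1 -> 'I_n.+1, injective x &
  (forall l, A l = x (lift ord0 l) /\ B l = x (widen_ord (leqnSn n) l)) \/
  (forall l, B l = x (lift ord0 l) /\ A l = x (widen_ord (leqnSn n) l)).
Proof.
move=> H.
have prop (A' B' : 'I_n -> 'I_n.+1) : root_differences C A' B' ->
    (forall l k : 'I_n, l = 0 :> nat -> k = 1 :> nat -> A' l = B' k) ->
    forall l k : 'I_n, k = l.+1 :> nat -> A' l = B' k.
  move=> H' h0 l; have [N] := ubnP (l : nat); elim: N l => // N IH l lN k kl.
  have [l0|l0] := posnP l; first by apply: h0; rewrite ?kl l0.
  have pn : (l.-1 < n)%N by have := ltn_ord l; lia.
  apply: (root_differences_step H' (l := Ordinal pn)) => //=; first by rewrite prednK.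
  by apply: IH; rewrite /= prednK.
have [h0|h0] := pselect (forall l k : 'I_n, l = 0 :> nat -> k = 1 :> nat -> A l = B k).
  have [h1 h2 h3] := root_differences_path H (prop _ _ H h0).
  by exists (path_vertex A B) => //; left.
have H' := root_differences_swap H.
have [|h1 h2 h3] := root_differences_path H' (prop _ _ H' _).
  move=> l k l0 k1; have kl : k = l.+1 :> nat by rewrite k1 l0.
  apply/eqP; rewrite -[_ == _]negbK -(root_differences_meet H kl).
  apply/negP => /eqP e; apply: h0 => l' k' l'0 k'1.
  have -> : l' = l by apply: val_inj; rewrite /= l'0 l0.
  by have -> : k' = k by apply: val_inj; rewrite /= k'1 k1.
by exists (path_vertex B A) => //; right.
Qed.

(** * Standard frames: relabelled conjugation, with or without the outer automorphism *)

Section StandardFrame.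
Variables (C : numClosedFieldType) (n : nat).
Local Notation M := 'M[C]_n.+1.
Local Notation row b := (lift ord0 (root_snd b)).
Local Notation col b := (widen_ord (leqnSn n) (root_fst b)).

(* [psi] carries the standard triangular decomposition of [sl] to the given one. *)
Record standard_frame (h : {vspace M}) (alpha : 'I_n -> {scalar M}) (f : posroot n -> M)
    (psi phi : M -> M) : Prop := {
  frame_linear : forall a x y, psi (a *: x + y) = a *: psi x + psi y;
  frame_bracket : forall x y, psi (lie_bracket x y) = lie_bracket (psi x) (psi y);
  frame_phiK : forall x, psi (phi x) = x;
  frame_sl : forall x, sl x -> sl (psi x);
  frame_sl_phi : forall x, sl x -> sl (phi x);
  frame_root : forall b, exists2 k, k != 0 & f b = k *: psi (lower_gen C b);
  frame_diag : forall D : 'I_n.+1 -> C, \sum_e D e = 0 -> psi (diagf D) \in h /\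
    forall b, root_form alpha b (psi (diagf D)) = D (col b) - D (row b);
  frame_cartan : forall y, y \in h -> exists2 D : 'I_n.+1 -> C, \sum_e D e = 0 & y = psi (diagf D) }.

Lemma tr_diagf (D : 'I_n.+1 -> C) : \tr (diagf D) = \sum_e D e.
Proof. by rewrite mxtrace_diag; apply: eq_bigr => e _; rewrite mxE. Qed.

Section Conjugate.
Variables (h : {vspace M}) (alpha : 'I_n -> {scalar M}) (f : posroot n -> M).
Hypothesis hcartan : cartan_decomposition h alpha.
Variables (P : M) (Pu : P \in unitmx).
Hypothesis diagP : forall y, y \in h -> is_diag_mx (P *m y *m invmx P).
Variables (k : posroot n -> C) (a c : posroot n -> 'I_n.+1).
Hypothesis shape : forall b, [/\ k b != 0, a b != c b,
  f b = k b *: (invmx P *m delta_mx (a b) (c b) *m P) &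
  forall D : 'I_n.+1 -> C, \sum_e D e = 0 ->
    root_form alpha b (invmx P *m diagf D *m P) = D (c b) - D (a b)].

Lemma conj_frame (R R' : M -> M) :
  (forall a x y, R (a *: x + y) = a *: R x + R y) ->
  (forall x y, R (lie_bracket x y) = lie_bracket (R x) (R y)) ->
  (forall x, R (R' x) = x) -> (forall x, sl x -> sl (R x)) -> (forall x, sl x -> sl (R' x)) ->
  (forall b, exists2 e, e != 0 & R (lower_gen C b) = e *: delta_mx (a b) (c b)) ->
  (forall D : 'I_n.+1 -> C, \sum_e D e = 0 -> exists D' : 'I_n.+1 -> C,
     [/\ \sum_e D' e = 0, R (diagf D) = diagf D' &
         forall b, D' (c b) - D' (a b) = D (col b) - D (row b)]) ->
  (forall D' : 'I_n.+1 -> C, \sum_e D' e = 0 -> exists2 D : 'I_n.+1 -> C,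
     \sum_e D e = 0 & R (diagf D) = diagf D') ->
  standard_frame h alpha f (fun z => invmx P *m R z *m P) (fun z => R' (P *m z *m invmx P)).
Proof.
move=> r1 r2 r3 r4 r5 r6 r7 r8.
have cK (z : M) : invmx P *m (P *m z *m invmx P) *m P = z.
  by rewrite !mulmxA mulVmx // mul1mx -mulmxA mulVmx // mulmx1.
have tr1 (z : M) : \tr (invmx P *m z *m P) = \tr z.
  by rewrite mxtrace_mulC mulmxA mulmxV // mul1mx.
have tr2 (z : M) : \tr (P *m z *m invmx P) = \tr z.
  by rewrite mxtrace_mulC mulmxA mulVmx // mul1mx.
split.
- by move=> e x y; rewrite r1 mulmxDr mulmxDl -scalemxAr -scalemxAl.
- move=> x y; rewrite r2 /lie_bracket mulmxBr mulmxBl !mulmxA.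
  by rewrite -![_ *m P *m invmx P]mulmxA mulmxV // !mulmx1.
- by move=> x; rewrite r3 cK.
- by move=> x /r4; rewrite /sl /= tr1.
- by move=> x sx; apply: r5; rewrite /sl /= tr2.
- move=> b; have [kb _ fE _] := shape b; have [e e0 RE] := r6 b; exists (k b / e).
    by rewrite mulf_neq0 // invr_eq0.
  by rewrite RE -scalemxAr -scalemxAl scalerA divfK.
- move=> D D0; have [D' [D'0 RE D'E]] := r7 D D0; rewrite RE; split.
    exact: (diagf_mem hcartan).
  by move=> b; have [_ _ _ ->] := shape b.
- move=> y yh; have /diag_mxP[d dE] := diagP yh.
  have dE' : P *m y *m invmx P = diagf (d 0).
    by rewrite dE; congr diag_mx; apply/rowP => j; rewrite mxE.
  have [|D D0 RE] := r8 (d 0).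
    have /(cartan_zero_weight hcartan)[sy _] := yh.
    by rewrite -tr_diagf -dE' tr2.
  by exists D => //; rewrite RE -dE' cK.
Qed.

End Conjugate.

Theorem standard_frame_ex (h : {vspace M}) (alpha : 'I_n -> {scalar M}) (f : posroot n -> M) :
  cartan_decomposition h alpha ->
  (forall b, root_space h (fun y => - root_form alpha b y) (f b) /\ f b <> 0) ->
  exists psi phi, standard_frame h alpha f psi phi.
Proof.
move=> hcartan hf; have [P Pu diagP] := weight_basis hcartan.
have /choice[k /choice[a /choice[c shape]]] := root_vector_shape hcartan hf Pu diagP.
pose A (l : 'I_n) := a (mkroot (leqnn l)); pose B (l : 'I_n) := c (mkroot (leqnn l)).
have rootE b (D : 'I_n.+1 -> C) : \sum_e D e = 0 ->
    \sum_(l < n | (root_fst b <= l <= root_snd b)%N) (D (B l) - D (A l)) = D (c b) - D (a b).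
  move=> D0; have [_ _ _ <-] := shape b => //; apply: eq_bigr => l _.
  have [_ _ _ <-] := shape (mkroot (leqnn l)) => //.
  rewrite /root_form mkroot_fst mkroot_snd (big_pred1 l) // => i /=; rewrite -eqn_leq.
  by apply/eqP/eqP => [/val_inj|->].
have diffs : root_differences C A B.
  move=> b; exists (a b), (c b); have [_ ac _ _] := shape b; split=> // d.
  pose t := (\sum_e d e) / n.+1%:R.
  have := rootE b (fun e => d e - t); rewrite sumrB sumr_const card_ord -[_ *+ n.+1]mulr_natr.
  rewrite divfK ?subrr ?pnatr_eq0 // => /(_ erefl); rewrite opprB addrA subrK => <-.
  by apply: eq_bigr => l _; rewrite opprB addrA subrK.
have [x xinj xAB] := root_path diffs.
have [x' xK x'K] := injF_bij xinj.
have sumD' (D : 'I_n.+1 -> C) : \sum_e D (x e) = \sum_e D e.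
  by rewrite [RHS](reindex_inj xinj).
have sumD (D : 'I_n.+1 -> C) : \sum_e D (x' e) = \sum_e D e.
  by rewrite -sumD'; apply: eq_bigr => e _; rewrite xK.
have sh b (D : 'I_n.+1 -> C) : \sum_(l < n | (root_fst b <= l <= root_snd b)%N)
    (D (x (widen_ord (leqnSn n) l)) - D (x (lift ord0 l))) = D (x (col b)) - D (x (row b)).
  exact: (sum_path (D \o x) (root_fst_snd b)).
have hshape := shape.
case: xAB => xAB.
  have ac b : a b = x (row b) /\ c b = x (col b).
    have [_ nac _ _] := shape b; apply: (traceless_pair_inj nac) => D D0.
    apply: oppr_inj; rewrite !opprB; refine (etrans (esym (rootE b D D0)) (etrans _ (sh b D))).
    by apply: eq_bigr => l _; have [<- <-] := xAB l.
  pose R (z : M) : M := \matrix_(i, j) z (x' i) (x' j).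
  pose R' (z : M) : M := \matrix_(i, j) z (x i) (x j).
  exists (fun z => invmx P *m R z *m P), (fun z => R' (P *m z *m invmx P)).
  apply: (conj_frame hcartan Pu diagP shape).
  - by move=> e y z; apply/matrixP => i j; rewrite !mxE.
  - move=> y z; apply/matrixP => i j; rewrite !mxE; congr (_ - _).
      by rewrite (reindex_inj (can_inj x'K)); apply: eq_bigr => e _; rewrite !mxE.
    by rewrite (reindex_inj (can_inj x'K)); apply: eq_bigr => e _; rewrite !mxE.
  - by move=> z; apply/matrixP => i j; rewrite !mxE !x'K.
  - move=> z; rewrite /sl /= => <-; rewrite /mxtrace -(sumD (fun i => z i i)).
    by apply: eq_bigr => i _; rewrite mxE.
  - move=> z; rewrite /sl /= => <-; rewrite /mxtrace -(sumD' (fun i => z i i)).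
    by apply: eq_bigr => i _; rewrite mxE.
  - move=> b; exists 1; rewrite ?oner_neq0 // scale1r; apply/matrixP => i j; rewrite !mxE.
    have [-> ->] := ac b; by rewrite !(can2_eq x'K xK).
  - move=> D D0; exists (D \o x'); split; first exact: etrans (sumD D) D0.
      apply/matrixP => i j; rewrite !mxE (inj_eq (can_inj x'K)).
      by case: (i == j) => //; rewrite !mulr1n mxE.
    by move=> b; have [-> ->] := ac b; rewrite /= !xK.
  - move=> D D0; exists (D \o x); first exact: etrans (sumD' D) D0.
    apply/matrixP => i j; rewrite !mxE (inj_eq (can_inj x'K)).
    by case: (i == j) => //; rewrite /= x'K.
have ac b : a b = x (col b) /\ c b = x (row b).
  have [_ nac _ _] := shape b; apply: (traceless_pair_inj nac) => D D0.
  refine (etrans _ (sh b D)); refine (etrans (esym (opprB _ _)) _).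
  refine (etrans (congr1 -%R (esym (rootE b D D0))) _); rewrite -sumrN.
  by apply: eq_bigr => l _; have [<- <-] := xAB l; rewrite opprB.
(* The arrows run the other way; minus the transpose reverses them before relabelling. *)
pose R (z : M) : M := \matrix_(i, j) - z (x' j) (x' i).
pose R' (z : M) : M := \matrix_(i, j) - z (x j) (x i).
exists (fun z => invmx P *m R z *m P), (fun z => R' (P *m z *m invmx P)).
apply: (conj_frame hcartan Pu diagP shape).
- by move=> e y z; apply/matrixP => i j; rewrite !mxE opprD mulrN.
- move=> y z; apply/matrixP => i j; rewrite !mxE opprB; congr (_ - _).
    by rewrite (reindex_inj (can_inj x'K)); apply: eq_bigr => e _; rewrite !mxE mulrNN mulrC.
  by rewrite (reindex_inj (can_inj x'K)); apply: eq_bigr => e _; rewrite !mxE mulrNN mulrC.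
- by move=> z; apply/matrixP => i j; rewrite !mxE opprK !x'K.
- move=> z; rewrite /sl /= => e; apply/eqP; rewrite -oppr_eq0 -e /mxtrace -(sumD (fun i => z i i)) -sumrN.
  by apply/eqP/eq_bigr => i _; rewrite mxE opprK.
- move=> z; rewrite /sl /= => e; apply/eqP; rewrite -oppr_eq0 -e /mxtrace -(sumD' (fun i => z i i)) -sumrN.
  by apply/eqP/eq_bigr => i _; rewrite mxE opprK.
- move=> b; exists (-1); rewrite ?oppr_eq0 ?oner_neq0 // scaleN1r; apply/matrixP => i j; rewrite !mxE.
  have [-> ->] := ac b; by rewrite !(can2_eq x'K xK) andbC.
- move=> D D0; exists (fun i => - D (x' i)); split; first by rewrite sumrN sumD D0 oppr0.
    apply/matrixP => i j; rewrite !mxE (inj_eq (can_inj x'K)) eq_sym.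
    by case: (i == j) / eqP => [->|_]; rewrite ?mulr1n ?mulr0n ?oppr0 // mxE.
  by move=> b; have [-> ->] := ac b; rewrite /= !xK opprK addrC.
- move=> D D0; exists (fun i => - D (x i)); first by rewrite sumrN sumD' D0 oppr0.
  apply/matrixP => i j; rewrite !mxE (inj_eq (can_inj x'K)) eq_sym.
  by case: (i == j) / eqP => [->|_]; rewrite ?mulr1n ?mulr0n ?oppr0 // x'K opprK.
Qed.

End StandardFrame.

(** * Transport of the graded basis along a standard frame *)

Section Transport.
Variables (C : numClosedFieldType) (n : nat).
Local Notation M := 'M[C]_n.+1.
Local Notation row b := (lift ord0 (root_snd b)).
Local Notation col b := (widen_ord (leqnSn n) (root_fst b)).
Variables (h : {vspace M}) (alpha omega : 'I_n -> {scalar M}) (f : posroot n -> M).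
Variables (psi phi : M -> M).
Hypothesis frame : standard_frame h alpha f psi phi.

Let psi0 : psi 0 = 0.
Proof.
by have := frame_linear frame (-1) 0 0; rewrite scaler0 addr0 scaleN1r addNr.
Qed.

Let psi_sum (I : finType) (c : I -> C) (x : I -> M) :
  psi (\sum_i c i *: x i) = \sum_i c i *: psi (x i).
Proof.
elim: (index_enum I) => [|i r IH]; first by rewrite !big_nil psi0.
by rewrite !big_cons (frame_linear frame) IH.
Qed.

Let psiZ c x : psi (c *: x) = c *: psi x.
Proof. by have := frame_linear frame c x 0; rewrite psi0 !addr0. Qed.

Lemma root_space_eq (a a' : M -> C) x :
  (forall y, y \in h -> a y = a' y) -> root_space h a x -> root_space h a' x.
Proof. by move=> aa' [sx hx]; split=> // y yh; rewrite hx // aa'. Qed.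

Lemma root_space_psi (i j : 'I_n.+1) (a : M -> C) : i != j ->
  (forall D : 'I_n.+1 -> C, \sum_e D e = 0 -> a (psi (diagf D)) = D i - D j) ->
  root_space h a (psi (delta_mx i j)).
Proof.
move=> ij ha; split.
  apply: (frame_sl frame); rewrite /sl /= /mxtrace big1 // => e _; rewrite mxE.
  by apply/eqP; rewrite pnatr_eq0 eqb0; apply: contra ij => /andP[/eqP <- /eqP <-].
move=> y /(frame_cartan frame)[D D0 ->]; rewrite ha // -(frame_bracket frame).
have -> : lie_bracket (diagf D) (delta_mx i j) = (D i - D j) *: delta_mx i j + 0.
  rewrite addr0 /lie_bracket /diagf mul_diag_mx mul_mx_diag; apply/matrixP => e g; rewrite !mxE.
  have [->|_] := eqVneq e i; last by rewrite !mulr0 mul0r subrr.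
  have [->|_] := eqVneq g j; last by rewrite !mulr0 mul0r subrr.
  by rewrite !mulr1 mul1r.
by rewrite (frame_linear frame) psi0 addr0.
Qed.

Let row_neq_col b : row b != col b.
Proof.
apply/eqP => /(congr1 val); rewrite /= /bump /= add1n => e.
by have := root_fst_snd b; rewrite -e ltnn.
Qed.

Lemma psi_lower_root b : root_space h (fun y => - root_form alpha b y) (psi (lower_gen C b)).
Proof.
apply: root_space_psi => // D D0.
by rewrite (proj2 (frame_diag frame D0)) opprB.
Qed.

Lemma psi_raise_root b : root_space h (root_form alpha b) (psi (delta_mx (col b) (row b))).
Proof.
apply: root_space_psi => [|D D0]; first by rewrite eq_sym.
by rewrite (proj2 (frame_diag frame D0)).
Qed.

Lemma root_space0 a : root_space h a 0.
Proof.
by split=> [|y _]; rewrite /sl /= ?mxtrace0 // /lie_bracket mulmx0 mul0mx subrr scaler0.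
Qed.

Lemma root_space_nminus b x :
  root_space h (fun y => - root_form alpha b y) x -> nminus h alpha x.
Proof.
move=> hx; exists (fun c => if c == b then x else 0) => [c|].
  by case: eqP => [->//|_]; exact: root_space0.
by rewrite -big_mkcond big_pred1_eq.
Qed.

Lemma nminus_sl x : nminus h alpha x -> sl x.
Proof.
move=> [x_ hx ->]; rewrite /sl /= raddf_sum big1 // => b _; exact: (proj1 (hx b)).
Qed.

Definition psum (D : 'I_n.+1 -> C) (k : nat) : C := \sum_(a < n.+1 | (a <= k)%N) D a.

Let delta_diff (j : 'I_n) (e : 'I_n.+1) : C :=
  (e == widen_ord (leqnSn n) j)%:R - (e == lift ord0 j)%:R.

(** Abel summation: partial sums are the coordinates in the basis of simple coroots
    [diagf (delta_diff j)]. *)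
Lemma diagf_psum (D : 'I_n.+1 -> C) : \sum_e D e = 0 ->
  diagf D = \sum_(j < n) psum D j *: diagf (delta_diff j).
Proof.
move=> D0; apply/matrixP => e g; rewrite summxE mxE.
under eq_bigr do rewrite !mxE.
case: (e == g); last by rewrite mulr0n big1 // => j _; rewrite mulr0n mulr0.
rewrite mulr1n mxE.
under eq_bigr do rewrite mulr1n mulrBr.
rewrite sumrB.
have S1 : \sum_(j < n) psum D j * (e == widen_ord (leqnSn n) j)%:R = psum D e.
  have [en|ne] := ltnP e n.
    rewrite (bigD1 (Ordinal en)) //= big1 => [|j jn].
      by rewrite (_ : e == _) ?mulr1 ?addr0 //; apply/eqP/val_inj.
    by case: eqP => [ee|_]; [case/eqP: jn; apply: val_inj; rewrite /= ee|rewrite mulr0].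
  rewrite big1 => [|j _]; last by case: eqP => [ee|]; rewrite ?mulr0 //; move: ne; rewrite ee /= leqNgt ltn_ord.
  rewrite -D0 /psum; apply: eq_bigl => a; apply/esym; apply: leq_trans ne.
  by rewrite -ltnS.
have S2 : psum D e = D e + \sum_(j < n) psum D j * (e == lift ord0 j)%:R.
  case: (unliftP ord0 e) => [j ->|->].
    rewrite (bigD1 j) //= eqxx mulr1 big1 ?addr0 => [|i ij]; last first.
      by rewrite (inj_eq lift_inj) eq_sym (negbTE ij) mulr0.
    rewrite /psum (bigD1 (lift ord0 j)) ?leqnn //=; congr (_ + _); apply: eq_bigl => a.
    rewrite -val_eqE /= /bump /= add1n; lia.
  rewrite big1 => [|j _]; last by rewrite mulr0.
  rewrite addr0 /psum (big_pred1 ord0) // => a /=; rewrite leqn0.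
  by apply/eqP/eqP => [h0|->//]; apply: val_inj.
by rewrite S1 S2 addrK.
Qed.

Hypothesis homega : fundamental_weights h alpha omega.

Lemma omega_psi (D : 'I_n.+1 -> C) i : \sum_e D e = 0 -> omega i (psi (diagf D)) = psum D i.
Proof.
move=> D0; rewrite (diagf_psum D0) psi_sum linear_sum.
have ind (a : 'I_n.+1) : \sum_e (e == a)%:R = 1 :> C.
  by rewrite (bigD1 a) //= eqxx big1 ?addr0 // => e /negbTE ->.
have dd0 j : \sum_e delta_diff j e = 0 by rewrite sumrB !ind subrr.
have wl j : (widen_ord (leqnSn n) j == lift ord0 j) = false.
  by apply/eqP => /(congr1 val); rewrite /= /bump /= add1n; lia.
have alphaE (j : 'I_n) y : root_form alpha (mkroot (leqnn j)) y = alpha j y.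
  rewrite /root_form mkroot_fst mkroot_snd (big_pred1 j) // => l /=; rewrite -eqn_leq.
  by apply/eqP/eqP => [/val_inj|->].
have cor j : omega i (psi (diagf (delta_diff j))) = (i == j)%:R.
  apply: homega; split.
    rewrite -alphaE (proj2 (frame_diag frame (dd0 j))) mkroot_fst mkroot_snd /delta_diff.
    by rewrite !eqxx wl [lift _ _ == _]eq_sym wl subr0 sub0r opprK -natrD.
  set b := mkroot (leqnn j).
  exists (psi (delta_mx (col b) (row b))), (psi (lower_gen C b)); split.
  - apply: root_space_eq (psi_raise_root b) => y _; exact: alphaE.
  - by apply: root_space_eq (psi_lower_root b) => y _; rewrite alphaE.
  - rewrite -(frame_bracket frame); congr psi.
    rewrite /lie_bracket /lower_gen !mul_delta_mx; apply/matrixP => e g.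
    rewrite !mxE /delta_diff mkroot_fst mkroot_snd; have [->|eg] := eqVneq e g.
      by rewrite !andbb mulr1n.
    have nb a : (e == a) && (g == a) = false.
      by apply/negP => /andP[/eqP e1 /eqP e2]; case/eqP: eg; rewrite e1 e2.
    by rewrite mulr0n !nb subrr.
rewrite (bigD1 i) //= linearZ /= cor eqxx mulr1 big1 ?addr0 // => j ji.
by rewrite linearZ /= cor eq_sym (negbTE ji) mulr0.
Qed.

Variables (V : lmodType C) (rho : M -> {linear V -> V}) (v : V) (m : 'I_n -> nat).
Hypothesis hrho : sl_representation rho.
Hypothesis hirr : irreducible rho.
Hypothesis hv : highest_weight_vector rho h alpha (weight omega m) v.

Local Notation rho' := (fun x => rho (psi x)).

Lemma transport_rep : sl_representation rho'.
Proof.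
split=> [a x y u sx sy|x y u sx sy].
  by rewrite (frame_linear frame) (proj1 hrho) //; apply: (frame_sl frame).
by rewrite (frame_bracket frame) (proj2 hrho) //; apply: (frame_sl frame).
Qed.

Lemma transport_irr : irreducible rho'.
Proof.
split=> [|W sW hW]; first exact: (proj1 hirr).
apply: (proj2 hirr) => // x u sx Wu; rewrite -(frame_phiK frame x).
by apply: hW => //; apply: (frame_sl_phi frame).
Qed.

Lemma transport_hw x : sl x -> is_upper x -> rho' x v = highest_weight m x *: v.
Proof.
move=> sx ux; have [_ hup hh] := hv.
pose D (a : 'I_n.+1) := x a a.
have D0 : \sum_e D e = 0 by [].
pose y := \sum_b x (col b) (row b) *: delta_mx (col b) (row b) : M.
have xE : x = 1 *: diagf D + y.
  rewrite scale1r; apply/matrixP => i j; rewrite !mxE summxE.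
  have [->|ij] := eqVneq i j.
    rewrite mulr1n big1 ?addr0 // => b _; rewrite !mxE.
    case: eqP => [e1|_]; last by rewrite mulr0.
    case: eqP => [e2|_]; last by rewrite mulr0.
    by have := row_neq_col b; rewrite -e1 -e2 eqxx.
  rewrite mulr0n add0r; have [lt|le] := ltnP i j; last first.
    rewrite ux; last by rewrite ltn_neqAle le andbT eq_sym val_eqE.
    rewrite big1 // => b _; rewrite !mxE.
    case: eqP => [e1|_]; last by rewrite mulr0.
    case: eqP => [e2|_]; last by rewrite mulr0.
    by move: le (root_fst_snd b); rewrite e1 e2 /= /bump /= add1n; lia.
  have hi : (i < n)%N by apply: leq_trans lt _; rewrite -ltnS ltn_ord.
  have hj : (j.-1 < n)%N by have := ltn_ord j; lia.
  have hij : (Ordinal hi <= Ordinal hj)%N by rewrite /=; lia.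
  have eci : widen_ord (leqnSn n) (Ordinal hi) = i by apply: val_inj.
  have erj : lift ord0 (Ordinal hj) = j.
    by apply: val_inj; rewrite /= /bump /= add1n prednK //; lia.
  rewrite (bigD1 (mkroot hij)) //= big1 ?addr0 => [|b nb].
    by rewrite !mxE mkroot_fst mkroot_snd eci erj !eqxx mulr1.
  rewrite !mxE; case: eqP => [e1|_]; last by rewrite mulr0.
  case: eqP => [e2|_]; last by rewrite mulr0.
  case/eqP: nb; apply: root_inj; apply: val_inj; rewrite ?mkroot_fst ?mkroot_snd /= ?e1 //.
  by rewrite e2.
have ypsi : psi y = \sum_b psi (x (col b) (row b) *: delta_mx (col b) (row b)).
  by rewrite /y psi_sum; apply: eq_bigr => b _; rewrite psiZ.
have nupper : nplus h alpha (psi y).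
  exists (fun b => psi (x (col b) (row b) *: delta_mx (col b) (row b))) => // b.
  rewrite psiZ; have [s1 hs] := psi_raise_root b; split; first by rewrite /sl /= mxtraceZ s1 mulr0.
  move=> z zh; rewrite /lie_bracket -scalemxAr -scalemxAl -scalerBr.
  by rewrite -[X in _ *: X]/(lie_bracket _ _) hs // !scalerA mulrC.
have sly : sl y.
  have -> : y = (-1) *: diagf D + x by rewrite xE scale1r scaleN1r addKr.
  by apply: sl_sub => //; rewrite /sl /= tr_diagf.
have sld : sl (diagf D) by rewrite /sl /= tr_diagf.
have [dh _] := frame_diag frame D0.
rewrite {1}xE (proj1 transport_rep) // scale1r (hup (psi y)) // addr0 hh //; congr (_ *: _).
rewrite /weight /highest_weight; apply: eq_bigr => i _; congr (_ * _).
exact: omega_psi.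
Qed.

Local Notation F := (pbw_filtration rho (nminus h alpha) v).

Lemma v_neq0 : v <> 0. Proof. by case: hv. Qed.

(** From left to right, any element of sl raises the word filtration by at most one, so n^- need not
    be shown to be spanned by the standard root vectors. *)
Lemma pbw_fil_word k z : F k z <-> fil_word rho' v k z.
Proof.
split.
  apply: lin_span_min; first exact: fil_word_sub.
  move=> _ [xs [sk hxs ->]]; apply: (fil_word_mono sk).
  elim: xs hxs {sk} => [_|x xs IH hxs]; first exact: (@fil_word_wact _ _ _ rho' v [::]).
  rewrite /= -(frame_phiK frame x).
  apply: (fil_word_sl transport_rep transport_hw).
    by apply/(frame_sl_phi frame)/nminus_sl/hxs; rewrite mem_head.
  by apply: IH => y yx; apply: hxs; rewrite inE yx orbT.
apply: lin_span_sub => _ [u uk ->]; exists [seq psi (lower_gen C b) | b <- u]; split.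
- by rewrite size_map.
- by move=> _ /mapP[b _ ->]; apply: (root_space_nminus (b := b)); apply: psi_lower_root.
- by elim: u {uk} => //= b u; rewrite /wact /= => ->.
Qed.

Lemma pbw_fil_below k z : fil_prev F k z <-> fil_below rho' v k z.
Proof. by case: k => [|k] //=; exact: pbw_fil_word. Qed.

Lemma root_vector_word (s : {ffun posroot n -> nat}) : exists2 K : C, K != 0 &
  foldr (fun b => iter (s b) (rho (f b))) v (enum {: posroot n}) =
  K *: wact rho' v (content_word s).
Proof.
rewrite /content_word; elim: (enum _) => [|b r [K K0 IH]].
  by exists 1; rewrite ?oner_neq0 // scale1r.
have [k k0 fE] := frame_root frame b; exists (k ^+ s b * K).
  by rewrite mulf_neq0 // expf_neq0.
rewrite [LHS]/= IH /= /wact /word_act foldr_cat.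
set z := foldr _ v _; elim: (s b) => [|l IHl]; first by rewrite expr0 mul1r.
have sf : sl (psi (lower_gen C b)) by apply/(frame_sl frame)/sl_lower.
rewrite iterS IHl fE -[k *: _]addr0 (proj1 hrho) //; last exact: sl0.
by rewrite (act0 hrho) addr0 linearZ scalerA exprS mulrA.
Qed.

Theorem pbw_basis : is_basis (S_lambda m) (pbw_monomial rho (nminus h alpha) v f).
Proof.
pose e (s : {ffun posroot n -> nat}) :=
  foldr (fun b => iter (s b) (rho (f b))) v (enum {: posroot n}).
have -> : pbw_monomial rho (nminus h alpha) v f = fun s => gr_class F (content_size s) (e s).
  apply: funext => s; apply: pbw_monomialE => b; have [k k0 ->] := frame_root frame b.
  have [s1 hs] := psi_lower_root b; apply: (root_space_nminus (b := b)); split.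
    by rewrite /sl /= mxtraceZ s1 mulr0.
  move=> z zh; rewrite /lie_bracket -scalemxAr -scalemxAl -scalerBr.
  by rewrite -[X in _ *: X]/(lie_bracket _ _) hs // !scalerA mulrC.
have /choice[K hK] : forall s, exists K, K != 0 /\ e s = K *: wact rho' v (content_word s).
  by move=> s; have [K] := root_vector_word s; exists K.
have size_cw s : size (content_word s) = content_size s.
  exact/content_sizeE/content_wordP.
apply: gr_basis.
- move=> s; apply/pbw_fil_word; have [_ ->] := hK s.
  by apply: submoduleZ; [exact: fil_word_sub|apply: fil_word_wact; rewrite size_cw].
- move=> k z /pbw_fil_word Fz.
  pose B z := exists2 R : seq (C * {ffun posroot n -> nat}),
    (forall t, t \in R -> S_lambda m t.2 /\ content_size t.2 = k) &
    fil_below rho' v k (z - \sum_(t <- R) t.1 *: e t.2).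
  suff [R hR hz] : B z by exists R => //; apply/pbw_fil_below.
  have subB : submodule B.
    split; first by exists [::]; rewrite ?big_nil ?subr0 //; apply: (proj1 (fil_below_sub _ _ _)).
    move=> a x y [R1 h1 hx] [R2 h2 hy]; exists ([seq (a * t.1, t.2) | t <- R1] ++ R2).
      by move=> t; rewrite mem_cat => /orP[/mapP[t' /h1 ? ->]|/h2].
    have := proj2 (fil_below_sub rho' v k) a _ _ hx hy; congr (fil_below _ _ _ _).
    rewrite big_cat big_map /= scalerBr addrACA -opprD; congr (_ - (_ + _)).
    by rewrite scaler_sumr; apply: eq_bigr => t _; rewrite scalerA.
  apply: (lin_span_min subB) Fz => _ [u uk ->].
  have : S_span rho' v m (size u) (wact rho' v u).
    exact: wact_S_span transport_rep transport_irr v_neq0 transport_hw u.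
  apply: (lin_span_min subB) => _ [w [s Ss [ws wu ->]]].
  have [k0 Ek] := hK s; have [wk|wk] := ltnP (size w) k.
    exists [::] => //; rewrite big_nil subr0; case: k wk {B subB uk} => // k wk.
    exact: fil_word_wact.
  have sw : size w = k by apply/eqP; rewrite eqn_leq wk (leq_trans wu).
  (* The letters of [w] may come in any order; rearranging them into [content_word s] costs lower
     degree, and [K s] undoes the scaling of the chosen root vectors. *)
  exists [:: ((K s)^-1, s)].
    by move=> t; rewrite inE => /eqP ->; split=> //; rewrite -(content_sizeE ws).
  rewrite big_seq1 Ek scalerA mulVf // scale1r -sw; apply: (wact_perm transport_rep transport_hw).
  apply/allP => b _; apply/eqP; rewrite /=.
  by move/has_contentP: ws => ->; have /has_contentP -> := content_wordP s.
- move=> k r c ur hr /pbw_fil_below hc s sr.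
  have [K0 _] := hK s.
  have hc' : fil_below rho' v k (\sum_(s <- r) (c s * K s) *: wact rho' v (content_word s)).
    move: hc; congr (fil_below _ _ _ _); apply: eq_bigr => t _.
    by have [_ ->] := hK t; rewrite scalerA.
  have := wact_indep transport_rep v_neq0 transport_hw ur hr hc' sr.
  by move/eqP; rewrite mulf_eq0 (negbTE K0) orbF => /eqP.
Qed.

End Transport.

Theorem theoremB (R : realType) (n : nat)
  (h : {vspace 'M[R[i]]_n.+1}) (alpha omega : 'I_n -> {scalar 'M[R[i]]_n.+1})
  (f : posroot n -> 'M[R[i]]_n.+1) (m : 'I_n -> nat)
  (V : lmodType R[i]) (rho : 'M[R[i]]_n.+1 -> {linear V -> V}) (v : V)
  (hcartan : cartan_decomposition h alpha)
  (homega : fundamental_weights h alpha omega)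
  (hf : forall b : posroot n,
     root_space h (fun y => - root_form alpha b y) (f b) /\ f b <> 0)
  (hrho : sl_representation rho)
  (hirr : irreducible rho)
  (hv : highest_weight_vector rho h alpha (weight omega m) v) :
  is_basis (S_lambda m) (pbw_monomial rho (nminus h alpha) v f).
Proof.
have [psi [phi frame]] := standard_frame_ex hcartan hf.
exact (pbw_basis frame homega hrho hirr hv).
Qed.
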